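(* Let $(T_j)_{j\ge 1}$, $N$, $m$, $Z_n$ and $Z$ be as in the context (in particular $\mathbb{E}[\sum_{j=1}^N T_j]=1$). Suppose that $N>0$ a.s., that $\mathbb{E}[N]>1$, that $m(\alpha)=1$ for some $\alpha\in(1,2)$, and that $Z_n$ converges a.s. and in $L^1$ to $Z$. (i) Suppose in addition that $\mathrm{supp}(Z)\nsubseteq\mathbb{R}$ and that $$\mathbb{E}[N^2]<\infty\quad\text{and}\quad \mathbb{E}\Big[N\sum_{j=1}^N\log_+|T_j|\Big]<\infty.$$ Then the law of $Z$ is absolutely continuous (with respect to Lebesgue measure on $\mathbb{C}\simeq\mathbb{R}^2$). (ii) If instead $\mathrm{supp}(Z)\subset\mathbb{R}$, and $\mathbb{E}[N]<\infty$, then the law of $Z$ is absolutely continuous (with respect to Lebesgue measure on $\mathbb{R}$). This applies in particular when the $T_j$ are real-valued.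
   Context: $(T_j)_{j\ge1}$ is a sequence of complex-valued random variables on a common probability space (with arbitrary joint dependence) such that $$N:=\#\{j: T_j\neq 0\}=\max\{j: T_j\neq 0\}<\infty\quad\text{a.s.}$$ (so $T_1,\dots,T_N$ are nonzero and $T_j=0$ for $j>N$). Set $m(s):=\mathbb{E}\big[\sum_{j=1}^N|T_j|^s\big]$, so $m(0)=\mathbb{E}[N]$. Weighted branching process: let $\mathbb{V}=\bigcup_{n\ge0}\mathbb{N}^n$ be the infinite Harris–Ulam tree with root $\emptyset$, and let $|v|$ denote the generation of $v\in\mathbb{V}$. To each $v\in\mathbb{V}$ attach an independent copy $(T_j(v))_{j\ge1}$ of $(T_j)_{j\ge1}$. Set $L(\emptyset):=1$ and $L(vi):=T_i(v)L(v)$ for $v\in\mathbb{V}$, $i\in\mathbb{N}$, where $vi$ is concatenation. Standing assumption: $\mathbb{E}[\sum_{j=1}^N T_j]=1$, so that $Z_n:=\sum_{|v|=n}L(v)$, $n\ge 0$, is a $\mathbb{C}$-valued martingale with mean one. When $Z_n$ converges a.s. and in $L^1$, $Z:=\lim_{n\to\infty}Z_n$. Here $\mathrm{supp}(Z)$ denotes the support of the law of $Z$, and $\log_+x=\max(\log x,0)$.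
   Formalization: In (ii), including the absolute continuity claimed for real-valued T_j, Z is additionally assumed not a.s. constant; otherwise it fails, e.g. for T=(3/5,3/5,-1/5), where Z=1. *)

(* Defs.v *)
From HB Require Import structures.
From mathcomp Require Import all_boot all_order all_algebra finmap.
From mathcomp Require Import all_classical all_reals all_analysis.
From mathcomp Require Import complex.

Set Implicit Arguments.
Unset Strict Implicit.
Unset Printing Implicit Defensive.

Import Order.TTheory GRing.Theory Num.Theory.
Import numFieldNormedType.Exports.

Local Open Scope classical_set_scope.
Local Open Scope ring_scope.

Notation Re := (@complex.Re _).
Notation Im := (@complex.Im _).
Notation normc := Normc.normc.

(* The Borel sigma-algebra of C = R^2, generated by the two coordinates. *)
HB.instance Definition _ (R : realType) := isPointed.Build R[i] 0.
HB.instance Definition _ (R : realType) :=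
  @isMeasurable.Build (measure_prod_display (R.-ocitv.-measurable.-sigma,
                                             R.-ocitv.-measurable.-sigma)%mdisp)
    R[i] (@g_sigma_preimageU _ _ (measurableTypeR R) (measurableTypeR R) _ Re Im)
    (@sigma_algebra0 _ _ _) (@sigma_algebraC _ _) (@sigma_algebra_bigcup _ _ _).

Definition lebesgueC {R : realType} : set R[i] -> \bar R :=
  pushforward (@lebesgue_measure R \x @lebesgue_measure R)%E
    (fun p => Complex p.1 p.2).

Definition supp {R : realType} (mu : set R[i] -> \bar R) : set R[i] :=
  [set z | forall e : R, 0 < e -> (0 < mu [set x | (normc (x - z) < e)%R])%E].

Definition real_line {R : realType} : set R[i] := [set z | Im z = 0].

(* C^nat with the product sigma-algebra. *)
Definition cseq (R : realType) : Type := g_sigma_algebraType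
  (\bigcup_(j in [set: nat])
     preimage_set_system setT (fun x : nat -> R[i] => x j) measurable).

(* Indices start at 0: T 0, T 1, ... stand for T_1, T_2, ..., and the tree is
   seq nat, with root [::] and with rcons v i for the child vi of v. *)
Section Weights.
Context {R : realType} {d : measure_display} {Omega : measurableType d}.
Variables (P : probability Omega R) (T : nat -> Omega -> R[i]).

(* This is 0 when infinitely many weights are nonzero. *)
Definition nweights (w : Omega) : nat :=
  #|` fset_set [set j | T j w != 0] |.

(* The number of nonzero weights is a.s. finite, and the nonzero weights are
   exactly the first ones. *)
Definition weights_initial : Prop :=
  {ae P, forall w, [set j | T j w != 0] = `I_(nweights w)}.

Definition weight_sum (w : Omega) : R[i] := \sum_(j < nweights w) T j w.

Definition moment (s : R) : \bar R :=
  ('E_P[fun w => (\sum_(j < nweights w) normc (T j w) `^ s)%R])%E.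

Definition rand_seq (w : Omega) : cseq R := fun j => T j w.

End Weights.

Definition logp {R : realType} (x : R) : R := Num.max (ln x) 0.

Definition has_expectation {R : realType} {d : measure_display}
    {Omega : measurableType d} (P : probability Omega R)
    (X : Omega -> R[i]) (c : R[i]) : Prop :=
  [/\ P.-integrable setT (EFin \o Re \o X),
      P.-integrable setT (EFin \o Im \o X),
      'E_P[Re \o X] = (Re c)%:E & 'E_P[Im \o X] = (Im c)%:E]%E.

(* Nothing else in the setting prevents Z from being a.s. constant (equal to its
   mean 1): for the deterministic weights T_1, T_2 = 1/2 +- it with
   |T_1| = |T_2| = 2 ^ (- 2/3) and alpha = 3/2, and likewise for the real
   weights 3/5, 3/5, -1/5 and some alpha in (1, 2), every Z_n equals 1. *)
Definition degenerate {R : realType} {d : measure_display}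
    {Omega : measurableType d} (P : probability Omega R)
    (X : Omega -> R[i]) : Prop :=
  exists c : R[i], {ae P, forall w, X w = c}.

Section Branching.
Context {R : realType} {d : measure_display} {Omega : measurableType d}.
Variables (P : probability Omega R) (TV : seq nat -> nat -> Omega -> R[i]).

Definition copies_of {d0 : measure_display} {Omega0 : measurableType d0}
    (P0 : probability Omega0 R) (T : nat -> Omega0 -> R[i]) : Prop :=
  forall (v : seq nat) (B : set (cseq R)), measurable B ->
    P (rand_seq (TV v) @^-1` B) = P0 (rand_seq T @^-1` B).

Definition independent_copies : Prop :=
  forall (s : seq (seq nat)) (B : seq nat -> set (cseq R)),
    uniq s -> (forall v, measurable (B v)) ->
    P (\bigcap_(v in [set` s]) rand_seq (TV v) @^-1` B v) =
    (\prod_(v <- s) P (rand_seq (TV v) @^-1` B v))%E.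

Definition path_weight (v : seq nat) (w : Omega) : R[i] :=
  \prod_(k < size v) TV (take k v) (nth 0%N v k) w.

(* The sum has finitely many nonzero terms a.s., and is 0 otherwise. *)
Definition Zn (n : nat) (w : Omega) : R[i] :=
  \sum_(v \in [set v : seq nat | size v = n]) path_weight v w.

Definition Zn_cvg_as (Z : Omega -> R[i]) : Prop :=
  {ae P, forall w, normc (Zn n w - Z w) @[n --> \oo] --> (0 : R)}.

Definition Zn_cvg_L1 (Z : Omega -> R[i]) : Prop :=
  ('E_P[fun w => normc (Zn n w - Z w)%R])%E @[n --> \oo] --> 0%E.

Lemma path_weight_nil (w : Omega) : path_weight [::] w = 1.
Proof. by rewrite /path_weight big_ord0. Qed.

Lemma path_weight_rcons (v : seq nat) (i : nat) (w : Omega) :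
  path_weight (rcons v i) w = TV v i w * path_weight v w.
Proof.
rewrite /path_weight size_rcons big_ord_recr /= mulrC; congr (_ * _).
  by rewrite -cats1 take_size_cat// nth_cat ltnn subnn.
apply: eq_bigr => k _; rewrite -cats1 nth_cat ltn_ord takel_cat//.
exact: ltnW.
Qed.

End Branching.

Section Laws.
Context {R : realType} {d : measure_display} {Omega : measurableType d}.
Variables (P : probability Omega R) (X : {RV P >-> R[i]}).

Definition abs_cont_law_C : Prop := distribution P X `<< lebesgueC.

(* Meant for an X that is a.s. real: the law is then carried by the real line,
   which Re identifies with R. *)
Definition abs_cont_law_R : Prop :=
  pushforward (distribution P X) (Re : R[i] -> measurableTypeR R)
    `<< lebesgue_measure.

End Laws.

(* Main.v *)
Require Import Defs.
From HB Require Import structures.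
From mathcomp Require Import all_boot all_order all_algebra.
From mathcomp Require Import all_classical all_reals all_analysis.
From mathcomp Require Import complex.
From mathcomp Require Import measurable_realfun ring lra.

Set Implicit Arguments.
Unset Strict Implicit.
Unset Printing Implicit Defensive.

Import Order.TTheory GRing.Theory Num.Theory.
Import numFieldNormedType.Exports.

Local Open Scope classical_set_scope.
Local Open Scope ring_scope.

Local Notation Re := (@complex.Re _).
Local Notation Im := (@complex.Im _).

(* Write e(x) = cos x + i sin x, phi(t) = E e(Re(t Z)), and xi_j for the root
   weights.  A functional F of a subtree is weighted into E[F e(Re(t Z))].
   Conditioning on the root turns the functional prod_j F(subtree j) at the
   frequency t into the product of the weighted transforms at the frequencies
   t xi_j; this gives |phi(t)| <= E prod_j |phi(t xi_j)| and its analogue for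
   linear combinations of functionals, with j restricted to good children (those
   among the first J ones with |xi_j| >= del).

   Let V be the plane in case (i) and the real line in case (ii).  If Re(t Z) is
   nonconstant for every t <> 0 in V, then |phi(t)| <= 1 - c |t|^2 near 0.
   Comparing 1 - |phi| with c0 (1 - (|t| / R)^alpha) along the tree, where
   m(alpha) = 1 and E[N] > 1, yields sup |phi| < 1 away from 0, and iterating the
   inequality yields phi -> 0 at infinity, because a node rarely has only bad
   children and has two good ones with positive probability.  No rate follows, so
   one discards a part of the probability space: a functional w_k with values in
   [0, 1] and E[1 - w_k] <= eps is defined recursively so that the transform of
   w_(k+1) is a second difference of products of transforms of w_k.  It is
   therefore squared at each step, and for k large the transform of w_k is at most
   C / (1 + |t|)^4 up to any given frequency, with C independent of k.  Testing
   against Dirichlet kernels bounds the w_k-weighted mass of dyadic cubes by their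
   volume; by approximation every null set has probability at most 2 eps.

   If Re(t Z) is constant for some t <> 0, then |phi(t xi_j / n)| = 1 for all n, so
   Re(t xi_j Z) is constant too; hence either Z is constant or all weights are
   real.  A constant limit is real: if Z = c <> 0 then sum_j xi_j = 1 at every
   node, so that Z_n = 1.  Thus Z is real, which is excluded in case (i); in case
   (ii), taking t = i, the weights are real and V is stable under t -> t xi_j. *)

(** * Bounded functions and their expectation *)

(** The obstacle to a rate is the chance that no child is good: it adds a constant to every
    one-generation bound, so |phi| can be pushed below any level but its decrease is not quantified.
    Second differences remove this constant. With no good child, the three products for z = 1, 1/2,
    0 are all empty and cancel, as 1 - 2 + 1 = 0; otherwise the second difference of a product is
    quadratically small in the first differences of its factors. This is why the functionals are
    built from three values of z and why the smoothing inequality is stated for linear combinations.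
    The price is a loss of mass of at most twice the mean of the functional for z = 1/2; it stays
    below eps for all k because the contraction restarts each time from the level 3/4. The exponent
    4 of the decay gives 2 to each coordinate, which makes the sums over differences of Dirichlet
    frequencies converge; repeated squaring over geometrically growing radii beats every power. *)

Section Bounded.
Context {R : realType} {d : measure_display} {T : measurableType d}.
Implicit Types f g : T -> R.

(** Boundedness is required everywhere, not almost everywhere, so that the condition refers to no
    measure and passes to compositions, sections and products. *)
Definition bmf f := measurable_fun [set: T] f /\ exists M, forall x, `|f x| <= M.

Lemma bmf_cst c : bmf (fun=> c).
Proof. by split; [exact: measurable_cst|exists `|c|]. Qed.

Lemma bmfD f g : bmf f -> bmf g -> bmf (fun x => f x + g x).
Proof.
move=> [mf [M fM]] [mg [N gN]]; split; first exact: measurable_funD.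
by exists (M + N) => x; rewrite (le_trans (ler_normD _ _))// lerD.
Qed.

Lemma bmfM f g : bmf f -> bmf g -> bmf (fun x => f x * g x).
Proof.
move=> [mf [M fM]] [mg [N gN]]; split; first exact: measurable_funM.
by exists (M * N) => x; rewrite normrM ler_pM.
Qed.

Lemma bmfZ c f : bmf f -> bmf (fun x => c * f x).
Proof. by move=> bf; apply: (bmfM (bmf_cst c)). Qed.

Lemma bmfN f : bmf f -> bmf (fun x => - f x).
Proof.
move=> [mf [M fM]]; split; first exact: measurableT_comp.
by exists M => x; rewrite normrN.
Qed.

Lemma bmfB f g : bmf f -> bmf g -> bmf (fun x => f x - g x).
Proof. by move=> bf bg; exact: bmfD bf (bmfN bg). Qed.

Lemma bmf_sum (I : Type) (s : seq I) (F : I -> T -> R) :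
  (forall i, bmf (F i)) -> bmf (fun x => \sum_(i <- s) F i x).
Proof.
move=> bF; elim: s => [|a s IH].
  by under eq_fun do rewrite big_nil; exact: bmf_cst.
by under eq_fun do rewrite big_cons; exact: bmfD.
Qed.

Lemma bmf_prod (I : Type) (s : seq I) (F : I -> T -> R) :
  (forall i, bmf (F i)) -> bmf (fun x => \prod_(i <- s) F i x).
Proof.
move=> bF; elim: s => [|a s IH].
  by under eq_fun do rewrite big_nil; exact: bmf_cst.
by under eq_fun do rewrite big_cons; exact: bmfM.
Qed.

Lemma bmf_cos f : measurable_fun [set: T] f -> bmf (fun x => cos (f x)).
Proof.
move=> mf; split; last by exists 1 => x; exact: cos_max.
apply: measurableT_comp => //.
by apply: continuous_measurable_fun => x; exact: continuous_cos.
Qed.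

Lemma bmf_sin f : measurable_fun [set: T] f -> bmf (fun x => sin (f x)).
Proof.
move=> mf; split; last by exists 1 => x; exact: sin_max.
apply: measurableT_comp => //.
by apply: continuous_measurable_fun => x; exact: continuous_sin.
Qed.

Lemma bmf_ind (A : set T) : measurable A -> bmf (\1_A : T -> R).
Proof.
move=> mA; split; first exact: measurable_indic.
by exists 1 => x; rewrite indicE; case: (_ \in _); rewrite ?normr1 ?normr0.
Qed.

Lemma bmf_if (b : T -> bool) f g : measurable_fun [set: T] b ->
  bmf f -> bmf g -> bmf (fun x => if b x then f x else g x).
Proof.
move=> mb [mf [M fM]] [mg [N gN]]; split.
  exact: measurable_fun_ifT.
by exists (Num.max M N) => x; case: ifP => _; rewrite le_max ?fM ?gN ?orbT.
Qed.

Lemma bmf_norm f : bmf f -> bmf (fun x => `|f x|).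
Proof.
move=> [mf [M fM]]; split; first exact: measurableT_comp.
by exists M => x; rewrite normr_id.
Qed.

End Bounded.

Lemma bmf_comp {R : realType} d d' (T : measurableType d) (T' : measurableType d')
    (h : T' -> T) (f : T -> R) : measurable_fun [set: T'] h -> bmf f ->
  bmf (fun x => f (h x)).
Proof.
move=> mh [mf [M fM]]; split; first exact: (measurableT_comp mf mh).
by exists M => x; exact: fM.
Qed.

Section Expect.
Context {R : realType} {d : measure_display} {T : measurableType d}.
Variable P : probability T R.
Implicit Types f g : T -> R.

Lemma bmf_int f : bmf f -> P.-integrable setT (EFin \o f).
Proof.
move=> [mf [M fM]]; apply: (@le_integrable _ _ _ P setT measurableT _ (cst M%:E)).
- exact/measurable_EFinP.
- move=> x _ /=; rewrite lee_fin (le_trans (fM x))//; exact: ler_norm.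
- exact: finite_measure_integrable_cst.
Qed.

Definition Ex f : R := \int[P]_x f x.

Lemma Ex_cst c : Ex (fun=> c) = c.
Proof. by rewrite /Ex Rintegral_cst//= probability_setT mulr1. Qed.

Lemma ExD f g : bmf f -> bmf g -> Ex (fun x => f x + g x) = Ex f + Ex g.
Proof. by move=> /bmf_int bf /bmf_int bg; exact: RintegralD. Qed.

Lemma ExB f g : bmf f -> bmf g -> Ex (fun x => f x - g x) = Ex f - Ex g.
Proof. by move=> /bmf_int bf /bmf_int bg; exact: RintegralB. Qed.

Lemma ExZ c f : bmf f -> Ex (fun x => c * f x) = c * Ex f.
Proof. by move=> /bmf_int bf; exact: RintegralZl. Qed.

Lemma Ex_sum (I : Type) (s : seq I) (F : I -> T -> R) :
  (forall i, bmf (F i)) ->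
  Ex (fun x => \sum_(i <- s) F i x) = \sum_(i <- s) Ex (F i).
Proof.
move=> bF; elim: s => [|a s IH].
  by under [LHS]eq_Rintegral do rewrite big_nil; rewrite big_nil; exact: Ex_cst.
under [LHS]eq_Rintegral do rewrite big_cons.
by rewrite big_cons -IH; apply: ExD => //; exact: bmf_sum.
Qed.

Lemma le_Ex f g : bmf f -> bmf g -> (forall x, f x <= g x) -> Ex f <= Ex g.
Proof. by move=> /bmf_int bf /bmf_int bg fg; apply: le_Rintegral. Qed.

Lemma eq_Ex f g : (forall x, f x = g x) -> Ex f = Ex g.
Proof. by move=> fg; congr Ex; exact/funext. Qed.

Lemma Ex_ae f g : bmf f -> bmf g -> {ae P, forall x, f x = g x} -> Ex f = Ex g.
Proof.
move=> bf bg fg; congr fine; apply: ae_eq_integral => //.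
- by have /integrableP[] := bmf_int bf.
- by have /integrableP[] := bmf_int bg.
- by apply: filterS fg => x -> _.
Qed.

Lemma bmf_max f g : bmf f -> bmf g -> bmf (fun x => Num.max (f x) (g x)).
Proof.
move=> [mf [M fM]] [mg [N gN]]; split.
  exact: measurable_maxr.
exists (Num.max M N) => x; case: (leP (f x) (g x)) => _; rewrite le_max ?fM ?gN ?orbT//.
Qed.

Lemma le_Ex_ae f g : bmf f -> bmf g -> {ae P, forall x, f x <= g x} ->
  Ex f <= Ex g.
Proof.
move=> bf bg fg; have bm := bmf_max bf bg.
have -> : Ex g = Ex (fun x => Num.max (f x) (g x)).
  apply: Ex_ae => //; apply: filterS fg => x fgx.
  by rewrite max_r.
by apply: le_Ex => // x; rewrite le_max lexx.
Qed.

Lemma Ex_ge0 f : (forall x, 0 <= f x) -> 0 <= Ex f.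
Proof. by move=> f0; apply: Rintegral_ge0. Qed.

Lemma Ex_eq0 f : bmf f -> (forall x, 0 <= f x) -> Ex f = 0 ->
  {ae P, forall x, f x = 0}.
Proof.
move=> bf f0 Ef; have := integrable_fin_num measurableT (bmf_int bf).
move=> fin; have E0 : (\int[P]_x (f x)%:E = 0)%E.
  by rewrite -(fineK fin) -[fine _]/(Ex f) Ef.
have mf : measurable_fun setT (EFin \o f) by apply/measurable_EFinP; case: bf.
have := (ae_eq_integral_abs P measurableT mf).1.
have -> : (\int[P]_x `|(EFin \o f) x| = \int[P]_x (f x)%:E)%E.
  by apply: eq_integral => x _ /=; rewrite ger0_norm.
by move=> /(_ E0); apply: filterS => x /(_ I) /= [].
Qed.

Lemma le_norm_Ex f : bmf f -> `|Ex f| <= Ex (fun x => `|f x|).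
Proof. by move=> /bmf_int bf; exact: le_normr_Rintegral. Qed.

Lemma Ex_dct (F : nat -> T -> R) f M : (forall n, measurable_fun setT (F n)) ->
  (forall n x, `|F n x| <= M) -> measurable_fun setT f ->
  {ae P, forall x, F n x @[n --> \oo] --> f x} ->
  Ex (F n) @[n --> \oo] --> Ex f.
Proof.
move=> mF FM mf Ff.
have [|||||fi _ cvE] := @dominated_convergence _ _ _ P setT measurableT
  (fun n => EFin \o F n) (EFin \o f) (cst M%:E).
- by move=> n; apply/measurable_EFinP.
- exact/measurable_EFinP.
- by apply: filterS Ff => x Fx _; apply: cvg_EFin => //; exact: nearW.
- exact: finite_measure_integrable_cst.
- by apply: aeW => x n _ /=; rewrite lee_fin.
apply: fine_cvg; rewrite fineK//.
exact: integrable_fin_num.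
Qed.

Lemma Ex_ind (A : set T) : measurable A -> Ex (\1_A) = fine (P A).
Proof. by move=> mA; rewrite /Ex /Rintegral integral_indic ?setIT. Qed.

End Expect.

(** * Complex-valued random variables *)

Section ComplexNorm.
Context {R : realType}.
Implicit Types x y z : R[i].

Lemma cReD x y : Re (x + y) = Re x + Re y. Proof. by case: x; case: y. Qed.
Lemma cImD x y : Im (x + y) = Im x + Im y. Proof. by case: x; case: y. Qed.
Lemma cReN x : Re (- x) = - Re x. Proof. by case: x. Qed.
Lemma cImN x : Im (- x) = - Im x. Proof. by case: x. Qed.
Lemma cReB x y : Re (x - y) = Re x - Re y. Proof. by rewrite cReD cReN. Qed.
Lemma cImB x y : Im (x - y) = Im x - Im y. Proof. by rewrite cImD cImN. Qed.
Lemma cReM x y : Re (x * y) = Re x * Re y - Im x * Im y.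
Proof. by case: x; case: y. Qed.
Lemma cImM x y : Im (x * y) = Re x * Im y + Im x * Re y.
Proof. by case: x => a b; case: y => c e /=; rewrite [b * c]mulrC. Qed.

Lemma complex_ext x y : Re x = Re y -> Im x = Im y -> x = y.
Proof. by case: x => a b; case: y => c e /= -> ->. Qed.

Lemma Re_sum I (s : seq I) (F : I -> R[i]) :
  Re (\sum_(i <- s) F i) = \sum_(i <- s) Re (F i).
Proof. by elim/big_rec2: _ => // i y1 y2 _ <-; rewrite cReD. Qed.

Lemma Im_sum I (s : seq I) (F : I -> R[i]) :
  Im (\sum_(i <- s) F i) = \sum_(i <- s) Im (F i).
Proof. by elim/big_rec2: _ => // i y1 y2 _ <-; rewrite cImD. Qed.

Lemma cnormE x : normc x = Num.sqrt (Re x ^+ 2 + Im x ^+ 2).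
Proof. by case: x. Qed.

Lemma normc_ge0 x : 0 <= normc x.
Proof. by rewrite cnormE sqrtr_ge0. Qed.

Lemma normc_sqr x : normc x ^+ 2 = Re x ^+ 2 + Im x ^+ 2.
Proof. by rewrite cnormE sqr_sqrtr// addr_ge0// sqr_ge0. Qed.

Lemma normcM x y : normc (x * y) = normc x * normc y.
Proof. exact: Normc.normcM. Qed.

Lemma cnormN x : normc (- x) = normc x.
Proof. exact: normcN. Qed.

Lemma normc_triangle x y : normc (x + y) <= normc x + normc y.
Proof. exact: le_normcD. Qed.

Lemma normc_triangleB x y : normc (x - y) <= normc x + normc y.
Proof. by rewrite -(cnormN y) normc_triangle. Qed.

Lemma normc_distl x y : `|normc x - normc y| <= normc (x - y).
Proof.
have H (u v : R[i]) : normc u - normc v <= normc (u - v).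
  by rewrite lerBlDr -{1}(subrK v u); exact: normc_triangle.
by rewrite ler_norml H andbT lerNl opprB (le_trans (H _ _))// -cnormN opprB.
Qed.

Lemma normc_eq0 x : (normc x == 0) = (x == 0).
Proof.
by apply/eqP/eqP => [/Normc.eq0_normc//|->]; rewrite cnormE/= expr0n addr0 sqrtr0.
Qed.

Lemma normc_gt0 x : (0 < normc x) = (x != 0).
Proof. by rewrite lt_neqAle normc_ge0 andbT eq_sym normc_eq0. Qed.

Lemma normc0 : normc (0 : R[i]) = 0.
Proof. by apply/eqP; rewrite normc_eq0. Qed.

Lemma normc1 : normc (1 : R[i]) = 1.
Proof. exact: Normc.normc1. Qed.

Lemma normcR (a : R) : normc (Complex a 0) = `|a|.
Proof. by rewrite cnormE /= expr0n addr0 sqrtr_sqr. Qed.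

Lemma normc_sum I (s : seq I) (F : I -> R[i]) :
  normc (\sum_(i <- s) F i) <= \sum_(i <- s) normc (F i).
Proof.
elim/big_rec2: _ => [|i y1 y2 _ H]; first by rewrite normc0.
by rewrite (le_trans (normc_triangle _ _))// lerD2l.
Qed.

Lemma normc_prod I (s : seq I) (F : I -> R[i]) :
  normc (\prod_(i <- s) F i) = \prod_(i <- s) normc (F i).
Proof.
by elim/big_rec2: _ => [|i y1 y2 _ <-]; [rewrite normc1|rewrite normcM].
Qed.

Lemma Re_le_normc x : `|Re x| <= normc x.
Proof.
by rewrite cnormE -sqrtr_sqr ler_wsqrtr// lerDl sqr_ge0.
Qed.

Lemma Im_le_normc x : `|Im x| <= normc x.
Proof.
by rewrite cnormE -sqrtr_sqr ler_wsqrtr// lerDr sqr_ge0.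
Qed.

Lemma normc_le_ReIm x : normc x <= `|Re x| + `|Im x|.
Proof.
rewrite -(ler_pXn2r (n := 2)) ?nnegrE ?addr_ge0 ?normc_ge0//.
rewrite normc_sqr sqrrD !real_normK ?num_real//.
by rewrite lerD2r lerDl mulrn_wge0// mulr_ge0.
Qed.

Definition eC (a : R) : R[i] := Complex (cos a) (sin a).

Lemma eCD a b : eC (a + b) = eC a * eC b.
Proof.
by apply: complex_ext; rewrite ?cReM ?cImM /= ?cosD ?sinD//; ring.
Qed.

Lemma eC0 : eC 0 = 1.
Proof. by rewrite /eC cos0 sin0. Qed.

Lemma normc_eC a : normc (eC a) = 1.
Proof. by rewrite cnormE /= cos2Dsin2 sqrtr1. Qed.

Lemma eC_sum I (s : seq I) (F : I -> R) :
  eC (\sum_(i <- s) F i) = \prod_(i <- s) eC (F i).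
Proof.
by elim/big_rec2: _ => [|i y1 y2 _ <-]; [rewrite eC0|rewrite eCD].
Qed.

End ComplexNorm.

Section ComplexMeas.
Context {R : realType} {d : measure_display} {T : measurableType d}.
Implicit Types f g : T -> R[i].

Lemma measurable_Re : measurable_fun setT (Re : R[i] -> R).
Proof.
by move=> _ B mB; apply: sub_sigma_algebra; left; exists B; rewrite ?setTI.
Qed.

Lemma measurable_Im : measurable_fun setT (Im : R[i] -> R).
Proof.
by move=> _ B mB; apply: sub_sigma_algebra; right; exists B; rewrite ?setTI.
Qed.

Lemma measurable_complexP f : measurable_fun setT f <->
  measurable_fun setT (fun x => Re (f x)) /\
  measurable_fun setT (fun x => Im (f x)).
Proof.
split=> [mf|[mr mi]].
  by split; [exact: (measurableT_comp measurable_Re mf)|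
             exact: (measurableT_comp measurable_Im mf)].
apply: (measurability (preimage_set_system setT (Re : R[i] -> R) measurable `|`
                       preimage_set_system setT (Im : R[i] -> R) measurable)) => //.
move=> _ [_ [[B mB <-]|[B mB <-]] <-]; rewrite !setTI.
- by rewrite -[X in measurable X]setTI; exact: mr.
- by rewrite -[X in measurable X]setTI; exact: mi.
Qed.

Lemma measurable_funCD f g : measurable_fun setT f -> measurable_fun setT g ->
  measurable_fun setT (fun x => f x + g x).
Proof.
move=> /measurable_complexP[fr fi] /measurable_complexP[gr gi].
apply/measurable_complexP; split.
  by under eq_fun do rewrite cReD; exact: measurable_funD.
by under eq_fun do rewrite cImD; exact: measurable_funD.
Qed.

Lemma measurable_funCM f g : measurable_fun setT f -> measurable_fun setT g ->
  measurable_fun setT (fun x => f x * g x).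
Proof.
move=> /measurable_complexP[fr fi] /measurable_complexP[gr gi].
apply/measurable_complexP; split.
  by under eq_fun do rewrite cReM; apply: measurable_funB; exact: measurable_funM.
by under eq_fun do rewrite cImM; apply: measurable_funD; exact: measurable_funM.
Qed.

Lemma measurable_funC_sum (I : Type) (s : seq I) (F : I -> T -> R[i]) :
  (forall i, measurable_fun setT (F i)) ->
  measurable_fun setT (fun x => \sum_(i <- s) F i x).
Proof.
move=> mF; elim: s => [|a s IH].
  by under eq_fun do rewrite big_nil; exact: measurable_cst.
by under eq_fun do rewrite big_cons; exact: measurable_funCD.
Qed.

Lemma measurable_normc f : measurable_fun setT f ->
  measurable_fun setT (fun x => normc (f x)).
Proof.
move=> /measurable_complexP[fr fi].
under eq_fun do rewrite cnormE.
apply: (measurableT_comp (f := @Num.sqrt R)).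
  by apply: continuous_measurable_fun; exact: sqrt_continuous.
by apply: measurable_funD; exact: measurable_funX.
Qed.

Definition bmc f := bmf (fun x => Re (f x)) /\ bmf (fun x => Im (f x)).

Lemma bmcP f : bmc f <->
  measurable_fun setT f /\ exists M, forall x, normc (f x) <= M.
Proof.
split.
  move=> [[mr [M rM]] [mi [N iN]]]; split; first exact/measurable_complexP.
  by exists (M + N) => x; rewrite (le_trans (normc_le_ReIm _))// lerD.
move=> [/measurable_complexP[mr mi] [M fM]].
by split; split => //; exists M => x; apply: le_trans (fM x);
  [exact: Re_le_normc|exact: Im_le_normc].
Qed.

Lemma bmc_norm f : bmc f -> bmf (fun x => normc (f x)).
Proof.
move=> /bmcP[mf [M fM]]; split; first exact: measurable_normc.
by exists M => x; rewrite ger0_norm// normc_ge0.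
Qed.

Lemma bmc_cst c : bmc (fun=> c).
Proof. by split; exact: bmf_cst. Qed.

Lemma bmcD f g : bmc f -> bmc g -> bmc (fun x => f x + g x).
Proof.
move=> [fr fi] [gr gi]; split.
  by under eq_fun do rewrite cReD; exact: bmfD.
by under eq_fun do rewrite cImD; exact: bmfD.
Qed.

Lemma bmcM f g : bmc f -> bmc g -> bmc (fun x => f x * g x).
Proof.
move=> [fr fi] [gr gi]; split.
  by under eq_fun do rewrite cReM; apply: bmfB; exact: bmfM.
by under eq_fun do rewrite cImM; apply: bmfD; exact: bmfM.
Qed.

Lemma bmcN f : bmc f -> bmc (fun x => - f x).
Proof.
move=> [fr fi]; split.
  by under eq_fun do rewrite cReN; exact: bmfN.
by under eq_fun do rewrite cImN; exact: bmfN.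
Qed.

Lemma bmc_sum (I : Type) (s : seq I) (F : I -> T -> R[i]) :
  (forall i, bmc (F i)) -> bmc (fun x => \sum_(i <- s) F i x).
Proof.
move=> bF; elim: s => [|a s IH].
  by under eq_fun do rewrite big_nil; exact: bmc_cst.
by under eq_fun do rewrite big_cons; exact: bmcD.
Qed.

Lemma bmc_prod (I : Type) (s : seq I) (F : I -> T -> R[i]) :
  (forall i, bmc (F i)) -> bmc (fun x => \prod_(i <- s) F i x).
Proof.
move=> bF; elim: s => [|a s IH].
  by under eq_fun do rewrite big_nil; exact: bmc_cst.
by under eq_fun do rewrite big_cons; exact: bmcM.
Qed.

Lemma bmc_real (f : T -> R) : bmf f -> bmc (fun x => Complex (f x) 0).
Proof. by move=> bf; split => //=; exact: bmf_cst. Qed.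

Lemma bmc_eC (f : T -> R) : measurable_fun setT f -> bmc (fun x => eC (f x)).
Proof. by move=> mf; split; [exact: bmf_cos|exact: bmf_sin]. Qed.

Lemma bmc_if (b : T -> bool) f g : measurable_fun [set: T] b ->
  bmc f -> bmc g -> bmc (fun x => if b x then f x else g x).
Proof.
move=> mb [fr fi] [gr gi]; split.
  rewrite (_ : (fun x => _) = fun x => if b x then Re (f x) else Re (g x)).
    exact: bmf_if.
  by apply/funext => x; case: (b x).
rewrite (_ : (fun x => _) = fun x => if b x then Im (f x) else Im (g x)).
  exact: bmf_if.
by apply/funext => x; case: (b x).
Qed.

End ComplexMeas.

Lemma bmc_comp {R : realType} d d' (T : measurableType d) (T' : measurableType d')
    (h : T' -> T) (f : T -> R[i]) : measurable_fun [set: T'] h -> bmc f ->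
  bmc (fun x => f (h x)).
Proof.
by move=> mh [fr fi]; split; [exact: bmf_comp mh fr|exact: bmf_comp mh fi].
Qed.

Section CExpect.
Context {R : realType} {d : measure_display} {T : measurableType d}.
Variable P : probability T R.
Implicit Types f g : T -> R[i].

Definition cEx f : R[i] :=
  Complex (Ex P (fun x => Re (f x))) (Ex P (fun x => Im (f x))).

Lemma cEx_cst c : cEx (fun=> c) = c.
Proof. by rewrite /cEx !Ex_cst; case: c. Qed.

Lemma eq_cEx f g : (forall x, f x = g x) -> cEx f = cEx g.
Proof. by move=> fg; congr cEx; exact/funext. Qed.

Lemma cExD f g : bmc f -> bmc g -> cEx (fun x => f x + g x) = cEx f + cEx g.
Proof.
move=> [fr fi] [gr gi]; apply: complex_ext; rewrite ?cReD ?cImD /= -ExD//.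
  by apply: eq_Ex => x; rewrite cReD.
by apply: eq_Ex => x; rewrite cImD.
Qed.

Lemma cExZ c f : bmc f -> cEx (fun x => c * f x) = c * cEx f.
Proof.
move=> [fr fi]; apply: complex_ext; rewrite ?cReM ?cImM /=.
  rewrite -!ExZ// -ExB; [|exact: bmfZ|exact: bmfZ].
  by apply: eq_Ex => x; rewrite cReM.
rewrite -!ExZ// -ExD; [|exact: bmfZ|exact: bmfZ].
by apply: eq_Ex => x; rewrite cImM.
Qed.

Lemma cExB f g : bmc f -> bmc g -> cEx (fun x => f x - g x) = cEx f - cEx g.
Proof.
move=> bf bg; rewrite cExD//; last exact: bmcN.
congr (_ + _); rewrite -mulN1r -cExZ//; apply: eq_cEx => x.
by rewrite mulN1r.
Qed.

Lemma cEx_sum (I : Type) (s : seq I) (F : I -> T -> R[i]) :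
  (forall i, bmc (F i)) ->
  cEx (fun x => \sum_(i <- s) F i x) = \sum_(i <- s) cEx (F i).
Proof.
move=> bF; elim: s => [|a s IH].
  under eq_cEx do rewrite big_nil; rewrite big_nil; exact: cEx_cst.
under eq_cEx do rewrite big_cons.
by rewrite big_cons -IH; apply: cExD => //; exact: bmc_sum.
Qed.

Lemma cEx_real (f : T -> R) : cEx (fun x => Complex (f x) 0) = Complex (Ex P f) 0.
Proof. by rewrite /cEx /= Ex_cst. Qed.

Lemma cEx_ae f g : bmc f -> bmc g -> {ae P, forall x, f x = g x} ->
  cEx f = cEx g.
Proof.
move=> [fr fi] [gr gi] fg; apply: complex_ext; rewrite /=.
  by apply: Ex_ae => //; apply: filterS fg => x ->.
by apply: Ex_ae => //; apply: filterS fg => x ->.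
Qed.

(** With c the expectation, |c|^2 is the expectation of the real part of conj(c) f, hence at most
    |c| times that of |f|; dividing by |c| requires c <> 0. *)
Lemma normc_cEx f : bmc f -> normc (cEx f) <= Ex P (fun x => normc (f x)).
Proof.
move=> bf; have [fr fi] := bf; set c := cEx f.
have [/eqP c0|c0] := boolP (c == 0).
  by rewrite c0 normc0 Ex_ge0// => x; exact: normc_ge0.
have nc : 0 < normc c by rewrite normc_gt0.
have H : Re (cEx (fun x => conjc c * f x)) = normc c ^+ 2.
  by rewrite cExZ// -/c normc_sqr cReM; case: (c) => a b /=; rewrite !expr2; ring.
rewrite -(ler_pM2l nc) -expr2 -H -ExZ; last exact: bmc_norm.
apply: le_Ex; [|exact: bmfZ (bmc_norm bf)|].
  by have [] : bmc (fun x => conjc c * f x) by exact: bmcM (bmc_cst _) bf.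
move=> x; rewrite (le_trans (ler_norm _))// (le_trans (Re_le_normc _))//.
by rewrite normcM; case: (c) => a b; rewrite [normc (conjc _)]cnormE [normc (Complex a b)]cnormE /= sqrrN.
Qed.

Lemma cEx_dct (F : nat -> T -> R[i]) f M : (forall n, measurable_fun setT (F n)) ->
  (forall n x, normc (F n x) <= M) -> measurable_fun setT f ->
  {ae P, forall x, normc (F n x - f x) @[n --> \oo] --> (0:R)} ->
  normc (cEx (F n) - cEx f) @[n --> \oo] --> (0:R).
Proof.
move=> mF FM /measurable_complexP[mr mi] Ff.
have cr : Ex P (fun x => Re (F n x)) @[n --> \oo] --> Ex P (fun x => Re (f x)).
  apply: (Ex_dct (M := M)) => //.
  - by move=> n; have /measurable_complexP[] := mF n.
  - by move=> n x; rewrite (le_trans (Re_le_normc _)).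
  - apply: filterS Ff => x Fx; apply/cvgrPdist_lt => e e0.
    move/cvgrPdist_lt : Fx => /(_ e e0); apply: filterS => n.
    rewrite sub0r normrN (ger0_norm (normc_ge0 _)); apply: le_lt_trans.
    by rewrite -normrN opprB -cReB Re_le_normc.
have ci : Ex P (fun x => Im (F n x)) @[n --> \oo] --> Ex P (fun x => Im (f x)).
  apply: (Ex_dct (M := M)) => //.
  - by move=> n; have /measurable_complexP[] := mF n.
  - by move=> n x; rewrite (le_trans (Im_le_normc _)).
  - apply: filterS Ff => x Fx; apply/cvgrPdist_lt => e e0.
    move/cvgrPdist_lt : Fx => /(_ e e0); apply: filterS => n.
    rewrite sub0r normrN (ger0_norm (normc_ge0 _)); apply: le_lt_trans.
    by rewrite -normrN opprB -cImB Im_le_normc.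
apply: (@squeeze_cvgr _ _ _ _ (cst 0) (fun n =>
  `|Ex P (fun x => Re (F n x)) - Ex P (fun x => Re (f x))| +
  `|Ex P (fun x => Im (F n x)) - Ex P (fun x => Im (f x))|)).
- apply: nearW => n; apply/andP; split; first exact: normc_ge0.
  by apply: le_trans (normc_le_ReIm _) _; rewrite cReB cImB.
- exact: cvg_cst.
- rewrite -[X in _ --> X]addr0; apply: cvgD.
    by apply/cvgr0Pnorm_lt => e e0; have /cvgrPdist_lt := cr => /(_ e e0);
      apply: filterS => n; rewrite normr_id distrC.
  by apply/cvgr0Pnorm_lt => e e0; have /cvgrPdist_lt := ci => /(_ e e0);
      apply: filterS => n; rewrite normr_id distrC.
Qed.

End CExpect.

Section BoundedFubini.
Context {R : realType} {d1 d2 : measure_display}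
  {T1 : measurableType d1} {T2 : measurableType d2}.
Variables (P1 : probability T1 R) (P2 : probability T2 R).

Lemma bmf_fubini (f : T1 * T2 -> R) : bmf f -> bmf (fun x => Ex P2 (fun y => f (x, y))).
Proof.
move=> bf; have int := bmf_int (P1 \x P2)%E bf; split.
  have m := measurable_fubini_F int.
  have -> : (fun x => Ex P2 (fun y => f (x, y))) = fine \o (fubini_F P2 (EFin \o f)) by [].
  exact: measurableT_comp.
have [mf [M fM]] := bf; exists M => x.
have bfx : bmf (fun y => f (x, y)).
  by split; [exact: measurableT_comp|exists M].
rewrite (le_trans (le_norm_Ex _ bfx))// -[leRHS](Ex_cst P2).
by apply: le_Ex => //; [exact: bmf_norm|exact: bmf_cst].
Qed.

Lemma Ex_fubini (f : T1 * T2 -> R) : bmf f ->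
  Ex (P1 \x P2)%E f = Ex P1 (fun x => Ex P2 (fun y => f (x, y))).
Proof.
move=> bf; have int := bmf_int (P1 \x P2)%E bf.
rewrite /Ex /Rintegral -(integral12_prod_meas1 int); congr fine.
apply: eq_integral => x _; rewrite /fubini_F fineK//.
apply: integrable_fin_num => //; apply: (bmf_int P2 (f := fun y => f (x, y))).
by have [mf [M fM]] := bf; split; [exact: measurableT_comp|exists M].
Qed.

Lemma bmc_fubini (f : T1 * T2 -> R[i]) : bmc f ->
  bmc (fun x => cEx P2 (fun y => f (x, y))).
Proof. by move=> [fr fi]; split; [exact: (bmf_fubini fr)|exact: (bmf_fubini fi)]. Qed.

Lemma cEx_fubini (f : T1 * T2 -> R[i]) : bmc f ->
  cEx (P1 \x P2)%E f = cEx P1 (fun x => cEx P2 (fun y => f (x, y))).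
Proof.
by move=> [fr fi]; apply: complex_ext; [exact: (Ex_fubini fr)|exact: (Ex_fubini fi)].
Qed.

End BoundedFubini.

Section SameLaw.
Context {R : realType} {d1 d2 d : measure_display}
  {T1 : measurableType d1} {T2 : measurableType d2} {T : measurableType d}.
Variables (P1 : probability T1 R) (P2 : probability T2 R).
Variables (X : T1 -> T) (Y : T2 -> T).
Hypotheses (mX : measurable_fun setT X) (mY : measurable_fun setT Y).
Hypothesis XY : forall A, measurable A -> P1 (X @^-1` A) = P2 (Y @^-1` A).

Lemma Ex_same_law (f : T -> R) : bmf f ->
  Ex P1 (fun x => f (X x)) = Ex P2 (fun y => f (Y y)).
Proof.
move=> bf; have mf : measurable_fun setT (EFin \o f).
  by apply/measurable_EFinP; have [] := bf.
have E d' (T' : measurableType d') (P' : probability T' R) (h : T' -> T) :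
    measurable_fun setT h ->
    (\int[P']_x (f (h x))%:E = \int[pushforward P' h]_y (EFin \o f) y)%E.
  move=> mh; rewrite (integral_pushforward mh) ?preimage_setT//.
  exact: (bmf_int P' (bmf_comp mh bf)).
congr fine; rewrite (E _ _ _ _ mX) (E _ _ _ _ mY).
by apply: eq_measure_integral => A mA _; exact: XY.
Qed.

Lemma cEx_same_law (f : T -> R[i]) : bmc f ->
  cEx P1 (fun x => f (X x)) = cEx P2 (fun y => f (Y y)).
Proof.
move=> [fr fi]; apply: complex_ext => /=.
  exact: (Ex_same_law fr).
exact: (Ex_same_law fi).
Qed.

End SameLaw.

(** * Random trees *)

(** All weight sequences of the branching process form one point of a product space, so that passing
    to a subtree and redrawing nodes are measurable maps, and laws are compared on finite
    cylinders. *)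
Definition tree (R : realType) : Type := g_sigma_algebraType
  (\bigcup_(v in [set: seq nat])
     preimage_set_system setT (fun x : seq nat -> cseq R => x v) measurable).

Section Tree.
Context {R : realType}.

Lemma measurable_coord j : measurable_fun setT (fun x : cseq R => x j).
Proof.
move=> _ B mB; apply: sub_sigma_algebra; exists j => //.
by exists B.
Qed.

Lemma measurable_node v : measurable_fun setT (fun x : tree R => x v : cseq R).
Proof.
move=> _ B mB; apply: sub_sigma_algebra; exists v => //.
by exists B.
Qed.

Lemma measurable_cseqP d (T : measurableType d) (f : T -> cseq R) :
  measurable_fun setT f <-> forall j, measurable_fun setT (fun x => f x j).
Proof.
split=> [mf j|mf]; first exact: (measurableT_comp (measurable_coord j) mf).
apply: (@measurability _ _ T (cseq R) setT f (\bigcup_(j in [set: nat])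
  preimage_set_system setT (fun x : nat -> R[i] => x j) measurable)) => //.
move=> _ [_ [j _ [B mB <-]] <-]; rewrite !setTI.
by have := mf j measurableT _ mB; rewrite setTI.
Qed.

Lemma measurable_treeP d (T : measurableType d) (f : T -> tree R) :
  measurable_fun setT f <->
  forall v, measurable_fun setT (fun x => f x v : cseq R).
Proof.
split=> [mf v|mf]; first exact: (measurableT_comp (measurable_node v) mf).
apply: (@measurability _ _ T (tree R) setT f (\bigcup_(v in [set: seq nat])
  preimage_set_system setT (fun x : seq nat -> cseq R => x v) measurable)) => //.
move=> _ [_ [v _ [B mB <-]] <-]; rewrite !setTI.
by have := mf v measurableT _ mB; rewrite setTI.
Qed.

Definition cylinder (s : seq (seq nat)) (B : seq nat -> set (cseq R)) :
  set (tree R) := \bigcap_(v in [set` s]) [set x | B v (x v)].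

Definition cylinders : set (set (tree R)) :=
  [set A | exists s B, [/\ uniq s, forall v, measurable (B v) & A = cylinder s B]].

Lemma measurable_cylinder s B : (forall v, measurable (B v)) ->
  measurable (cylinder s B).
Proof.
move=> mB; apply: fin_bigcap_measurable; first exact: finite_seq.
by move=> v _; have := measurable_node v measurableT (mB v); rewrite setTI.
Qed.

Lemma cylinders_setI : setI_closed cylinders.
Proof.
move=> _ _ [s1 [B1 [u1 m1 ->]]] [s2 [B2 [u2 m2 ->]]].
exists (undup (s1 ++ s2)), (fun v => (if v \in s1 then B1 v else setT) `&`
   (if v \in s2 then B2 v else setT)); split.
- exact: undup_uniq.
- by move=> v; apply: measurableI; case: ifP.
- apply/seteqP; split=> x /=.
    move=> [h1 h2] v _; split.
      by case: ifPn => // vs; exact: h1.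
    by case: ifPn => // vs; exact: h2.
  move=> h; split=> v /= vs.
    by have [] := h v; [rewrite /= mem_undup mem_cat vs|rewrite vs].
  by have [] := h v; [rewrite /= mem_undup mem_cat vs orbT|rewrite vs].
Qed.

Lemma measurable_tree_cylinders : @measurable _ (tree R) = <<s cylinders >>.
Proof.
apply/seteqP; split.
  apply: smallest_sub; first exact: smallest_sigma_algebra.
  move=> A [v _ [B mB <-]]; apply: sub_sigma_algebra.
  exists [:: v], (fun=> B); split=> //; apply/seteqP; split=> x /=.
    by move=> [_ Bx] u /=; rewrite inE => /eqP ->.
  by move=> h; split => //; apply: (h v); rewrite /= inE.
apply: smallest_sub; first exact: sigma_algebra_measurable.
by move=> _ [s [B [_ mB ->]]]; exact: measurable_cylinder.
Qed.

Section Law.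
Context {d1 d2 : measure_display} {T1 : measurableType d1} {T2 : measurableType d2}.
Variables (P1 : probability T1 R) (P2 : probability T2 R).
Variables (X : T1 -> tree R) (Y : T2 -> tree R).
Hypotheses (mX : measurable_fun setT X) (mY : measurable_fun setT Y).

Lemma tree_law_unique :
  (forall s B, uniq s -> (forall v, measurable (B v)) ->
    P1 (X @^-1` cylinder s B) = P2 (Y @^-1` cylinder s B)) ->
  forall A, measurable A -> P1 (X @^-1` A) = P2 (Y @^-1` A).
Proof.
move=> XY A mA.
apply: (measure_unique cylinders (fun=> setT) measurable_tree_cylinders
  cylinders_setI _ _ (pushforward P1 X) (pushforward P2 Y)) => //.
- by move=> _; exists [::], (fun=> setT); split=> //; apply/seteqP; split.
- by apply/seteqP; split=> // x _; exists 0%N.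
- by move=> _ [s [B [us mB ->]]]; exact: XY.
- by move=> _; have H : (P1 [set: T1] < +oo)%E by [rewrite probability_setT ltry|]; exact: H.
Qed.

End Law.

(* [q] is the common law of the weight sequences attached to the nodes. *)
Definition iid_tree {d} {T : measurableType d} (P : probability T R)
    (X : T -> tree R) (q : set (cseq R) -> \bar R) :=
  measurable_fun setT X /\
  forall s B, uniq s -> (forall v, measurable (B v)) ->
    P (X @^-1` cylinder s B) = (\prod_(v <- s) q (B v))%E.

Lemma iid_tree_same d1 d2 (T1 : measurableType d1) (T2 : measurableType d2)
    (P1 : probability T1 R) (P2 : probability T2 R) X Y q :
  iid_tree P1 X q -> iid_tree P2 Y q ->
  forall A, measurable A -> P1 (X @^-1` A) = P2 (Y @^-1` A).
Proof.
move=> [mX hX] [mY hY]; apply: tree_law_unique => // s B us mB.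
by rewrite hX// hY.
Qed.

Definition subtree (j : nat) (x : tree R) : tree R := fun v => x (j :: v).

(** Resampling: with an independent copy [y], the nodes in [W] are kept and all others redrawn,
    which leaves the law unchanged. Independence of the nodes is used later in this form. *)
Definition splice (W : pred (seq nat)) (x y : tree R) : tree R :=
  fun v => if W v then x v else y v.

Lemma measurable_subtree j : measurable_fun setT (subtree j).
Proof. by apply/measurable_treeP => v; exact: measurable_node. Qed.

Lemma measurable_splice W :
  measurable_fun setT (fun x : tree R * tree R => splice W x.1 x.2).
Proof.
apply/measurable_treeP => v; rewrite /splice; case: (W v).
  exact: (measurableT_comp (measurable_node v) measurable_fst).
exact: (measurableT_comp (measurable_node v) measurable_snd).
Qed.

Context {d : measure_display} {T : measurableType d}.
Variables (P : probability T R) (X : T -> tree R) (q : set (cseq R) -> \bar R).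
Hypothesis iidX : iid_tree P X q.

Lemma iid_tree_subtree j : iid_tree P (fun w => subtree j (X w)) q.
Proof.
have [mX hX] := iidX; split; first exact: (measurableT_comp (measurable_subtree j) mX).
move=> s B us mB.
rewrite (_ : _ @^-1` _ = X @^-1` cylinder [seq j :: v | v <- s] (fun v => B (behead v))).
  rewrite hX ?big_map// map_inj_uniq//.
  by move=> u v [].
apply/seteqP; split=> w /= h u /=.
  by move=> /mapP[v vs ->]; exact: h.
by move=> us'; apply: (h (j :: u)); rewrite /= map_f.
Qed.

Lemma iid_tree_splice W : iid_tree (P \x P)%E
  (fun w : T * T => splice W (X w.1) (X w.2)) q.
Proof.
have [mX hX] := iidX; split.
  have m12 : measurable_fun setT (fun w : T * T => (X w.1, X w.2)).
    apply: measurable_fun_pair.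
      exact: (measurableT_comp mX measurable_fst).
    exact: (measurableT_comp mX measurable_snd).
  exact: (measurableT_comp (measurable_splice W) m12).
move=> s B us mB.
rewrite (_ : _ @^-1` _ = (X @^-1` cylinder [seq v <- s | W v] B) `*`
    (X @^-1` cylinder [seq v <- s | ~~ W v] B)).
  have mcyl r : measurable (X @^-1` cylinder r B).
    by rewrite -[X in measurable X]setTI; apply: mX => //; exact: measurable_cylinder.
  apply: (eq_trans (product_measure1E P P (mcyl _) (mcyl _))).
  apply: (eq_trans (congr2 (fun a b => (a * b)%E)
    (hX _ B (filter_uniq W us) mB) (hX _ B (filter_uniq (predC W) us) mB))).
  rewrite !big_filter.
  by rewrite [RHS](bigID W).
apply/seteqP; split=> -[w1 w2] /=.
  move=> h; split=> v /=; rewrite mem_filter => /andP[Wv vs].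
    by have := h v vs; rewrite /= /splice Wv.
  by have := h v vs; rewrite /= /splice (negbTE Wv).
move=> [h1 h2] v vs /=; rewrite /splice; case: ifPn => Wv.
  by apply: h1; rewrite /= mem_filter Wv.
by apply: h2; rewrite /= mem_filter Wv.
Qed.

Lemma cEx_subtree j (F : tree R -> R[i]) : bmc F ->
  cEx P (fun w => F (subtree j (X w))) = cEx P (fun w => F (X w)).
Proof.
move=> bF; apply: (cEx_same_law (X := fun w => subtree j (X w))) => //.
- by case: (iid_tree_subtree j).
- by case: iidX.
- exact: (iid_tree_same (iid_tree_subtree j) iidX).
Qed.

Lemma cEx_splice W (F : tree R -> R[i]) : bmc F ->
  cEx P (fun w => F (X w)) =
  cEx P (fun w => cEx P (fun w' => F (splice W (X w) (X w')))).
Proof.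
move=> bF; have [msp _] := iid_tree_splice W.
have H := cEx_fubini P P (bmc_comp msp bF).
rewrite -[RHS]H.
apply: (cEx_same_law (Y := fun w : T * T => splice W (X w.1) (X w.2))) => //.
- by case: iidX.
- exact: (iid_tree_same iidX (iid_tree_splice W)).
Qed.

End Tree.

(** * The smoothing inequality *)

Section ComplexCvg.
Context {R : realType}.
Implicit Types f g : nat -> R[i].

Definition ccvg f (l : R[i]) := normc (f n - l) @[n --> \oo] --> (0 : R).

Lemma ccvgP f l : ccvg f l <->
  Re (f n) @[n --> \oo] --> Re l /\ Im (f n) @[n --> \oo] --> Im l.
Proof.
split=> [fl|[fr fi]].
  split; apply/cvgrPdist_lt => e e0;
    move/cvgr0Pnorm_lt : fl => /(_ e e0); apply: filterS => n;
    rewrite (ger0_norm (normc_ge0 _)) => /(le_lt_trans _); apply.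
  - by rewrite distrC -cReB Re_le_normc.
  - by rewrite distrC -cImB Im_le_normc.
apply: (@squeeze_cvgr _ _ _ _ (cst 0)
  (fun n => `|Re (f n) - Re l| + `|Im (f n) - Im l|)).
- apply: nearW => n; apply/andP; split; first exact: normc_ge0.
  by apply: le_trans (normc_le_ReIm _) _; rewrite cReB cImB.
- exact: cvg_cst.
- rewrite -[X in _ --> X]addr0; apply: cvgD.
    by apply/cvgr0Pnorm_lt => e e0; have /cvgrPdist_lt := fr => /(_ e e0);
      apply: filterS => n; rewrite normr_id distrC.
  by apply/cvgr0Pnorm_lt => e e0; have /cvgrPdist_lt := fi => /(_ e e0);
      apply: filterS => n; rewrite normr_id distrC.
Qed.

Lemma ccvg_cst (c : R[i]) : ccvg (fun=> c) c.
Proof. by apply/ccvgP; split; exact: cvg_cst. Qed.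

Lemma ccvgD f g l k : ccvg f l -> ccvg g k -> ccvg (fun n => f n + g n) (l + k).
Proof.
move=> /ccvgP[fr fi] /ccvgP[gr gi]; apply/ccvgP; rewrite cReD cImD; split.
  by under eq_fun do rewrite cReD; exact: cvgD.
by under eq_fun do rewrite cImD; exact: cvgD.
Qed.

Lemma ccvgM f g l k : ccvg f l -> ccvg g k -> ccvg (fun n => f n * g n) (l * k).
Proof.
move=> /ccvgP[fr fi] /ccvgP[gr gi]; apply/ccvgP; rewrite cReM cImM; split.
  by under eq_fun do rewrite cReM; apply: cvgB; exact: cvgM.
by under eq_fun do rewrite cImM; apply: cvgD; exact: cvgM.
Qed.

Lemma ccvg_sum (I : Type) (s : seq I) (F : I -> nat -> R[i]) (l : I -> R[i]) :
  (forall i, ccvg (F i) (l i)) ->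
  ccvg (fun n => \sum_(i <- s) F i n) (\sum_(i <- s) l i).
Proof.
move=> Fl; elim: s => [|a s IH].
  by under eq_fun do rewrite big_nil; rewrite big_nil; exact: ccvg_cst.
by under eq_fun do rewrite big_cons; rewrite big_cons; exact: ccvgD.
Qed.

Lemma ccvg_prod (I : Type) (s : seq I) (F : I -> nat -> R[i]) (l : I -> R[i]) :
  (forall i, ccvg (F i) (l i)) ->
  ccvg (fun n => \prod_(i <- s) F i n) (\prod_(i <- s) l i).
Proof.
move=> Fl; elim: s => [|a s IH].
  by under eq_fun do rewrite big_nil; rewrite big_nil; exact: ccvg_cst.
by under eq_fun do rewrite big_cons; rewrite big_cons; exact: ccvgM.
Qed.

Lemma ccvg_eC (f : nat -> R) l : f n @[n --> \oo] --> l ->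
  ccvg (fun n => eC (f n)) (eC l).
Proof.
move=> fl; apply/ccvgP; split => /=.
  exact: (cvg_comp _ _ fl (@continuous_cos R l)).
exact: (cvg_comp _ _ fl (@continuous_sin R l)).
Qed.

Lemma ccvg_norm f l : ccvg f l -> normc (f n) @[n --> \oo] --> normc l.
Proof.
move=> fl; apply/cvgrPdist_lt => e e0.
move/cvgr0Pnorm_lt : fl => /(_ e e0); apply: filterS => n.
rewrite (ger0_norm (normc_ge0 _)) => /(le_lt_trans _); apply.
by rewrite distrC normc_distl.
Qed.

Lemma ccvg_near f g l : (\forall n \near \oo, f n = g n) -> ccvg f l -> ccvg g l.
Proof.
move=> fg; rewrite /ccvg => /cvgrPdist_lt fl; apply/cvgrPdist_lt => e e0.
by apply: filterS2 fg (fl e e0) => n <-.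
Qed.

End ComplexCvg.

Section Smoothing.
Context {R : realType}.

Definition rootw (x : tree R) : nat -> R[i] := x [::].

(* Truncated version of [Zn]: only the first [K] children of each node count. *)
Fixpoint Zt (K n : nat) (x : tree R) : R[i] :=
  if n is n'.+1 then \sum_(j < K) rootw x j * Zt K n' (subtree j x) else 1.

Lemma measurable_root j : measurable_fun setT (fun x : tree R => rootw x j).
Proof. exact: (measurableT_comp (measurable_coord j) (measurable_node [::])). Qed.

Lemma measurable_Zt K n : measurable_fun setT (Zt K n).
Proof.
elim: n => [|n IH] /=; first exact: measurable_cst.
apply: measurable_funC_sum => j; apply: measurable_funCM.
  exact: measurable_root.
exact: (measurableT_comp IH (measurable_subtree j)).
Qed.

(** Bad children get the factor 1, that is, no constraint. Good ones have |t xi_j| >= del |t|, so a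
    bound valid beyond a radius rho passes to the parent beyond rho / del. *)
Definition prod_good (del : R) (J : nat) (F : tree R -> R) (x : tree R) : R :=
  \prod_(j < J) (if del <= normc (rootw x j) then F (subtree j x) else 1).

Definition fun01 (F : tree R -> R) :=
  measurable_fun setT F /\ forall x, 0 <= F x <= 1.

Lemma fun01_bmf F : fun01 F -> bmf F.
Proof.
move=> [mF F01]; split => //; exists 1 => x.
by have /andP[F0 F1] := F01 x; rewrite ger0_norm.
Qed.

Lemma measurable_fun_good del j :
  measurable_fun setT (fun x : tree R => del <= normc (rootw x j)).
Proof.
apply: measurable_fun_ler; first exact: measurable_cst.
exact: (measurable_normc (measurable_root j)).
Qed.

Lemma fun01_prod_good del J F : fun01 F -> fun01 (prod_good del J F).
Proof.
move=> F01; have bF := fun01_bmf F01; have [mF F1] := F01; split.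
  have [] // : bmf (prod_good del J F).
  apply: bmf_prod => j; apply: bmf_if; [|exact: bmf_comp (measurable_subtree j) bF|exact: bmf_cst].
  exact: measurable_fun_good.
move=> x; apply/andP; split.
  by apply: prodr_ge0 => j _; case: ifP => // _; have /andP[] := F1 (subtree j x).
by apply: prodr_ile1 => j _; case: ifP => // _; rewrite lexx ler01.
Qed.

Context {d : measure_display} {T : measurableType d} (P : probability T R).

(** The pairing Re(t Y), rather than an inner product, makes the child of weight xi_j appear simply
    at the frequency t xi_j. *)
Definition Psi (F : T -> R) (Y : T -> R[i]) (t : R[i]) : R[i] :=
  cEx P (fun w => Complex (F w) 0 * eC (Re (t * Y w))).

Lemma bmc_PsiE (F : T -> R) (Y : T -> R[i]) t : bmf F -> measurable_fun setT Y ->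
  bmc (fun w => Complex (F w) 0 * eC (Re (t * Y w))).
Proof.
move=> bF mY; apply: bmcM; first exact: bmc_real.
apply: bmc_eC; apply: (measurableT_comp measurable_Re).
by apply: measurable_funCM => //; exact: measurable_cst.
Qed.

Lemma normc_Psi (F : T -> R) Y t : bmf F -> (forall x, 0 <= F x) ->
  measurable_fun setT Y -> normc (Psi F Y t) <= Ex P F.
Proof.
move=> bF F0 mY; have bP := bmc_PsiE t bF mY.
apply: le_trans (normc_cEx P bP) _.
apply: le_Ex => // [|x]; first exact: bmc_norm.
by rewrite normcM normcR normc_eC mulr1 ger0_norm.
Qed.

Lemma bmc_Psi (F : T -> R) Y (s : T -> R[i]) : bmf F -> measurable_fun setT Y ->
  measurable_fun setT s -> bmc (fun w => Psi F Y (s w)).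
Proof.
move=> bF mY ms.
apply: (@bmc_fubini _ _ _ _ _ P P
  (fun w => Complex (F w.2) 0 * eC (Re (s w.1 * Y w.2)))).
apply: bmcM; first exact: bmc_real (bmf_comp measurable_snd bF).
apply: bmc_eC; apply: (measurableT_comp measurable_Re).
apply: measurable_funCM; first exact: (measurableT_comp ms measurable_fst).
exact: (measurableT_comp mY measurable_snd).
Qed.

Lemma PsiB (F G : T -> R) Y t : bmf F -> bmf G -> measurable_fun setT Y ->
  Psi (fun w => F w - G w) Y t = Psi F Y t - Psi G Y t.
Proof.
move=> bF bG mY; rewrite -cExB; [|exact: bmc_PsiE|exact: bmc_PsiE].
apply: eq_cEx => w; rewrite -mulrBl; congr (_ * _).
by apply: complex_ext; rewrite ?cReB ?cImB /= ?subr0.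
Qed.

Lemma PsiD (F G : T -> R) Y t : bmf F -> bmf G -> measurable_fun setT Y ->
  Psi (fun w => F w + G w) Y t = Psi F Y t + Psi G Y t.
Proof.
move=> bF bG mY; rewrite -cExD; [|exact: bmc_PsiE|exact: bmc_PsiE].
apply: eq_cEx => w; rewrite -mulrDl; congr (_ * _).
by apply: complex_ext; rewrite ?cReD ?cImD /= ?addr0.
Qed.

Lemma PsiZ c (F : T -> R) Y t : bmf F -> measurable_fun setT Y ->
  Psi (fun w => c * F w) Y t = Complex c 0 * Psi F Y t.
Proof.
move=> bF mY; rewrite -cExZ; last exact: bmc_PsiE.
apply: eq_cEx => w; rewrite mulrA; congr (_ * _).
by apply: complex_ext; rewrite ?cReM ?cImM /= ?mul0r ?mulr0 ?subr0 ?addr0.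
Qed.

Lemma ccvg_Psi (F : T -> R) (Y_ : nat -> T -> R[i]) Y t : bmf F ->
  (forall n, measurable_fun setT (Y_ n)) -> measurable_fun setT Y ->
  {ae P, forall w, ccvg (Y_ ^~ w) (Y w)} ->
  ccvg (fun n => Psi F (Y_ n) t) (Psi F Y t).
Proof.
move=> bF mY_ mY Y_Y; have [_ [M FM]] := bF.
apply: (cEx_dct (M := M)).
- by move=> n; have /bmcP[] := bmc_PsiE t bF (mY_ n).
- by move=> n x; rewrite normcM normcR normc_eC mulr1.
- by have /bmcP[] := bmc_PsiE t bF mY.
- apply: filterS Y_Y => w Yw; apply: ccvgM; first exact: ccvg_cst.
  by apply: ccvg_eC; have /ccvgP[] := ccvgM (ccvg_cst t) Yw.
Qed.

Variables (X : T -> tree R) (q : set (cseq R) -> \bar R).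
Hypothesis iidX : iid_tree P X q.

Let mX : measurable_fun setT X. Proof. by case: iidX. Qed.

(** Induction on [K]: keeping the root and the first [K] subtrees while redrawing the rest separates
    the last factor from the others. *)
Lemma cEx_subtrees K (g : nat -> tree R -> R[i]) : (forall j, bmc (g j)) ->
  cEx P (fun w => \prod_(j < K) g j (subtree j (X w))) =
  \prod_(j < K) cEx P (fun w => g j (X w)).
Proof.
move=> bg; elim: K => [|K IH].
  by rewrite big_ord0; under eq_cEx do rewrite big_ord0; rewrite cEx_cst.
rewrite big_ord_recr /= -IH -(cEx_subtree iidX K (bg K)).
pose W (v : seq nat) := if v is j :: _ then (j < K)%N else true.
have bprod n : bmc (fun x : tree R => \prod_(j < n) g j (subtree j x)).
  by apply: bmc_prod => j; exact: bmc_comp (measurable_subtree j) (bg j).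
have bpX : bmc (fun w => \prod_(j < K) g j (subtree j (X w))).
  exact: bmc_comp mX (bprod K).
have bgX : bmc (fun w => g K (subtree K (X w))).
  by apply: bmc_comp mX (bmc_comp (measurable_subtree K) (bg K)).
rewrite (cEx_splice iidX W (bprod K.+1)).
rewrite mulrC -cExZ//; apply: eq_cEx => w.
rewrite mulrC -cExZ//; apply: eq_cEx => w'.
rewrite big_ord_recr /=; congr (_ * _).
  apply: eq_bigr => j _; congr (g j _); apply/funext => v.
  by rewrite /subtree /splice /W ltn_ord.
by congr (g K _); apply/funext => v; rewrite /subtree /splice /W ltnn.
Qed.

(** Redrawing everything except the root makes the root weights constants for the inner expectation,
    in which the subtrees are independent. *)
Lemma cEx_branching K (g : nat -> cseq R -> tree R -> R[i]) :
  (forall j, bmc (fun p : cseq R * tree R => g j p.1 p.2)) ->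
  cEx P (fun w => \prod_(j < K) g j (rootw (X w)) (subtree j (X w))) =
  cEx P (fun w => \prod_(j < K) cEx P (fun w' => g j (rootw (X w)) (X w'))).
Proof.
move=> bg.
have bF : bmc (fun x : tree R => \prod_(j < K) g j (rootw x) (subtree j x)).
  apply: bmc_prod => j.
  apply: (bmc_comp (h := fun x : tree R => (rootw x : cseq R, subtree j x))) (bg j).
  apply: measurable_fun_pair; [exact: measurable_node|exact: measurable_subtree].
rewrite (cEx_splice iidX (pred1 [::]) bF); apply: eq_cEx => w.
rewrite -(cEx_subtrees K (g := fun j => g j (rootw (X w)))) => [|j].
  by apply: eq_cEx => w'; apply: eq_bigr => j _; congr (g j _ _).
apply: (bmc_comp (h := fun x : tree R => (rootw (X w) : cseq R, x))) (bg j).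
by apply: measurable_fun_pair => //; exact: measurable_cst.
Qed.

End Smoothing.

Section SmoothingInequality.
Context {R : realType} {d : measure_display} {T : measurableType d}.
Variables (P : probability T R) (X : T -> tree R) (q : set (cseq R) -> \bar R).
Hypothesis iidX : iid_tree P X q.

Let mX : measurable_fun setT X. Proof. by case: iidX. Qed.

Definition good_comb del J m (c : 'I_m -> R) (F : 'I_m -> tree R -> R)
    (Y : T -> R[i]) (t : R[i]) (w : T) : R[i] :=
  \sum_(i < m) Complex (c i) 0 * \prod_(j < J)
    (if del <= normc (rootw (X w) j) then
       Psi P (fun w' => F i (X w')) Y (t * rootw (X w) j) else 1).

(** The outer and the inner variable differ for truncations, where generation n + 1 of a tree is
    made of generations n of its subtrees; in the limit both are Z. [J] is a parameter because a
    truncation must keep at least [J] children. *)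
Definition smoothing_ineq J (Yo Yi : T -> R[i]) :=
  forall del m (c : 'I_m -> R) (F : 'I_m -> tree R -> R) t,
  (forall i, fun01 (F i)) ->
  normc (\sum_(i < m) Complex (c i) 0 *
           Psi P (fun w => prod_good del J (F i) (X w)) Yo t) <=
  Ex P (fun w => normc (good_comb del J c F Yi t w)).

Lemma bmf_comp_X (F : tree R -> R) : fun01 F -> bmf (fun w => F (X w)).
Proof. by move=> /fun01_bmf; exact: bmf_comp. Qed.

Lemma Psi_le1 (F : tree R -> R) Y t : fun01 F -> measurable_fun setT Y ->
  normc (Psi P (fun w => F (X w)) Y t) <= 1.
Proof.
move=> F01 mY; have bF := bmf_comp_X F01; have [_ F1] := F01.
apply: le_trans (normc_Psi P t bF _ mY) _ => [x|].
  by have /andP[] := F1 (X x).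
rewrite -[leRHS](Ex_cst P); apply: le_Ex => //; first exact: bmf_cst.
by move=> x; have /andP[] := F1 (X x).
Qed.

Lemma measurable_root_X j : measurable_fun setT (fun w => rootw (X w) j).
Proof. exact: (measurableT_comp (measurable_root j) mX). Qed.

Lemma measurable_good_X del j :
  measurable_fun setT (fun w => del <= normc (rootw (X w) j)).
Proof. exact: (measurableT_comp (measurable_fun_good del j) mX). Qed.

Lemma bmc_good_comb del J m (c : 'I_m -> R) (F : 'I_m -> tree R -> R) Y t :
  (forall i, fun01 (F i)) -> measurable_fun setT Y ->
  bmc (good_comb del J c F Y t).
Proof.
move=> F01 mY; apply: bmc_sum => i; apply: bmcM; first exact: bmc_cst.
apply: bmc_prod => j; apply: bmc_if; [exact: measurable_good_X| |exact: bmc_cst].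
apply: bmc_Psi => //; first exact: bmf_comp_X.
by apply: measurable_funCM; [exact: measurable_cst|exact: measurable_root_X].
Qed.

Lemma normc_good_comb del J m (c : 'I_m -> R) (F : 'I_m -> tree R -> R) Y t w :
  (forall i, fun01 (F i)) -> measurable_fun setT Y ->
  normc (good_comb del J c F Y t w) <= \sum_(i < m) `|c i|.
Proof.
move=> F01 mY; apply: le_trans (normc_sum _ _) _; apply: ler_sum => i _.
rewrite normcM normcR ler_piMr// normc_prod.
apply: prodr_ile1 => j _; case: ifP => _; rewrite normc_ge0 ?normc1 ?lexx//.
by rewrite Psi_le1.
Qed.

(** Bad children carry the functional 1 for every i, so their factors do not depend on i; they come
    out of the combination as one common factor of modulus at most 1. *)
Lemma smoothing_ineq_Zt J K n : (J <= K)%N ->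
  smoothing_ineq J (fun w => Zt K n.+1 (X w)) (fun w => Zt K n (X w)).
Proof.
move=> JK del m c F t F01.
pose good (x : tree R) (j : nat) := (j < J)%N && (del <= normc (rootw x j)).
pose Z w := Zt K n (X w).
have mZ : measurable_fun setT Z by exact: (measurableT_comp (measurable_Zt K n) mX).
have mgood (j : nat) : measurable_fun setT (fun w => good (X w) j).
  rewrite /good; case: (j < J)%N => /=; last exact: measurable_cst.
  exact: measurable_good_X.
pose psi i s := Psi P (fun w => F i (X w)) Z s.
pose phi s := Psi P (fun=> 1) Z s.
have bphi (s : T -> R[i]) : measurable_fun setT s -> bmc (fun w => phi (s w)).
  by move=> ms; apply: bmc_Psi => //; exact: bmf_cst.
have E i : Psi P (fun w => prod_good del J (F i) (X w)) (fun w => Zt K n.+1 (X w)) t =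
  cEx P (fun w => \prod_(j < K) (if good (X w) j then psi i (t * rootw (X w) j)
                            else phi (t * rootw (X w) j))).
  pose g (j : nat) (xi : cseq R) (x : tree R) : R[i] :=
    Complex (if (j < J)%N && (del <= normc (xi j)) then F i x else 1) 0 *
    eC (Re (t * (xi : nat -> R[i]) j * Zt K n x)).
  have bg j : bmc (fun p : cseq R * tree R => g j p.1 p.2).
    have mxi : measurable_fun setT (fun p : cseq R * tree R => p.1 j : R[i]).
      exact: (measurableT_comp (measurable_coord j) measurable_fst).
    apply: bmcM.
      apply: bmc_real; apply: bmf_if; last exact: bmf_cst.
        case: (j < J)%N => /=; last exact: measurable_cst.
        apply: measurable_fun_ler; first exact: measurable_cst.
        exact: (measurable_normc mxi).
      exact: bmf_comp measurable_snd (fun01_bmf (F01 i)).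
    apply: bmc_eC; apply: (measurableT_comp measurable_Re).
    apply: measurable_funCM.
      by apply: measurable_funCM => //; exact: measurable_cst.
    exact: (measurableT_comp (measurable_Zt K n) measurable_snd).
  transitivity (cEx P (fun w => \prod_(j < K) g j (rootw (X w)) (subtree j (X w)))).
    apply: eq_cEx => w; rewrite /g big_split /=; congr (_ * _).
      rewrite /prod_good (big_ord_widen _ (fun j => if del <= normc (rootw (X w) j)
        then F i (subtree j (X w)) else 1) JK) big_mkcond /=.
      elim/big_rec2: _ => // j y1 y2 _ <-.
      by apply: complex_ext; rewrite ?cReM ?cImM /=; case: (j < J)%N => /=;
        rewrite ?mul1r ?mul0r ?mulr0 ?subr0 ?addr0.
    rewrite mulr_sumr Re_sum eC_sum; apply: eq_bigr => j _.
    by rewrite mulrA.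
  rewrite (cEx_branching iidX K bg); apply: eq_cEx => w; apply: eq_bigr => j _.
  by rewrite /g /good; case: ifP.
have bG i : bmc (fun w => \prod_(j < K) (if good (X w) j then psi i (t * rootw (X w) j)
                            else phi (t * rootw (X w) j))).
  apply: bmc_prod => j; apply: bmc_if => //.
    apply: bmc_Psi => //; first exact: bmf_comp_X.
    by apply: measurable_funCM; [exact: measurable_cst|exact: measurable_root_X].
  apply: bphi.
  by apply: measurable_funCM; [exact: measurable_cst|exact: measurable_root_X].
rewrite (eq_bigr (fun i => cEx P (fun w => Complex (c i) 0 *
  \prod_(j < K) (if good (X w) j then psi i (t * rootw (X w) j)
                            else phi (t * rootw (X w) j))))); last first.
  by move=> i _; rewrite E cExZ.
rewrite -cEx_sum; last by move=> i; apply: bmcM => //; exact: bmc_cst.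
have bs : bmc (fun w => \sum_(i < m) Complex (c i) 0 *
  \prod_(j < K) (if good (X w) j then psi i (t * rootw (X w) j)
                            else phi (t * rootw (X w) j))).
  by apply: bmc_sum => i; apply: bmcM => //; exact: bmc_cst.
apply: le_trans (normc_cEx P bs) _; apply: le_Ex; first exact: bmc_norm.
  exact/bmc_norm/bmc_good_comb.
move=> w.
have -> : \sum_(i < m) Complex (c i) 0 *
  \prod_(j < K) (if good (X w) j then psi i (t * rootw (X w) j)
                            else phi (t * rootw (X w) j)) =
  (\prod_(j < K) (if good (X w) j then 1 else phi (t * rootw (X w) j))) *
  good_comb del J c F Z t w.
  rewrite mulr_sumr; apply: eq_bigr => i _; rewrite mulrCA; congr (_ * _).
  pose h (j : nat) := if del <= normc (rootw (X w) j)
        then psi i (t * rootw (X w) j) else 1.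
  have -> : \prod_(j < J) (if del <= normc (rootw (X w) j)
      then Psi P (fun w' : T => F i (X w')) Z (t * rootw (X w) j) else 1) =
      \prod_(j < K) (if (j < J)%N then h j else 1).
    by rewrite -[RHS]big_mkcond -(big_ord_widen K h JK).
  rewrite -big_split /=; apply: eq_bigr => j _; rewrite /good /h.
  by case: (j < J)%N => /=; [case: ifP => _|]; rewrite ?mul1r ?mulr1.
rewrite normcM ler_piMl ?normc_ge0// normc_prod.
apply: prodr_ile1 => j _; case: ifP => _; rewrite normc_ge0 ?normc1 ?lexx//.
rewrite -[leRHS](Ex_cst P) normc_Psi//; exact: bmf_cst.
Qed.

(** Both sides involve only [J] children, hence finitely many bounded factors, and converge by
    dominated convergence. This serves both for K -> oo at a fixed generation and for n -> oo. *)
Lemma smoothing_ineq_lim J (Yo_ Yi_ : nat -> T -> R[i]) Yo Yi :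
  (forall n, measurable_fun setT (Yo_ n)) -> measurable_fun setT Yo ->
  (forall n, measurable_fun setT (Yi_ n)) -> measurable_fun setT Yi ->
  {ae P, forall w, ccvg (Yo_ ^~ w) (Yo w)} ->
  {ae P, forall w, ccvg (Yi_ ^~ w) (Yi w)} ->
  (\forall n \near \oo, smoothing_ineq J (Yo_ n) (Yi_ n)) ->
  smoothing_ineq J Yo Yi.
Proof.
move=> mYo_ mYo mYi_ mYi cYo cYi ineq del m c F t F01.
have co : normc (\sum_(i < m) Complex (c i) 0 *
    Psi P (fun w => prod_good del J (F i) (X w)) (Yo_ n) t) @[n --> \oo] -->
    normc (\sum_(i < m) Complex (c i) 0 *
    Psi P (fun w => prod_good del J (F i) (X w)) Yo t).
  apply: ccvg_norm; apply: ccvg_sum => i; apply: ccvgM; first exact: ccvg_cst.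
  by apply: ccvg_Psi => //; apply: bmf_comp_X; exact: fun01_prod_good.
have ci : Ex P (fun w => normc (good_comb del J c F (Yi_ n) t w)) @[n --> \oo] -->
    Ex P (fun w => normc (good_comb del J c F Yi t w)).
  apply: (Ex_dct (M := \sum_(i < m) `|c i|)).
  - by move=> n; have [] := bmc_norm (bmc_good_comb del J c t F01 (mYi_ n)).
  - by move=> n w; rewrite ger0_norm ?normc_ge0// normc_good_comb.
  - by have [] := bmc_norm (bmc_good_comb del J c t F01 mYi).
  - apply: aeW => w; apply: ccvg_norm; apply: ccvg_sum => i.
    apply: ccvgM; first exact: ccvg_cst.
    apply: ccvg_prod => j; case: ifP => _; last exact: ccvg_cst.
    by apply: ccvg_Psi => //; exact: bmf_comp_X.
apply: (ler_cvg_to co ci).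
by apply: filterS ineq => n; exact.
Qed.

End SmoothingInequality.

(** * Almost sure properties of the tree and passage from truncated sums to the limit *)

Section AlmostSure.
Context {R : realType} {d : measure_display} {T : measurableType d}.
Variable P : probability T R.

Lemma ae_prob1P (A : set T) : measurable A -> {ae P, forall w, A w} <-> P A = 1%E.
Proof.
move=> mA; have mC : measurable (~` A) by exact: measurableC.
have PA : P A = (1 - P (~` A))%E.
  by rewrite -(probability_setC P mC) setCK.
split=> [[N [mN N0 sN]]|PA1].
  suff : P (~` A) = 0%E by rewrite PA => ->; rewrite sube0.
  by apply/eqP; rewrite eq_le measure_ge0 andbT -N0 le_measure// inE.
exists (~` A); split=> //.
by rewrite probability_setC// PA1 subee.
Qed.

Lemma ae_forall_seq (Q : seq nat -> T -> Prop) :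
  (forall v, {ae P, forall w, Q v w}) -> {ae P, forall w, forall v, Q v w}.
Proof.
move=> hQ.
have : {ae P, forall w, forall n, Q (odflt [::] (unpickle n)) w}.
  by apply: ae_foralln => n; exact: hQ.
by apply: filterS => w h v; have := h (pickle v); rewrite pickleK.
Qed.

Lemma ae_witness (Q : T -> Prop) : {ae P, forall w, Q w} -> exists w, Q w.
Proof.
move=> [N [mN N0 sN]]; apply: contrapT => nQ.
have NT : N = setT by apply/seteqP; split=> // w _; apply: sN => Qw; apply: nQ; exists w.
by move: N0; rewrite NT probability_setT => /eqP; rewrite onee_eq0.
Qed.

End AlmostSure.

Section TreeSums.
Context {R : realType}.
Implicit Types x : tree R.

Fixpoint words (K n : nat) : seq (seq nat) :=
  if n is n'.+1 then [seq j :: v | j <- iota 0 K, v <- words K n'] else [:: [::]].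

Fixpoint tree_weight x (v : seq nat) : R[i] :=
  if v is j :: v' then rootw x j * tree_weight (subtree j x) v' else 1.

Lemma words_uniq K n : uniq (words K n).
Proof.
elim: n => //= n IH; apply: allpairs_uniq => //; first exact: iota_uniq.
by move=> [a b] [a' b'] _ _ /= [-> ->].
Qed.

Lemma size_words K n v : v \in words K n -> size v = n.
Proof.
elim: n v => [|n IH] v /=; first by rewrite inE => /eqP ->.
by move=> /allpairsP[[j u] /= [_ un ->]] /=; rewrite IH.
Qed.

Lemma Zt_words K n x : Zt K n x = \sum_(v <- words K n) tree_weight x v.
Proof.
elim: n x => [|n IH] x /=; first by rewrite big_seq1.
rewrite big_allpairs_dep -(big_mkord xpredT (fun j => rootw x j * Zt K n (subtree j x))).
rewrite /index_iota subn0; apply: eq_bigr => j _.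
by rewrite IH mulr_sumr.
Qed.

(** An existential bound instead of [nweights] gives a measurable condition on a weight sequence,
    which passes by equality of laws from [W] to every node. The condition 0 < m encodes N > 0. *)
Definition initial_weights (xi : nat -> R[i]) : Prop :=
  exists2 m, (0 < m)%N & forall j, (xi j != 0) = (j < m)%N.

Definition initial_tree x := forall v, initial_weights (x v).

Lemma initial_subtree j x : initial_tree x -> initial_tree (subtree j x).
Proof. by move=> ix v; exact: ix. Qed.

(** Finite branching: only finitely many nodes of generation n have nonzero weight, so from some
    [K0] on the truncation loses none of them. *)
Lemma tree_weight_words x n : initial_tree x ->
  exists K0, forall K v, (K0 <= K)%N -> size v = n -> tree_weight x v != 0 ->
  v \in words K n.
Proof.
elim: n x => [|n IH] x ix; first by exists 0%N => K [] //= _ _ _; rewrite inE.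
have [m _ hm] := ix [::].
have H k : exists K0, forall j K v, (j < k)%N -> (K0 <= K)%N -> size v = n ->
    tree_weight (subtree j x) v != 0 -> v \in words K n.
  elim: k => [|k [K1 IHk]]; first by exists 0%N.
  have [K2 hK2] := IH _ (initial_subtree k ix).
  exists (maxn K1 K2) => j K v; rewrite ltnS geq_max leq_eqVlt => jk /andP[h1 h2].
  by case/predU1P: jk => [->|jk]; [exact: hK2|exact: IHk].
have [K1 hK1] := H m; exists (maxn m K1) => K [|j v]//=.
rewrite geq_max => /andP[mK K1K] [sv]; rewrite mulf_eq0 negb_or => /andP[xj xv].
have jm : (j < m)%N by rewrite -hm.
apply/allpairsP; exists (j, v) => /=; split=> //.
  by rewrite mem_iota /= add0n (leq_trans jm).
exact: (hK1 j).
Qed.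

End TreeSums.

Section RandomTree.
Context {R : realType} {d : measure_display} {T : measurableType d}.
Variable TV : seq nat -> nat -> T -> R[i].

Definition random_tree (w : T) : tree R := fun v => rand_seq (TV v) w.

End RandomTree.

Lemma path_weightE {R : realType} d (T : measurableType d)
    (TV : seq nat -> nat -> T -> R[i]) v w :
  path_weight TV v w = tree_weight (random_tree TV w) v.
Proof.
elim: v TV => [|j v IH] TV; first by rewrite path_weight_nil.
rewrite /path_weight /= big_ord_recl /=; congr (_ * _).
by rewrite -[subtree _ _]/(random_tree (fun v => TV (j :: v)) w) -IH.
Qed.

Lemma Zn_Zt {R : realType} d (T : measurableType d)
    (TV : seq nat -> nat -> T -> R[i]) n w : initial_tree (random_tree TV w) ->
  exists K0, forall K, (K0 <= K)%N -> Zn TV n w = Zt K n (random_tree TV w).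
Proof.
move=> ix; have [K0 hK0] := tree_weight_words n ix; exists K0 => K K0K.
rewrite Zt_words (fsbig_seq _ _ (words_uniq K n)) /Zn.
rewrite (eq_fsbigr (tree_weight (random_tree TV w))); last first.
  by move=> v _; exact: path_weightE.
apply/esym/fsbig_widen => [v /=|v [/= sv nv]]; first exact: size_words.
by apply/eqP; apply: contrapT => /negP h; apply: nv; exact: hK0.
Qed.

Section LimitOfTruncations.
Context {R : realType}.

(** A version of Z_n that is measurable on all trees. When the weights are initial, the truncated
    sums are eventually constant in [K] and the upper limit is their final value; other trees form a
    null set. *)
Definition Zlim n (x : tree R) : R[i] :=
  Complex (fine (limn_esup (fun K => (Re (Zt K n x))%:E)))
          (fine (limn_esup (fun K => (Im (Zt K n x))%:E))).

Lemma measurable_Zlim n : measurable_fun setT (Zlim n).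
Proof.
apply/measurable_complexP; split=> /=; apply: measurableT_comp => //;
  apply: measurable_fun_limn_esup => K; apply/measurable_EFinP.
- by have /measurable_complexP[] := measurable_Zt (R := R) K n.
- by have /measurable_complexP[] := measurable_Zt (R := R) K n.
Qed.

Lemma Zlim_eventually n x z : (exists K0, forall K, (K0 <= K)%N -> Zt K n x = z) ->
  Zlim n x = z.
Proof.
move=> [K0 hK0]; have /ccvgP[cr ci] : ccvg (fun K => Zt K n x) z.
  by apply: ccvg_near (ccvg_cst z); exists K0 => // K /= K0K; rewrite (hK0 K).
have H (u : nat -> R) l : u K @[K --> \oo] --> l ->
    fine (limn_esup (fun K => (u K)%:E)) = l.
  move=> ul; have cu : (u K)%:E @[K --> \oo] --> l%:E.
    by apply: cvg_EFin => //; exact: nearW.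
  rewrite is_cvg_limn_esupE; last by apply/cvg_ex; exists l%:E.
  by rewrite (cvg_lim _ cu).
by apply: complex_ext => /=; exact: H.
Qed.

Lemma Zlim_Zn {d} {T : measurableType d} (TV : seq nat -> nat -> T -> R[i]) n w :
  initial_tree (random_tree TV w) -> Zlim n (random_tree TV w) = Zn TV n w.
Proof.
by move=> /(Zn_Zt n)[K0 hK0]; apply: Zlim_eventually; exists K0 => K /hK0.
Qed.

Lemma Zt_Zlim n x : initial_tree x -> exists K0, forall K, (K0 <= K)%N -> Zt K n x = Zlim n x.
Proof.
(* The one-point space [unit] turns a single tree into a deterministic branching process. *)
move=> ix; have [K0 hK0] := @Zn_Zt R _ unit (fun v j _ => x v j) n tt ix.
have E K : (K0 <= K)%N -> Zt K n x = Zn (fun v j _ => x v j) n tt by move=> /hK0 ->.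
by exists K0 => K /E ->; apply/esym/Zlim_eventually; exists K0.
Qed.

Lemma ccvg_Zlim n x : initial_tree x -> ccvg (fun K => Zt K n x) (Zlim n x).
Proof.
move=> /(Zt_Zlim n)[K0 hK0]; apply: ccvg_near (ccvg_cst (Zlim n x)).
by exists K0 => // K /= K0K; rewrite (hK0 K).
Qed.

End LimitOfTruncations.

Section Limit.
Context {R : realType} {d0 : measure_display} {T0 : measurableType d0}
  {d : measure_display} {T : measurableType d}.
Variables (P0 : probability T0 R) (P : probability T R).
Variables (W : nat -> {RV P0 >-> R[i]}) (TV : seq nat -> nat -> {RV P >-> R[i]}).
Hypotheses (hW : weights_initial P0 W) (hcopies : copies_of P TV P0 W)
  (hindep : independent_copies P TV)
  (hNpos : {ae P0, forall w, (0 < nweights W w)%N}).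

Let X := random_tree TV.

Definition weight_law (B : set (cseq R)) := P0 (rand_seq W @^-1` B).

Lemma measurable_rand_seq (W' : nat -> T0 -> R[i]) :
  (forall j, measurable_fun setT (W' j)) -> measurable_fun setT (rand_seq W').
Proof. by move=> mW; apply/measurable_cseqP => j; exact: mW. Qed.

Lemma iid_random_tree : iid_tree P X weight_law.
Proof.
split.
  apply/measurable_treeP => v; apply/measurable_cseqP => j.
  exact: measurable_funPT.
move=> s B us mB; have := hindep us mB.
rewrite (_ : \bigcap_(v in _) _ = X @^-1` cylinder s B); last by [].
by move=> ->; apply: eq_bigr => v _; exact: hcopies.
Qed.

Lemma ae_copies (B : set (cseq R)) v : measurable B ->
  {ae P, forall w, B (X w v)} <-> {ae P0, forall w, B (rand_seq W w)}.
Proof.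
move=> mB; have mB0 : measurable (rand_seq W @^-1` B).
  have := measurable_rand_seq (fun j => measurable_funPT (W j)).
  by move=> /(_ measurableT _ mB); rewrite setTI.
have mBv : measurable ((fun w => X w v : cseq R) @^-1` B).
  have := measurableT_comp (measurable_node v) (iid_random_tree).1.
  by move=> /(_ measurableT _ mB); rewrite setTI.
by rewrite (ae_prob1P P mBv) (ae_prob1P P0 mB0) -(hcopies v mB).
Qed.

Lemma measurable_initial : measurable (@initial_weights R : set (cseq R)).
Proof.
rewrite (_ : initial_weights = \bigcup_(m in [set m | (0 < m)%N])
    \bigcap_j [set xi : cseq R | ((xi : nat -> R[i]) j != 0) = (j < m)%N]); last first.
  apply/seteqP; split=> xi /=; first by move=> [m m0 h]; exists m => // j _; exact: h.
  by move=> [m m0 h]; exists m => // j; exact: h.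
apply: bigcup_measurable => m _; apply: bigcapT_measurable => j.
have mj : measurable_fun setT (fun xi : cseq R => normc ((xi : nat -> R[i]) j)).
  exact: (measurable_normc (measurable_coord j)).
have m0 : measurable [set xi : cseq R | normc ((xi : nat -> R[i]) j) = 0].
  by have := mj measurableT _ (measurable_set1 0); rewrite setTI.
have E (xi : cseq R) : (xi : nat -> R[i]) j != 0 <-> normc ((xi : nat -> R[i]) j) <> 0.
  by rewrite -normc_eq0; split=> [/eqP|/eqP].
case: (j < m)%N.
  rewrite (_ : [set _ | _] = ~` [set xi : cseq R | normc ((xi : nat -> R[i]) j) = 0]).
    exact: measurableC.
  by apply/seteqP; split=> xi /=; rewrite -E.
rewrite (_ : [set _ | _] = [set xi : cseq R | normc ((xi : nat -> R[i]) j) = 0])//.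
apply/seteqP; split=> xi /=.
  by move/negbT; rewrite negbK -normc_eq0 => /eqP.
by move/eqP; rewrite normc_eq0 => ->.
Qed.

Lemma ae_initial0 : {ae P0, forall w, initial_weights (rand_seq W w)}.
Proof.
apply: filterS2 hW hNpos => w hw N0; exists (nweights W w) => // j.
have := hw; move/seteqP => [h1 h2]; apply/idP/idP; [exact: h1|exact: h2].
Qed.

Lemma ae_initial : {ae P, forall w, initial_tree (X w)}.
Proof.
apply: ae_forall_seq => v.
exact/(ae_copies v measurable_initial)/ae_initial0.
Qed.

Lemma measurable_ZtX K n : measurable_fun setT (fun w => Zt K n (X w)).
Proof. exact: (measurableT_comp (measurable_Zt K n) (iid_random_tree).1). Qed.

Lemma measurable_ZlimX n : measurable_fun setT (fun w => Zlim n (X w)).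
Proof. exact: (measurableT_comp (measurable_Zlim n) (iid_random_tree).1). Qed.

Lemma smoothing_ineq_limit (Z : {RV P >-> R[i]}) J : Zn_cvg_as P TV Z ->
  smoothing_ineq P X J Z Z.
Proof.
move=> hZ; have iidX := iid_random_tree.
have cZt n : {ae P, forall w, ccvg (fun K => Zt K n (X w)) (Zlim n (X w))}.
  by apply: filterS ae_initial => w iw; exact: ccvg_Zlim.
have cZ : {ae P, forall w, ccvg (fun n => Zlim n (X w)) (Z w)}.
  apply: filterS2 ae_initial hZ => w iw; rewrite /ccvg.
  by under [X in _ -> X @ _ --> _]eq_fun do rewrite Zlim_Zn//.
have cZS : {ae P, forall w, ccvg (fun n => Zlim n.+1 (X w)) (Z w)}.
  by apply: filterS cZ => w; rewrite /ccvg (cvg_shiftS (fun n => normc (Zlim n (X w) - Z w))).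
apply: (smoothing_ineq_lim iidX (Yo_ := fun n w => Zlim n.+1 (X w)) (Yi_ := fun n w => Zlim n (X w))) => //.
- by move=> n; exact: measurable_ZlimX.
- exact: measurable_ZlimX.
apply: nearW => n.
apply: (smoothing_ineq_lim iidX (Yo_ := fun K w => Zt K n.+1 (X w))
   (Yi_ := fun K w => Zt K n (X w))) => //.
- by move=> K; exact: measurable_ZtX.
- exact: measurable_ZlimX.
- by move=> K; exact: measurable_ZtX.
- exact: measurable_ZlimX.
by exists J => // K /= JK; exact: (smoothing_ineq_Zt iidX n JK).
Qed.

End Limit.

(** * Number of good children and moments of the weights *)

Section NonMeasurable.
Local Open Scope ereal_scope.
Context {R : realType} {d : measure_display} {T : measurableType d}.
Variable P : probability T R.

(* No measurability is assumed in these comparisons: the number of nonzero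
   weights, as it is defined here, is only a.e. equal to a nice function. *)
Lemma le_integral_ge0 (f g : T -> \bar R) :
  (forall x, 0 <= f x) -> (forall x, f x <= g x) ->
  \int[P]_x f x <= \int[P]_x g x.
Proof.
move=> f0 fg; rewrite !ge0_integralTE//; last first.
  by move=> x; exact: le_trans (fg x).
apply: ereal_sup_le => _ /= [h hf <-]; exists h => // x.
exact: le_trans (fg x).
Qed.

Lemma ae_le_integral_l (f g : T -> \bar R) : measurable_fun setT f ->
  (forall x, 0 <= f x) -> (forall x, 0 <= g x) ->
  {ae P, forall x, f x <= g x} -> \int[P]_x f x <= \int[P]_x g x.
Proof.
move=> mf f0 g0 [N [mN N0 sN]].
have mC : measurable (~` N) by exact: measurableC.
rewrite (_ : \int[P]_x f x = \int[P]_x (f \_ (~` N)) x); last first.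
  apply: ae_eq_integral => //.
    by apply/(measurable_restrictT _ mC); exact: measurable_funTS.
  exists N; split=> // x /= h; apply: contrapT => Nx; apply: h => _.
  by rewrite patchE mem_set.
apply: le_integral_ge0 => x; rewrite patchE; case: ifPn => // /set_mem Nx.
by apply: contrapT => h; apply: Nx; exact: sN.
Qed.

Lemma ae_le_integral_r (f g : T -> \bar R) : measurable_fun setT g ->
  (forall x, 0 <= f x) -> (forall x, 0 <= g x) ->
  {ae P, forall x, f x <= g x} -> \int[P]_x f x <= \int[P]_x g x.
Proof.
move=> mg f0 g0 [N [mN N0 sN]].
(* Raising the measurable side to +oo on the null set makes the comparison hold everywhere. *)
pose g' x := if x \in N then +oo else g x.
have mg' : measurable_fun setT g'.
  apply: measurable_fun_ifT => //.
  apply: (measurable_fun_bool true).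
  rewrite setTI (_ : _ @^-1` _ = N)//.
  by apply/seteqP; split=> x /=; [exact: set_mem|exact: mem_set].
rewrite (_ : \int[P]_x g x = \int[P]_x g' x); last first.
  apply: ae_eq_integral => //; exists N; split=> // x /= h.
  by apply: contrapT => Nx; apply: h => _; rewrite /g' memNset.
apply: le_integral_ge0 => // x; rewrite /g'; case: ifPn => [_|/negP Nx].
  exact: leey.
by apply: contrapT => h; apply: Nx; rewrite inE; exact: sN.
Qed.

End NonMeasurable.

Section Offspring.
Context {R : realType} {d0 : measure_display} {T0 : measurableType d0}
  {d : measure_display} {T : measurableType d}.
Variables (P0 : probability T0 R) (P : probability T R).
Variables (W : nat -> {RV P0 >-> R[i]}) (TV : seq nat -> nat -> {RV P >-> R[i]}).
Hypotheses (hW : weights_initial P0 W) (hcopies : copies_of P TV P0 W)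
  (hindep : independent_copies P TV)
  (hNpos : {ae P0, forall w, (0 < nweights W w)%N}).

Let X := random_tree TV.

Let iidX : iid_tree P X (weight_law W).
Proof. exact: iid_random_tree hcopies hindep. Qed.

Lemma Ex_root (f : cseq R -> R) : bmf f ->
  Ex P (fun w => f (rootw (X w))) = Ex P0 (fun w => f (rand_seq W w)).
Proof.
move=> bf; apply: (Ex_same_law (X := fun w => rootw (X w) : cseq R)) => //.
- exact: (measurableT_comp (measurable_node [::]) iidX.1).
- by apply: measurable_rand_seq => j; exact: measurable_funPT.
- by move=> A mA; exact: hcopies.
Qed.

Lemma measurable_good_coord (del : R) j :
  measurable_fun setT (fun xi : cseq R => del <= normc ((xi : nat -> R[i]) j)).
Proof.
apply: measurable_fun_ler; first exact: measurable_cst.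
exact: (measurable_normc (measurable_coord j)).
Qed.

Definition ngood (del : R) (J : nat) (xi : nat -> R[i]) : R :=
  \sum_(j < J) (if del <= normc (xi j) then 1 else 0).

Lemma bmf_ngood del J : bmf (ngood del J : cseq R -> R).
Proof.
apply: bmf_sum => j; apply: bmf_if; [exact: measurable_good_coord|exact: bmf_cst|exact: bmf_cst].
Qed.

Lemma ngood_ge0 del J xi : 0 <= ngood del J xi.
Proof. by apply: sumr_ge0 => j _; case: ifP. Qed.

Lemma ngood_homo del del' J J' xi : del' <= del -> (J <= J')%N ->
  ngood del J xi <= ngood del' J' xi.
Proof.
move=> dd JJ; rewrite /ngood.
rewrite (big_ord_widen _ (fun j => if del <= normc (xi j) then 1 else 0) JJ) big_mkcond /=.
apply: ler_sum => j _; case: (j < J)%N; last by case: ifP.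
case: ifPn => // h; first by rewrite (le_trans dd h).
by case: ifP.
Qed.

(** Finitely many nonzero weights are bounded away from 0, so one index [n] can serve both as the
    number of children inspected and, through 1 / (n + 1), as the threshold. *)
Lemma initial_ngood xi m : (forall j, (xi j != 0) = (j < m)%N) ->
  exists n, m%:R <= ngood n.+1%:R^-1 n xi.
Proof.
move=> hm.
have H k : (k <= m)%N -> exists n, (k <= n)%N /\
    forall j, (j < k)%N -> n.+1%:R^-1 <= normc (xi j).
  elim: k => [_|k IH km]; first by exists 0%N.
  have [n [kn hn]] := IH (ltnW km).
  have xk : 0 < normc (xi k) by rewrite normc_gt0 hm.
  have [n' _ hn'] := near_infty_natSinv_lt (PosNum xk).
  exists (maxn n'.+1 n.+1); split; first by rewrite leq_max !ltnS kn orbT.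
  move=> j; rewrite ltnS leq_eqVlt => /predU1P[->|jk].
    by apply: ltW; apply: hn'; rewrite /= leq_max leqnSn.
  apply: le_trans (hn j jk).
  by rewrite lef_pV2 ?posrE// ler_nat ltnS (leq_trans (leqnSn n))// leq_max leqnn orbT.
have [n [mn hn]] := H m (leqnn m); exists n.
rewrite -[leLHS](_ : ngood n.+1%:R^-1 m xi = _).
  exact: ngood_homo.
rewrite /ngood (eq_bigr (fun=> 1)); first by rewrite sumr_const card_ord.
by move=> j _; rewrite hn.
Qed.

(** The counts with threshold 1 / (n + 1) among the first [n] children increase with [n] and
    eventually reach N, so by monotone convergence one of these bounded counts already has mean
    above 1. *)
Lemma ngood_mean : (1 < 'E_P0[fun w => (nweights W w)%:R%R])%E ->
  exists J del, [/\ 0 < del & 1 < Ex P (fun w => ngood del J (rootw (X w)))].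
Proof.
move=> EN; apply: contrapT => H.
pose f n (w : T0) := ngood n.+1%:R^-1 n (rand_seq W w).
have mf n : measurable_fun setT (f n).
  have [m _] := bmf_comp (measurable_rand_seq (fun j => measurable_funPT (W j)))
    (bmf_ngood n.+1%:R^-1 n).
  exact: m.
have bf n : bmf (f n).
  exact: bmf_comp (measurable_rand_seq (fun j => measurable_funPT (W j)))
    (bmf_ngood n.+1%:R^-1 n).
have f1 n : (\int[P0]_w (f n w)%:E <= 1)%E.
  have fin := integrable_fin_num measurableT (bmf_int P0 (bf n)).
  rewrite -(fineK fin) lee_fin -[fine _]/(Ex P0 (f n)) -(Ex_root (bmf_ngood n.+1%:R^-1 n)).
  by rewrite leNgt; apply/negP => h; apply: H; exists n, n.+1%:R^-1; split.
have ndf w : nondecreasing_seq (fun n => (f n w)%:E).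
  move=> n m nm; rewrite lee_fin; apply: ngood_homo => //.
  by rewrite lef_pV2 ?posrE// ler_nat ltnS.
have mc := monotone_convergence P0 measurableT
  (fun n => (measurable_EFinP _ _).2 (mf n))
  (fun n w _ => (ngood_ge0 n.+1%:R^-1 n (rand_seq W w) : (0 <= (f n w)%:E)%E))
  (fun w _ => ndf w).
have : (\int[P0]_w limn (fun n => (f n w)%:E) <= 1)%E.
  rewrite mc; apply: lime_le.
    apply: ereal_nondecreasing_is_cvgn => n m nm; apply: le_integral_ge0 => w.
      by rewrite lee_fin ngood_ge0.
    exact: ndf.
  by apply: nearW => n; exact: f1.
apply/negP; rewrite -ltNge; apply: lt_le_trans EN _.
rewrite expectation.unlock; apply: ae_le_integral_r.
- apply: (emeasurable_fun_cvg (fun n w => (f n w)%:E)).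
    by move=> n; apply/measurable_EFinP.
  move=> w _; apply: ereal_nondecreasing_is_cvgn; exact: ndf.
- by move=> w; rewrite lee_fin.
- move=> w; apply: lime_ge; first by apply: ereal_nondecreasing_is_cvgn; exact: ndf.
  by apply: nearW => n; rewrite lee_fin ngood_ge0.
apply: filterS hW => w hw.
have [n hn] : exists n, (nweights W w)%:R <= f n w.
  apply: initial_ngood => j; move/seteqP : hw => [h1 h2].
  by apply/idP/idP; [exact: h1|exact: h2].
apply: le_trans (_ : (f n w)%:E <= _)%E; first by rewrite lee_fin.
apply: lime_ge; first by apply: ereal_nondecreasing_is_cvgn; exact: ndf.
by exists n => // k /= nk; exact: ndf.
Qed.

(** Each term is at most s^alpha |T_j|^alpha, and the full sum of the |T_j|^alpha has mean 1. The
    cap at 1 keeps the integrand bounded independently of the weights. *)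
Lemma alpha_moment alpha J del s : moment P0 W alpha = 1%E -> 0 < alpha -> 0 < del -> 0 <= s ->
  Ex P (fun w => \sum_(j < J) (if del <= normc (rootw (X w) j) then
    Num.min ((normc (rootw (X w) j) * s) `^ alpha) 1 else 0)) <= s `^ alpha.
Proof.
move=> hm a0 del0 s0.
pose g (xi : cseq R) := \sum_(j < J) (if del <= normc ((xi : nat -> R[i]) j) then
    Num.min ((normc ((xi : nat -> R[i]) j) * s) `^ alpha) 1 else 0).
have mn j : measurable_fun setT (fun xi : cseq R => normc ((xi : nat -> R[i]) j)).
  exact: (measurable_normc (measurable_coord j)).
have bg : bmf g.
  apply: bmf_sum => j; apply: bmf_if; [exact: measurable_good_coord| |exact: bmf_cst].
  split.
    apply: measurable_minr; last exact: measurable_cst.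
    apply: (measurableT_comp (measurable_powR alpha)).
    by apply: measurable_funM => //; exact: measurable_cst.
  exists 1 => xi; rewrite ger0_norm ?ge_min ?lexx ?orbT// le_min powR_ge0 ler01//.
have g0 xi : 0 <= g xi.
  by apply: sumr_ge0 => j _; case: ifP => // _; rewrite le_min powR_ge0 ler01.
rewrite (Ex_root bg).
have mW : measurable_fun setT (rand_seq W).
  by apply: measurable_rand_seq => j; exact: measurable_funPT.
have bgW := bmf_comp mW bg.
have fin := integrable_fin_num measurableT (bmf_int P0 bgW).
rewrite -lee_fin /Ex /Rintegral fineK//.
have sa : 0 <= s `^ alpha by exact: powR_ge0.
have -> : (s `^ alpha)%:E = ((s `^ alpha)%:E * moment P0 W alpha)%E by rewrite hm mule1.
pose h (xi : cseq R) := \sum_(j < J) (if del <= normc ((xi : nat -> R[i]) j) then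
    (normc ((xi : nat -> R[i]) j)) `^ alpha else 0).
have h0 xi : 0 <= h xi.
  by apply: sumr_ge0 => j _; case: ifP => // _; rewrite powR_ge0.
have mh : measurable_fun setT h.
  apply: measurable_sum => j; apply: measurable_fun_ifT; last exact: measurable_cst.
    exact: measurable_good_coord.
  exact: (measurableT_comp (measurable_powR alpha)).
have mhW := measurableT_comp mh mW.
apply: (@le_trans _ _ (\int[P0]_w ((s `^ alpha)%:E * (h (rand_seq W w))%:E))%E).
  apply: le_integral_ge0 => w; rewrite ?lee_fin ?g0// mulr_sumr.
  apply: ler_sum => j _; case: ifP => _; last by rewrite mulr0.
  by rewrite ge_min powRM ?normc_ge0// mulrC lexx.
rewrite ge0_integralZl//; last first.
- by move=> w _; rewrite lee_fin.
- exact/measurable_EFinP.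
apply: lee_wpmul2l; first by rewrite lee_fin.
rewrite /moment expectation.unlock; apply: ae_le_integral_l.
- exact/measurable_EFinP.
- by move=> w; rewrite lee_fin.
- by move=> w; rewrite lee_fin sumr_ge0// => j _; rewrite powR_ge0.
apply: filterS hW => w hw; rewrite lee_fin /h.
pose F (j : nat) := normc (W j w) `^ alpha.
have -> : \sum_(j < nweights W w) normc (W j w) `^ alpha =
    \sum_(j < maxn J (nweights W w) | (j < nweights W w)%N) F j.
  exact: (big_ord_widen _ F (leq_maxr _ _)).
rewrite (big_ord_widen (maxn J (nweights W w))
  (fun j => if del <= normc (W j w) then F j else 0) (leq_maxl _ _)).
rewrite [leLHS]big_mkcond [leRHS]big_mkcond /=; apply: ler_sum => j _.
case: ifPn => _; last by case: ifP => // _; exact: powR_ge0.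
case: ifPn => hd; last by case: ifP => // _; exact: powR_ge0.
have -> : (j < nweights W w)%N.
  by move/seteqP : hw => [h1 h2]; apply: h1; rewrite /= -normc_gt0 (lt_le_trans del0).
exact: lexx.
Qed.

(** It suffices to inspect the first child: its weight is almost surely nonzero as N > 0, hence
    above a small threshold outside an event of small probability. *)
Lemma no_good_small J : (0 < J)%N -> forall e : R, 0 < e -> exists2 del1, 0 < del1 &
  forall del, del <= del1 ->
  Ex P (fun w => if ngood del J (rootw (X w)) <= 0 then 1 else 0) <= e.
Proof.
move=> J0 e e0.
pose f n (xi : cseq R) : R := if n.+1%:R^-1 <= normc ((xi : nat -> R[i]) 0%N) then 0 else 1.
have bf n : bmf (f n).
  by apply: bmf_if; [exact: measurable_good_coord|exact: bmf_cst|exact: bmf_cst].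
have bfX n := bmf_comp ((measurableT_comp (measurable_node [::]) iidX.1)) (bf n).
have cf : Ex P (fun w => f n (rootw (X w))) @[n --> \oo] --> Ex P (fun=> 0).
  apply: (Ex_dct (M := 1)).
  - by move=> n; have [] := bfX n.
  - by move=> n w; rewrite /f; case: ifP; rewrite ?normr0 ?normr1.
  - exact: measurable_cst.
  apply: filterS (ae_initial hW hcopies hindep hNpos) => w /(_ [::]) [m m0 hm].
  have x0 : 0 < normc (rootw (X w) 0%N) by rewrite normc_gt0 hm.
  apply: cvg_near_cst; apply: filterS (near_infty_natSinv_lt (PosNum x0)) => n /= hn.
  by rewrite /f ltW.
rewrite Ex_cst in cf.
move/cvgr0Pnorm_lt : cf => /(_ e e0)[n _ /(_ n (leqnn n)) /= hn].
exists n.+1%:R^-1 => // del hdel; apply: le_trans (ltW hn).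
apply: le_trans (ler_norm _); apply: le_Ex => [|//|w].
  apply: (bmf_comp (h := fun w => rootw (X w) : cseq R) (f := fun xi => if ngood del J xi <= 0 then 1 else 0)).
    exact: (measurableT_comp (measurable_node [::]) iidX.1).
  apply: bmf_if; [|exact: bmf_cst|exact: bmf_cst].
  by apply: measurable_fun_ler; [by have [] := bmf_ngood del J|exact: measurable_cst].
rewrite /f; have [h1|_] := leP (ngood del J (rootw (X w))) 0; case: ifPn => // h2.
case: J J0 h1 => // J' _; rewrite leNgt => /negP[].
rewrite /ngood big_ord_recl /= (le_trans hdel h2) ltr_pwDl//.
by apply: sumr_ge0 => j _; case: ifP.
Qed.

End Offspring.

(** * Characteristic functions near the origin *)

Section Trigonometry.
Context {R : realType}.
Implicit Types x : R.

Lemma sin_mvt x : 0 < x -> exists2 c, 0 < c < x & sin x = cos c * x.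
Proof.
move=> x0; have dsin (y : R) : y \in `]0, x[ -> is_derive y 1 (@sin R) (cos y).
  by move=> _; exact: is_derive_sin.
have csin : {within `[0, x], continuous (@sin R)}.
  by apply: continuous_subspaceT => y; exact: continuous_sin.
have [c] := MVT x0 dsin csin.
by rewrite in_itv /= sin0 !subr0 => cx ->; exists c.
Qed.

Lemma sin_le x : 0 <= x -> sin x <= x.
Proof.
rewrite le_eqVlt => /predU1P[<-|x0]; first by rewrite sin0.
by have [c _ ->] := sin_mvt x0; rewrite ler_piMl ?cos_le1// ltW.
Qed.

Lemma one_subr_cos x : 1 - cos x = 2 * sin (x / 2) ^+ 2.
Proof.
have -> : cos x = cos ((x / 2) *+ 2) by congr cos; rewrite -mulr_natr divfK.
by rewrite cos_mulr2n sin2cos2; ring.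
Qed.

Lemma cos_lower x : 1 - x ^+ 2 / 2 <= cos x.
Proof.
wlog x0 : x / 0 <= x => [h|].
  have [/h//|x0] := leP 0 x.
  by rewrite -cosN -sqrrN h// oppr_ge0 ltW.
rewrite lerBlDr -lerBlDl one_subr_cos.
have h : `|sin (x / 2)| <= x / 2.
  rewrite ler_norml sin_le ?divr_ge0// andbT.
  rewrite lerNl -sinN; have [le1|gt1] := leP (x / 2) 1.
    rewrite sinN lerNl (le_trans (_ : _ <= 0))//.
      by rewrite oppr_le0 divr_ge0.
    by apply: sin_ge0_pi; rewrite divr_ge0//= (le_trans le1)// (le_trans _ (pi_ge2 _))// ler1n.
  by rewrite (le_trans (sin_le1 _))// ltW.
have : sin (x / 2) ^+ 2 <= (x / 2) ^+ 2.
  by rewrite -[leLHS]real_normK ?num_real// lerXn2r ?nnegrE// divr_ge0.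
by rewrite expr_div_n; lra.
Qed.

Lemma cos_upper x : `|x| <= 1 -> x ^+ 2 / 8 <= 1 - cos x.
Proof.
wlog x0 : x / 0 <= x => [h|].
  have [/h//|x0] := leP 0 x.
  by rewrite -normrN -cosN -sqrrN; apply: h; rewrite oppr_ge0 ltW.
rewrite ger0_norm// => x1; rewrite one_subr_cos.
have h : x / 4 <= sin (x / 2).
  move: x0; rewrite le_eqVlt => /predU1P[<-|x0]; first by rewrite !mul0r sin0.
  have x20 : 0 < x / 2 by rewrite divr_gt0.
  have [c /andP[c0 cx] ->] := sin_mvt x20.
  have c2 : 1 / 2 <= cos c.
    apply: le_trans (cos_lower c); have : c ^+ 2 <= 1.
      by rewrite expr_le1 ?ltW// (lt_le_trans cx)//; lra.
    by lra.
  by rewrite (_ : x / 4 = 1 / 2 * (x / 2)); [rewrite ler_pM2r|field].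
have : (x / 4) ^+ 2 <= sin (x / 2) ^+ 2.
  by rewrite lerXn2r ?nnegrE ?divr_ge0// (le_trans _ h)// divr_ge0.
by rewrite expr_div_n; lra.
Qed.

Lemma cos_half x : 0 <= x -> x <= 1 -> 1 / 2 <= cos x.
Proof.
move=> x0 x1; apply: le_trans (cos_lower x).
have : x ^+ 2 <= 1 by rewrite expr_le1.
by lra.
Qed.

End Trigonometry.

Section Nonlattice.
Context {R : realType} {d : measure_display} {T : measurableType d}.
Variables (P : probability T R) (Z : T -> R[i]).
Hypothesis mZ : measurable_fun setT Z.

Definition charf (t : R[i]) : R[i] := Psi P (fun=> 1) Z t.

Definition ae_const (t : R[i]) := exists c : R, {ae P, forall w, Re (t * Z w) = c}.

Let PP := (P \x P)%E : probability (T * T)%type R.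
Let D (p : T * T) : R[i] := Z p.1 - Z p.2.

Let mD : measurable_fun setT D.
Proof.
apply: measurable_funCD; first exact: (measurableT_comp mZ measurable_fst).
apply/measurable_complexP; have /measurable_complexP[mr mi] := mZ.
split; [under eq_fun do rewrite cReN|under eq_fun do rewrite cImN];
  apply: measurableT_comp => //.
- exact: (measurableT_comp mr measurable_snd).
- exact: (measurableT_comp mi measurable_snd).
Qed.

Lemma measurable_ReM (t : R[i]) d' (T' : measurableType d') (Y : T' -> R[i]) :
  measurable_fun setT Y -> measurable_fun setT (fun w => Re (t * Y w)).
Proof.
move=> mY; apply: (measurableT_comp measurable_Re).
by apply: measurable_funCM => //; exact: measurable_cst.
Qed.

Lemma charfE t : charf t = cEx P (fun w => eC (Re (t * Z w))).
Proof.
by apply: eq_cEx => w; rewrite (_ : Complex 1 0 = 1 :> R[i])// mul1r.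
Qed.

Lemma normc_charf_le1 t : normc (charf t) <= 1.
Proof.
by apply: le_trans (normc_Psi P t (bmf_cst 1) _ mZ) _; rewrite ?Ex_cst.
Qed.

(** |phi|^2 is the transform of Z - Z' for two independent copies, which is real by symmetry. *)
Lemma symmetrize t :
  1 - normc (charf t) ^+ 2 = Ex PP (fun p => 1 - cos (Re (t * D p))).
Proof.
have mt := measurable_ReM t mZ.
have bc := bmf_cos mt; have bs := bmf_sin mt.
have bcc := bmf_cos (measurable_ReM t mD).
rewrite ExB//; last exact: bmf_cst.
rewrite Ex_cst; congr (_ - _).
have E := Ex_fubini P P bcc; rewrite [RHS]E charfE normc_sqr /= {E}; apply/esym.
rewrite (eq_Ex P (g := fun w => Ex P (fun w => cos (Re (t * Z w))) * cos (Re (t * Z w)) +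
    Ex P (fun w => sin (Re (t * Z w))) * sin (Re (t * Z w)))).
  by rewrite ExD ?ExZ -?expr2//; exact: bmfZ.
move=> w.
rewrite (eq_Ex P (g := fun w' => cos (Re (t * Z w)) * cos (Re (t * Z w')) +
    sin (Re (t * Z w)) * sin (Re (t * Z w')))).
  by rewrite ExD ?ExZ//; [ring|exact: bmfZ|exact: bmfZ].
by move=> w'; rewrite /D mulrBr cReB cosB.
Qed.

(** A second moment of Z is not assumed, so the form t -> E[Re(t D)^2] is cut off at |D| <= n; the
    cut-off forms increase with [n]. *)
Let trunc (n : nat) (f : R[i] -> R) (p : T * T) : R :=
  if normc (D p) <= n%:R then f (D p) else 0.

Let Q n f := Ex PP (trunc n f).

Let bmf_trunc n (f : R[i] -> R) (M : R) : measurable_fun setT f ->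
  (forall z, normc z <= n%:R -> `|f z| <= M) -> bmf (trunc n f).
Proof.
move=> mf fM; split.
  apply: measurable_fun_ifT; last exact: measurable_cst.
    by apply: measurable_fun_ler; [exact: measurable_normc|exact: measurable_cst].
  exact: (measurableT_comp mf mD).
exists (Num.max M 0) => p; rewrite /trunc; case: ifPn => [h|_].
  by rewrite le_max fM.
by rewrite normr0 le_max lexx orbT.
Qed.

Lemma abs_ReM (t z : R[i]) : `|Re (t * z)| <= normc t * normc z.
Proof. by rewrite -normcM Re_le_normc. Qed.

Let sq (t z : R[i]) := Re (t * z) ^+ 2.

Let bmf_sq n t : bmf (trunc n (sq t)).
Proof.
apply: (@bmf_trunc _ _ ((normc t * n%:R) ^+ 2)).
  apply: measurable_funX; apply: measurable_ReM; exact: measurable_id.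
move=> z zn; rewrite /sq ger0_norm ?sqr_ge0//.
rewrite -[leLHS]real_normK ?num_real// lerXn2r ?nnegrE ?mulr_ge0 ?normc_ge0//.
by apply: le_trans (abs_ReM t z) _; rewrite ler_wpM2l ?normc_ge0.
Qed.

Lemma trunc_lower n t : normc t * n%:R <= 1 ->
  Q n (sq t) <= 16 * (1 - normc (charf t)).
Proof.
move=> tn.
have h : Q n (sq t) / 8 <= 1 - normc (charf t) ^+ 2.
  rewrite symmetrize mulrC -ExZ//; apply: le_Ex.
  - exact: bmfZ.
  - apply: bmfB; [exact: bmf_cst|exact: bmf_cos (measurable_ReM t mD)].
  move=> p; rewrite /trunc; case: ifPn => [h|_]; last by rewrite mulr0 subr_ge0 cos_le1.
  rewrite mulrC cos_upper// (le_trans (abs_ReM _ _))// (le_trans _ tn)//.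
  by rewrite ler_wpM2l// normc_ge0.
(* The passage from 8 to 16 is 1 - x^2 <= 2 (1 - x) for x in [0, 1]. *)
have := normc_charf_le1 t; have := normc_ge0 (charf t).
move: h; move: (normc (charf t)) => x; move: (Q _ _) => y; nra.
Qed.

Lemma ae_section (A : T * T -> Prop) : {ae PP, forall p, A p} ->
  exists w, {ae P, forall w', A (w, w')}.
Proof.
move=> [N [mN N0 sN]].
have mx : measurable_fun setT (fun w => P (xsection N w)) by exact: measurable_fun_xsection.
have [w hw] : exists w, P (xsection N w) = 0%E.
  apply: (@ae_witness _ _ _ P).
  have h := (ae_eq_integral_abs P measurableT mx).1.
  suff H : (\int[P]_w `|P (xsection N w)| = 0)%E.
    by move: (h H); apply: filterS => w /(_ I).
  rewrite -N0; apply: eq_integral => w _; rewrite gee0_abs//.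
exists w; exists (xsection N w); split=> //.
  exact: measurable_xsection.
by move=> w' /= h'; rewrite /xsection /= inE; exact: sN.
Qed.

Lemma Q0_ae_const t : (forall n, Q n (sq t) = 0) -> ae_const t.
Proof.
move=> Q0.
have h0 : {ae PP, forall p, forall n, trunc n (sq t) p = 0}.
  apply: ae_foralln => n; apply: (Ex_eq0 (bmf_sq n t) _ (Q0 n)) => p.
  by rewrite /trunc; case: ifP => // _; exact: sqr_ge0.
have /ae_section[w hw] : {ae PP, forall p, Re (t * D p) = 0}.
  apply: filterS h0 => p h; have [n hn] : exists n, normc (D p) <= n%:R.
    by exists (Num.bound (normc (D p))); exact/ltW/archi_boundP/normc_ge0.
  by have := h n; rewrite /trunc hn => /eqP; rewrite sqrf_eq0 => /eqP.
exists (Re (t * Z w)); apply: filterS hw => w' /=.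
by rewrite /D mulrBr cReB => /eqP; rewrite subr_eq0 => /eqP.
Qed.

Lemma Q_homo n m t : (n <= m)%N -> Q n (sq t) <= Q m (sq t).
Proof.
move=> nm; apply: le_Ex => // p; rewrite /trunc.
case: ifPn => h; last by case: ifP => // _; exact: sqr_ge0.
by rewrite (le_trans h) ?ler_nat.
Qed.

Lemma Q_ge0 n t : 0 <= Q n (sq t).
Proof. by apply: Ex_ge0 => p; rewrite /trunc; case: ifP => // _; exact: sqr_ge0. Qed.

Let prodRI (z : R[i]) := Re z * Im z.

Lemma Q_expand n t : Q n (sq t) =
  Re t ^+ 2 * Q n (sq 1) - 2 * Re t * Im t * Q n prodRI + Im t ^+ 2 * Q n (sq (Complex 0 1)).
Proof.
have b1 : bmf (trunc n prodRI).
  apply: (@bmf_trunc _ _ (n%:R * n%:R)).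
    apply: measurable_funM; [exact: measurable_Re|exact: measurable_Im].
  move=> z zn; rewrite normrM; apply: ler_pM => //.
    exact: le_trans (Re_le_normc z) zn.
  exact: le_trans (Im_le_normc z) zn.
rewrite /Q -!ExZ// -ExB; [|exact: bmfZ|exact: bmfZ].
rewrite -ExD; [|by apply: bmfB; exact: bmfZ|exact: bmfZ].
apply: eq_Ex => p; rewrite /trunc /sq /prodRI; case: ifP => _; last by rewrite !mulr0 subrr addr0.
by case: (D p) => a b; case: (t) => t1 t2; rewrite !cReM /=; ring.
Qed.

Lemma exists_Q_gt0 t : ~ ae_const t -> exists n, 0 < Q n (sq t).
Proof.
move=> nc; apply: contrapT => H; apply: nc; apply: Q0_ae_const => n.
apply/eqP; rewrite eq_le Q_ge0 andbT leNgt; apply/negP => h; apply: H.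
by exists n.
Qed.

Lemma nonlattice_line t : ~ ae_const t -> exists r c : R, [/\ 0 < r, 0 < c &
  forall s : R, `|s| <= r -> normc (charf (Complex s 0 * t)) <= 1 - c * s ^+ 2].
Proof.
move=> /exists_Q_gt0[n Qn].
exists ((normc t * n%:R + 1)^-1), (Q n (sq t) / 16); split.
- by rewrite invr_gt0 ltr_wpDl// mulr_ge0 ?normc_ge0.
- by rewrite divr_gt0.
move=> s hs.
have := @trunc_lower n (Complex s 0 * t); rewrite normcM normcR.
have -> : Q n (sq (Complex s 0 * t)) = s ^+ 2 * Q n (sq t).
  rewrite /Q -ExZ//; apply: eq_Ex => p; rewrite /trunc /sq; case: ifP => _; last by rewrite mulr0.
  by rewrite !cReM !cImM /=; ring.
have p0 : 0 < normc t * n%:R + 1 by rewrite ltr_wpDl// mulr_ge0 ?normc_ge0.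
move=> H; have {}H := H _.
have /H : `|s| * normc t * n%:R <= 1.
  rewrite -mulrA; apply: (@le_trans _ _ ((normc t * n%:R + 1)^-1 * (normc t * n%:R + 1))).
    by apply: ler_pM; rewrite ?mulr_ge0 ?normc_ge0// lerDl.
  by rewrite mulVf// gt_eqF.
by lra.
Qed.

(** Each direction is detected by some cut-off [n], and a single [n] must serve all directions. If
    no determinant A C - M^2 were positive, every form with n >= n1 would vanish at the direction (M
    / A, 1); as the forms increase with [n], this direction would be the same for all of them, and
    Re(t Z) would be constant for that t. *)
Lemma nonlattice_plane : (forall t, t != 0 -> ~ ae_const t) ->
  exists r c : R, [/\ 0 < r, 0 < c &
  forall t, normc t <= r -> normc (charf t) <= 1 - c * normc t ^+ 2].
Proof.
move=> nc.
pose A n := Q n (sq 1); pose C n := Q n (sq (Complex 0 1)); pose M n := Q n prodRI.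
have [n1 An1] : exists n, 0 < A n.
  by apply: exists_Q_gt0; apply: nc; exact: oner_neq0.
have A0 n : (n1 <= n)%N -> 0 < A n by move=> h; apply: lt_le_trans An1 (Q_homo _ h).
have [n [n1n det]] : exists n, (n1 <= n)%N /\ 0 < A n * C n - M n ^+ 2.
  apply: contrapT => H.
  have det0 n : (n1 <= n)%N -> A n * C n - M n ^+ 2 <= 0.
    by move=> h; rewrite leNgt; apply/negP => h'; apply: H; exists n.
  pose la n := M n / A n.
  have QE n l : Q n (sq (Complex l 1)) = l ^+ 2 * A n - 2 * l * M n + C n.
    by rewrite Q_expand /= expr1n mulr1 mul1r.
  have Q0 n : (n1 <= n)%N -> Q n (sq (Complex (la n) 1)) = 0.
    move=> h; apply/eqP; rewrite eq_le Q_ge0 andbT QE.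
    have -> : la n ^+ 2 * A n - 2 * la n * M n + C n =
        (A n * C n - M n ^+ 2) / A n.
      by rewrite /la; field; rewrite gt_eqF// A0.
    by rewrite pmulr_lle0 ?invr_gt0 ?A0// det0.
  have laE n : (n1 <= n)%N -> la n = la n1.
    move=> h.
    have h1 : Q n1 (sq (Complex (la n) 1)) = 0.
      by apply/eqP; rewrite eq_le Q_ge0 andbT -(Q0 n h) Q_homo.
    have h2 := Q0 n1 (leqnn _); rewrite QE in h1; rewrite QE in h2.
    have E : (la n - la n1) ^+ 2 * A n1 = 0.
      have ME : M n1 = la n1 * A n1 by rewrite /la divfK// gt_eqF.
      rewrite ME in h1 h2; move: h1 h2; move: (la n) (la n1) (A n1) (C n1) => x y a c h1 h2.
      have -> : (x - y) ^+ 2 * a = (x ^+ 2 * a - 2 * x * (y * a) + c) -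
        (y ^+ 2 * a - 2 * y * (y * a) + c) by ring.
      by rewrite h1 h2 subrr.
    by move/eqP: E; rewrite mulf_eq0 (gt_eqF An1) orbF sqrf_eq0 subr_eq0 => /eqP.
  apply: (nc (Complex (la n1) 1)); first by rewrite eq_complex /= oner_eq0 andbF.
  apply: Q0_ae_const => n; have [h|/ltnW h] := leqP n1 n; first by rewrite -(laE n h) Q0.
  by apply/eqP; rewrite eq_le Q_ge0 andbT -(Q0 n1 (leqnn _)) Q_homo.
have C0 : 0 <= C n by exact: Q_ge0.
have AC : 0 < A n + C n by rewrite ltr_pwDl ?A0.
exists (n%:R + 1)^-1, ((A n * C n - M n ^+ 2) / (A n + C n) / 16); split.
- by rewrite invr_gt0 ltr_wpDl.
- by rewrite !divr_gt0.
move=> t ht.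
have p0 : 0 < n%:R + 1 :> R by rewrite ltr_wpDl.
have /trunc_lower : normc t * n%:R <= 1.
  apply: (@le_trans _ _ ((n%:R + 1)^-1 * (n%:R + 1))).
    by apply: ler_pM; rewrite ?normc_ge0// lerDl.
  by rewrite mulVf// gt_eqF.
(* The determinant over the trace bounds the smaller eigenvalue of a positive definite form from
   below; after multiplication by the trace, the difference is a sum of two squares. *)
have : (A n * C n - M n ^+ 2) / (A n + C n) * normc t ^+ 2 <= Q n (sq t).
  rewrite mulrAC ler_pdivrMr// Q_expand normc_sqr -/(A n) -/(M n) -/(C n) -subr_ge0.
  move: (A n) (M n) (C n) (Re t) (Im t) => a m c x y.
  have -> : (x ^+ 2 * a - 2 * x * y * m + y ^+ 2 * c) * (a + c) -
     (a * c - m ^+ 2) * (x ^+ 2 + y ^+ 2) = (a * x - m * y) ^+ 2 + (c * y - m * x) ^+ 2 by ring.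
  by rewrite addr_ge0 ?sqr_ge0.
by lra.
Qed.

End Nonlattice.

Lemma exprn_small (R : realType) (A x : R) : 0 <= A < 1 -> 0 < x -> exists n, A ^+ n < x.
Proof.
move=> /andP[A0 A1] x0.
have h : (fun n => A ^+ n) @ \oo --> (0 : R) by apply: cvg_expr; rewrite ger0_norm.
have [n hn] := filter_ex (cvgr0_norm_lt _ h x x0).
by exists n; apply: le_lt_trans hn; exact: ler_norm.
Qed.

(** Take [j] with 8^-j < A. For i >= j one has 2^i >= j, so each further squaring multiplies the
    left side by less than A; the constant covers the finitely many smaller [i]. *)
Lemma double_exp_le (R : realType) (A : R) : 0 < A < 1 ->
  exists2 C, 0 < C & forall i, 8^-1 ^+ (2 ^ i) <= C * A ^+ i.
Proof.
move=> /andP[A0 A1]; have h8 : 0 <= (8^-1 : R) < 1 by apply/andP; split; lra.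
have [j hj] := exprn_small h8 A0.
have C0 : 0 < (A ^+ j)^-1 by rewrite invr_gt0 exprn_gt0.
exists (A ^+ j)^-1 => //.
have base i : (i <= j)%N -> 8^-1 ^+ (2 ^ i) <= (A ^+ j)^-1 * A ^+ i.
  move=> ij; apply: (@le_trans _ _ 1); first by rewrite exprn_ile1//; lra.
  rewrite mulrC ler_pdivlMr ?exprn_gt0// mul1r.
  by rewrite ler_wiXn2l// ltW.
elim=> [|i IH]; first exact: base.
have [ij|ij] := leqP i.+1 j; first exact: base.
have u0 : 0 <= (8^-1 : R) ^+ (2 ^ i) by apply: exprn_ge0; lra.
rewrite expnS mulnC exprM expr2 exprSr mulrA; apply: ler_pM => //.
apply: le_trans (ltW hj); apply: ler_wiXn2l; [lra|lra|].
by apply: leq_trans (ltnW (ltn_expl i (isT : (1 < 2)%N))); rewrite -ltnS.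
Qed.

(** * Decay of weighted characteristic functions *)

Arguments Psi : simpl never.
Arguments charf : simpl never.

Section Decay.
Context {R : realType} {d : measure_display} {T : measurableType d}.
Variables (P : probability T R) (X : T -> tree R) (q : set (cseq R) -> \bar R).
Hypothesis iidX : iid_tree P X q.
Variable Z : T -> R[i].
Hypothesis mZ : measurable_fun setT Z.
Hypothesis hS : forall J, smoothing_ineq P X J Z Z.
Variable V : set R[i].
Hypothesis hV : {ae P, forall w, forall j t, V t -> V (t * rootw (X w) j)}.

Let xi w := rootw (X w).
Let psi (F : tree R -> R) t := Psi P (fun w => F (X w)) Z t.
Let phi := charf P Z.

Lemma fun01_cst (c : R) : 0 <= c <= 1 -> fun01 (fun=> c : R).
Proof. by move=> c01; split => //; exact: measurable_cst. Qed.

Lemma psi1 t : psi (fun=> 1) t = phi t. Proof. by []. Qed.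

Lemma prod_good1 del J : prod_good del J (fun=> 1) = (fun=> 1 : R) :> (tree R -> R).
Proof. by apply/funext => x; rewrite /prod_good big1// => j _; case: ifP. Qed.

Lemma bmf_prod_psi (F : tree R -> R) del J t : fun01 F ->
  bmf (fun w => \prod_(j < J) (if del <= normc (xi w j) then normc (psi F (t * xi w j)) else 1)).
Proof.
move=> F01; apply: bmf_prod => j; apply: bmf_if; last exact: bmf_cst.
  exact: (measurable_good_X iidX).
apply: bmc_norm; apply: bmc_Psi => //; first exact: (bmf_comp_X iidX).
by apply: measurable_funCM; [exact: measurable_cst|exact: (measurable_root_X iidX)].
Qed.

Lemma normc_psi_prod_good (F : tree R -> R) del J t : fun01 F ->
  normc (psi (prod_good del J F) t) <=
  Ex P (fun w => \prod_(j < J) (if del <= normc (xi w j) then normc (psi F (t * xi w j)) else 1)).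
Proof.
move=> F01.
have := @hS J del 1 (fun=> 1) (fun=> F) t (fun=> F01).
rewrite big_ord1 (_ : Complex 1 0 = 1 :> R[i])// mul1r => /le_trans; apply.
apply: le_Ex.
- by apply: bmc_norm; apply: (bmc_good_comb iidX).
- exact: bmf_prod_psi.
move=> w; rewrite /good_comb big_ord1 (_ : Complex 1 0 = 1 :> R[i])// mul1r.
rewrite normc_prod; apply: ler_prod => j _; case: ifP => _.
  by rewrite normc_ge0 lexx.
by rewrite normc1 ler01 lexx.
Qed.

Lemma psi_prod_good_le (F : tree R -> R) del J t (b : T -> R) : fun01 F -> bmf b ->
  {ae P, forall w, \prod_(j < J) (if del <= normc (xi w j) then normc (psi F (t * xi w j)) else 1) <= b w} ->
  normc (psi (prod_good del J F) t) <= Ex P b.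
Proof.
move=> F01 bb h; apply: le_trans (normc_psi_prod_good del J t F01) _.
by apply: le_Ex_ae => //; exact: bmf_prod_psi.
Qed.

(** A product of factors close to 1 is linear up to second-order terms, and these are absorbed by
    lowering the slope from 1 to 1 - n kap, where n is the number of factors. *)
Lemma prod_1subr_le (I : Type) (s : seq I) (y : I -> R) kap :
  (forall i, 0 <= y i <= kap) -> (size s)%:R * kap <= 1 ->
  \prod_(i <- s) (1 - y i) <= 1 - (1 - (size s)%:R * kap) * \sum_(i <- s) y i.
Proof.
move=> y01; elim: s => [|a s IH] /=; first by rewrite !big_nil mulr0 subr0.
rewrite -natr1 !big_cons => h.
have kap0 : 0 <= kap by have /andP[/le_trans] := y01 a; apply.
have nk : 0 <= (size s)%:R * kap by rewrite mulr_ge0.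
have hs : (size s)%:R * kap <= 1 by move: h; rewrite mulrDl mul1r; lra.
have S0 : 0 <= \sum_(i <- s) y i by apply: sumr_ge0 => i _; have /andP[] := y01 i.
have /andP[a0 a1] := y01 a; have {}IH := IH hs.
have ya1 : y a <= 1 by move: h; rewrite mulrDl mul1r; lra.
apply: le_trans (ler_wpM2l _ IH) _; first by rewrite subr_ge0.
rewrite (mulrDl _ 1 kap) mul1r; move: S0 nk a0 a1.
move: (y a) (\sum_(i <- s) y i) ((size s)%:R * kap) => u S n S0 nk a0 a1.
rewrite -subr_ge0 (_ : _ - _ = n * u + kap * u + S * (kap - u) + n * S * u); last by ring.
by rewrite !addr_ge0// !mulr_ge0// subr_ge0.
Qed.

Variables (J : nat) (del0 : R) (alpha : R).
Hypotheses (del0_gt0 : 0 < del0)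
  (hmean : 1 < Ex P (fun w => ngood del0 J (xi w))).
Hypotheses (alpha_gt0 : 0 < alpha)
  (hmom : forall del s, 0 < del -> 0 <= s ->
    Ex P (fun w => \sum_(j < J) (if del <= normc (xi w j) then
      Num.min ((normc (xi w j) * s) `^ alpha) 1 else 0)) <= s `^ alpha).
Hypothesis (hsmall : forall e : R, 0 < e -> exists2 del1, 0 < del1 &
  forall del, del <= del1 ->
  Ex P (fun w => if ngood del J (xi w) <= 0 then 1 else 0) <= e).
Variables (r0 c1 : R).
Hypotheses (r0_gt0 : 0 < r0) (c1_gt0 : 0 < c1)
  (hnl : forall t, V t -> normc t <= r0 -> normc (phi t) <= 1 - c1 * normc t ^+ 2).

Let mxi : measurable_fun setT (xi : T -> cseq R).
Proof. exact: (measurableT_comp (measurable_node [::]) iidX.1). Qed.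

Lemma bmf_ngood_xi del : bmf (fun w => ngood del J (xi w)).
Proof. exact: (bmf_comp mxi (bmf_ngood del J)). Qed.

Let a0 := Ex P (fun w => ngood del0 J (xi w)).
(** [kap] is chosen so that the slope 1 - J kap of [prod_1subr_le] equals 1 / a0 and cancels the
    mean number a0 of good children. [c0] is at most [kap], as that lemma requires, and at most the
    value of c1 |t|^2 at |t| = del0 r0; the latter settles the collar del0 r0 <= |t| <= r0, into
    which good children of larger frequencies may fall. *)
Let kap := (1 - a0^-1) / J%:R.
Let c0 := Num.min kap (c1 * (del0 * r0) ^+ 2).

Let J_gt0 : (0 < J)%N.
Proof.
move: hmean; rewrite /ngood; case: J => // .
by rewrite (eq_Ex P (g := fun=> 0)) ?Ex_cst ?ltr10// => w; rewrite big_ord0.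
Qed.

Let a0_gt0 : 0 < a0. Proof. exact: lt_trans ltr01 hmean. Qed.

Let a0V : a0^-1 < 1. Proof. by rewrite invf_lt1. Qed.

Let Jkap : J%:R * kap = 1 - a0^-1.
Proof. by rewrite /kap mulrC divfK// pnatr_eq0 -lt0n. Qed.

Let kap_gt0 : 0 < kap.
Proof. by rewrite divr_gt0 ?subr_gt0// ltr0n. Qed.

Let c0_gt0 : 0 < c0.
Proof. by rewrite lt_min kap_gt0 mulr_gt0// exprn_gt0// mulr_gt0. Qed.

(* Along the tree [1 - |phi|] is superharmonic for the law of a uniform good
   child; [barrier Rad m] compares it with the subharmonic function
   [c0 (1 - (|t| / Rad) ^ alpha)]. *)
Let barrier Rad m := forall t, V t -> del0 * r0 <= normc t ->
  normc (phi t) <= 1 - (c0 * (1 - (normc t / Rad) `^ alpha) - m).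

(** For |t| > r0 the barrier is averaged over the good children. Its constant part is preserved, as
    a0 / a0 = 1, whereas the part in |t|^alpha returns with the factor 1 / a0 because the
    alpha-moment is at most 1. The surplus (1 - 1 / a0) c0 (|t| / Rad)^alpha lowers the error
    [m]. *)
Let barrier_step Rad m : 0 < Rad -> 0 <= m -> barrier Rad m ->
  barrier Rad (Num.max 0 (m - c0 * ((1 - a0^-1) * (r0 / Rad) `^ alpha))).
Proof.
move=> Rad0 m0 hm t Vt ht.
set m' := Num.max 0 _.
have m'0 : 0 <= m' by rewrite le_max lexx.
have s0 : 0 <= normc t / Rad by rewrite divr_ge0 ?normc_ge0// ltW.
have [tr0|r0t] := leP (normc t) r0.
  apply: le_trans (hnl Vt tr0) _.
  have h1 : c0 <= c1 * normc t ^+ 2.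
    rewrite (@le_trans _ _ (c1 * (del0 * r0) ^+ 2))//.
      by rewrite /c0 ge_min lexx orbT.
    rewrite ler_pM2l// lerXn2r ?nnegrE ?normc_ge0// mulr_ge0// ltW//.
  have h2 : 0 <= c0 * (normc t / Rad) `^ alpha by rewrite mulr_ge0 ?powR_ge0// ltW.
  by move: h1 h2 m'0; rewrite mulrBr; lra.
pose s := normc t / Rad.
pose u w (j : 'I_J) := if del0 <= normc (xi w j) then
  Num.min ((normc (xi w j) * s) `^ alpha) 1 else 0.
pose g w (j : 'I_J) : R := if del0 <= normc (xi w j) then 1 else 0.
(* A lower bound for 1 - |phi(t xi_j)|: the barrier where it is informative and 0 otherwise, which
   keeps it between 0 and [kap]. *)
pose y w (j : 'I_J) := if del0 <= normc (xi w j) then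
  Num.max 0 (c0 - m - c0 * Num.min ((normc (xi w j) * s) `^ alpha) 1) else 0.
have u0 w j : 0 <= u w j.
  by rewrite /u; case: ifP => // _; rewrite le_min powR_ge0 ler01.
have y01 w j : 0 <= y w j <= kap.
  rewrite /y; case: ifP => _; last by rewrite lexx ltW.
  rewrite le_max lexx /= ge_max (ltW kap_gt0) /=.
  apply: (@le_trans _ _ c0); last by rewrite /c0 ge_min lexx.
  rewrite -addrA gerDl -opprD oppr_le0 addr_ge0// mulr_ge0 ?(ltW c0_gt0)//.
  by rewrite le_min powR_ge0 ler01.
have yge w j : (c0 - m) * g w j - c0 * u w j <= y w j.
  rewrite /y /g /u; case: ifP => _; last by rewrite !mulr0 subrr.
  by rewrite mulr1 le_max lexx orbT.
have bu : bmf (fun w => \sum_(j < J) u w j).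
  apply: bmf_sum => j; apply: bmf_if; [exact: (measurable_good_X iidX)| |exact: bmf_cst].
  split; last by exists 1 => w; rewrite ger0_norm ?ge_min ?lexx ?orbT// le_min powR_ge0 ler01.
  apply: measurable_minr; last exact: measurable_cst.
  apply: (measurableT_comp (measurable_powR alpha)).
  apply: measurable_funM; last exact: measurable_cst.
  exact: (measurable_normc (measurable_root_X iidX j)).
have bg : bmf (fun w => \sum_(j < J) g w j) := bmf_ngood_xi del0.
pose b w := 1 - a0^-1 * ((c0 - m) * (\sum_(j < J) g w j) - c0 * \sum_(j < J) u w j).
have bb1 : bmf (fun w => (c0 - m) * (\sum_(j < J) g w j) - c0 * \sum_(j < J) u w j).
  by apply: bmfB; exact: bmfZ.
have bb : bmf b by apply: bmfB; [exact: bmf_cst|exact: bmfZ].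
have := @psi_prod_good_le (fun=> 1) del0 J t b (fun01_cst _) bb.
rewrite prod_good1 psi1 => H; have {}H := H _ _.
have E : Ex P b = 1 - a0^-1 * ((c0 - m) * a0 - c0 * Ex P (fun w => \sum_(j < J) u w j)).
  rewrite /b ExB ?Ex_cst ?ExZ ?ExB ?ExZ//; try exact: bmfZ; try exact: bmf_cst.
apply: (@le_trans _ _ (Ex P b)).
  apply: H; first by rewrite ler01 lexx.
  apply: filterS hV => w hw; rewrite /b.
  have Y := prod_1subr_le (s := index_enum 'I_J) (y01 w).
  rewrite -[size _]/(size (index_enum 'I_J)) in Y.
  have szJ : size (index_enum 'I_J) = J by rewrite -sum1_size sum1_card card_ord.
  rewrite szJ Jkap opprB addrCA subrr addr0 in Y.
  apply: (@le_trans _ _ (\prod_(j < J) (1 - y w j))).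
    apply: ler_prod => j _; rewrite /y; case: ifPn => hj; last by rewrite subr0 ler01 lexx.
    apply/andP; split; first exact: normc_ge0.
    rewrite psi1.
    have V' := hw j t Vt.
    have n' : del0 * r0 <= normc (t * xi w j).
      by rewrite normcM mulrC ler_pM// ltW.
    have h1 := hm _ V' n'; have h2 := normc_charf_le1 P mZ (t * xi w j).
    rewrite normcM (_ : normc t * normc (xi w j) / Rad = normc (xi w j) * s) in h1; last first.
      by rewrite /s mulrCA mulrA.
    set pw := (_ * s) `^ alpha in h1 *.
    have [pw1|pw1] := leP pw 1.
      rewrite -/phi in h2 *; rewrite lerBrDl -lerBrDr ge_max subr_ge0 h2 andTb.
      by move: h1; rewrite mulrBr mulr1; lra.
    rewrite mulr1 (_ : c0 - m - c0 = - m); last by ring.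
    by rewrite max_l ?oppr_le0// subr0.
  apply: le_trans (Y _) _; first by rewrite gerBl invr_ge0 ltW.
  rewrite lerB// ler_pM2l ?invr_gt0//.
  by rewrite !mulr_sumr -sumrB; apply: ler_sum => j _; exact: yge.
rewrite E.
have hu := hmom del0_gt0 s0.
have sr : (r0 / Rad) `^ alpha <= (normc t / Rad) `^ alpha.
  apply: ge0_ler_powR; rewrite ?nnegrE; [exact: ltW|by rewrite divr_ge0 ?ltW|exact: s0|].
  by rewrite ler_pM2r ?invr_gt0 ?ltW.
have hm' : m - c0 * ((1 - a0^-1) * (r0 / Rad) `^ alpha) <= m' by rewrite /m' le_max lexx orbT.
rewrite mulrBr mulrCA mulVf ?gt_eqF// mulr1.
have h3 : a0^-1 * (c0 * Ex P (fun w => \sum_(j < J) u w j)) <= a0^-1 * (c0 * (normc t / Rad) `^ alpha).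
  by rewrite ler_pM2l ?invr_gt0// ler_pM2l.
have h4 : c0 * ((1 - a0^-1) * (r0 / Rad) `^ alpha) <= c0 * ((1 - a0^-1) * (normc t / Rad) `^ alpha).
  by rewrite ler_pM2l// ler_pM2l// subr_gt0.
move: h3 h4 hm'; move: (Ex P _) ((normc t / Rad) `^ alpha) ((r0 / Rad) `^ alpha) (a0^-1) => e pt pr ai.
lra.
Qed.

(** With the error [c0] the barrier follows from |phi| <= 1, and every step then removes the same
    amount until the error is 0. *)
Let barrier_iter Rad k : 0 < Rad ->
  barrier Rad (Num.max 0 (c0 - k%:R * (c0 * ((1 - a0^-1) * (r0 / Rad) `^ alpha)))).
Proof.
move=> Rad0; set g := c0 * _.
have g0 : 0 <= g.
  by rewrite !mulr_ge0 ?powR_ge0 ?subr_ge0// ltW.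
elim: k => [|k IH].
  rewrite mul0r subr0 max_r ?ltW// => t _ _.
  apply: le_trans (normc_charf_le1 P mZ t) _.
  have : 0 <= c0 * (normc t / Rad) `^ alpha by rewrite mulr_ge0 ?powR_ge0// ltW.
  by rewrite mulrBr; lra.
have h := barrier_step Rad0 _ IH; have {}h := h (_ : is_true (0 <= _)).
have {}h := h _; move=> t Vt ht; have {}h := h _ t Vt ht.
have m0 : 0 <= Num.max 0 (c0 - k%:R * g) by rewrite le_max lexx.
apply: le_trans (h m0) _.
rewrite -/g.
suff : Num.max 0 (Num.max 0 (c0 - k%:R * g) - g) <= Num.max 0 (c0 - k.+1%:R * g) by lra.
rewrite ge_max le_max lexx /= -natr1 mulrDl mul1r.
have [h1|h1] := leP 0 (c0 - k%:R * g); rewrite le_max.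
  by apply/orP; right; lra.
by apply/orP; left; lra.
Qed.

Lemma inv_powR_half (be : R) : 0 < be -> (2 `^ be^-1)^-1 `^ be = 2^-1.
Proof.
move=> be0; have p2 : 0 < 2 `^ be^-1 :> R by rewrite powR_gt0.
have E2 : (2 `^ be^-1) `^ be = 2 :> R.
  by rewrite -powRrM mulVf ?gt_eqF// powRr1.
by rewrite -(powR_inv1 (ltW p2)) powRAC E2 powR_inv1 ?ler0n.
Qed.

(** For Rad = 2^(1 / alpha) |t| and with the error driven to 0, the barrier at [t] reads |phi(t)| <=
    1 - c0 / 2. The number of steps depends on [t], the bound does not. *)
Lemma charf_lt1 : exists r eta : R, [/\ 0 < r, 0 <= eta < 1 &
  forall t, V t -> r <= normc t -> normc (phi t) <= eta].
Proof.
exists (Num.max r0 (del0 * r0)), (Num.max 0 (1 - c0 / 2)); split.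
- by rewrite lt_max r0_gt0.
- rewrite le_max lexx /= gt_max ltr01 /=.
  by rewrite gtrBl divr_gt0.
move=> t Vt; rewrite ge_max => /andP[tr0 tdr0].
have t0 : 0 < normc t := lt_le_trans r0_gt0 tr0.
pose Rad := normc t * 2 `^ alpha^-1.
have p2 : 0 < 2 `^ alpha^-1 by rewrite powR_gt0.
have Rad0 : 0 < Rad by rewrite mulr_gt0.
have g0 : 0 < c0 * ((1 - a0^-1) * (r0 / Rad) `^ alpha).
  by rewrite !mulr_gt0 ?subr_gt0 ?powR_gt0 ?divr_gt0.
set g := c0 * _ in g0.
pose k := Num.bound (c0 / g).
have hk : c0 - k%:R * g <= 0.
  rewrite subr_le0 -ler_pdivrMr// ltW// archi_boundP// divr_ge0// ltW//.
have := barrier_iter k Rad0 Vt tdr0.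
rewrite -/g max_l// subr0.
have -> : (normc t / Rad) `^ alpha = 1 / 2.
  rewrite /Rad invfM mulrA divff ?gt_eqF// !mul1r.
  exact: inv_powR_half.
move=> h; rewrite le_max; apply/orP; right; apply: le_trans h _; lra.
Qed.

Let p0 := Ex P (fun w => if 2 <= ngood del0 J (xi w) then 1 else 0).

Lemma bmf_two_good : bmf (fun w => if 2 <= ngood del0 J (xi w) then 1 else 0 : R).
Proof.
apply: bmf_if; [|exact: bmf_cst|exact: bmf_cst].
by apply: measurable_fun_ler; [exact: measurable_cst|have [] := bmf_ngood_xi del0].
Qed.

Lemma bmf_no_good del : bmf (fun w => if ngood del J (xi w) <= 0 then 1 else 0 : R).
Proof.
apply: bmf_if; [|exact: bmf_cst|exact: bmf_cst].
by apply: measurable_fun_ler; [have [] := bmf_ngood_xi del|exact: measurable_cst].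
Qed.

Let cnt del w : nat := (\sum_(j < J) (del <= normc (xi w j))%R)%N.

Let ngood_cnt del w : ngood del J (xi w) = (cnt del w)%:R.
Proof. by rewrite /ngood /cnt natr_sum; apply: eq_bigr => j _; case: (_ <= _). Qed.

Let cnt_le del w : (cnt del w <= J)%N.
Proof.
rewrite /cnt -[leqRHS](card_ord J) -sum1_card; apply: leq_sum => j _.
by case: (_ <= _).
Qed.

(** The number of good children is at most 1, plus J on the event that it is at least 2; as its mean
    exceeds 1, this event has positive probability. *)
Lemma two_good_gt0 : 0 < p0 <= 1.
Proof.
apply/andP; split; last first.
  rewrite -[leRHS](Ex_cst P); apply: le_Ex => //; [exact: bmf_two_good|exact: bmf_cst|].
  by move=> w; case: ifP.
have : a0 <= 1 + J%:R * p0.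
  have bJ := bmfZ J%:R bmf_two_good.
  have <- : Ex P (fun w => 1 + J%:R * (if 2 <= ngood del0 J (xi w) then 1 else 0)) =
      1 + J%:R * p0.
    rewrite ExD//; last exact: bmf_cst.
    by rewrite Ex_cst ExZ//; exact: bmf_two_good.
  apply: le_Ex; [exact: bmf_ngood_xi|by apply: bmfD => //; exact: bmf_cst|].
  move=> w; rewrite ngood_cnt ler_nat; case: ifPn => h.
    by rewrite mulr1 nat1r ler_nat leqW// cnt_le.
  by rewrite mulr0 addr0 lern1 -ltnS ltnNge.
have := hmean; rewrite -/a0 => h1 h2.
have : 0 < J%:R * p0 by lra.
by rewrite pmulr_rgt0 ?ltr0n.
Qed.

(** The product is at most x^n when n children are good: 1 for none, x for one, at most x^2 for
    more. As [del <= del0], two children good for [del0] are also good for [del], so that the gain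
    [p0] does not depend on [del]. *)
Lemma psi_contract (F : tree R -> R) del e x t : fun01 F -> del <= del0 ->
  Ex P (fun w => if ngood del J (xi w) <= 0 then 1 else 0) <= e -> 0 <= x <= 1 ->
  {ae P, forall w, forall j, (j < J)%N -> del <= normc (xi w j) ->
    normc (psi F (t * xi w j)) <= x} ->
  normc (psi (prod_good del J F) t) <= e + x * (1 - p0 * (1 - x)).
Proof.
move=> F01 dd he /andP[x0 x1] h.
pose b w := (if ngood del J (xi w) <= 0 then 1 else 0) +
  (x - x * (1 - x) * (if 2 <= ngood del0 J (xi w) then 1 else 0)).
have b2 : bmf (fun w => x * (1 - x) * (if 2 <= ngood del0 J (xi w) then 1 else 0)).
  exact: (bmfZ _ bmf_two_good).
have b3 : bmf (fun w => x - x * (1 - x) * (if 2 <= ngood del0 J (xi w) then 1 else 0)).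
  by apply: bmfB => //; exact: bmf_cst.
have bb : bmf b by apply: bmfD => //; exact: bmf_no_good.
apply: le_trans (psi_prod_good_le (b := b) F01 bb _) _; last first.
  rewrite /b ExD//; last exact: bmf_no_good.
  rewrite ExB//; last exact: bmf_cst.
  rewrite Ex_cst ExZ; last exact: bmf_two_good.
  by rewrite -/p0 lerD// le_eqVlt; apply/orP; left; apply/eqP; ring.
apply: filterS h => w h.
apply: (@le_trans _ _ (x ^+ cnt del w)).
  rewrite /cnt.
  have -> : x ^+ (\sum_(j < J) (del <= normc (xi w j))%R)%N =
      \prod_(j < J) (if del <= normc (xi w j) then x else 1).
    by rewrite expr_sum; apply: eq_bigr => j _; case: ifP.
  apply: ler_prod => j _; case: ifPn => hj; last by rewrite ler01 lexx.
  by rewrite normc_ge0 h.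
rewrite /b !ngood_cnt.
have xx : 0 <= x * (1 - x) by rewrite mulr_ge0// subr_ge0.
case E : (cnt del w) => [|[|n]].
- by rewrite expr0 lexx; case: ifP => _; nra.
- rewrite expr1 lern0/=.
  have : ngood del0 J (xi w) <= ngood del J (xi w) by apply: ngood_homo.
  rewrite !ngood_cnt E ler_nat; case: (cnt del0 w) => [|[|//]] _.
    by rewrite lern0/= mulr0 subr0 add0r.
  by rewrite ler_nat/= mulr0 subr0 add0r.
- rewrite lern0/= add0r; apply: (@le_trans _ _ (x ^+ 2)).
    by rewrite ler_wiXn2l.
  by case: ifP => _; nra.
Qed.

(* Iterating [x |-> e + x (1 - p0 (1 - x))] from [eta < 1] brings it below [x]
   when [e] is small enough. *)
Lemma contract_small eta x : 0 <= eta < 1 -> 0 < x -> exists2 e, 0 < e &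
  exists M : nat, forall (A : nat -> R -> Prop),
   (forall n y y', y <= y' -> A n y -> A n y') ->
   A 0%N eta ->
   (forall n y, 0 <= y <= 1 -> A n y -> A n.+1 (e + y * (1 - p0 * (1 - y)))) ->
   A M x.
Proof.
move=> /andP[eta0 eta1] x0; have /andP[p00 p01] := two_good_gt0.
pose x' := Num.min x eta.
have [xe|ex] := leP x eta; last first.
  exists 1 => //; exists 0%N => A mA A0 _; exact: mA (ltW ex) A0.
(* One step lowers a value y between x and eta by y p0 (1 - y) >= 2 [st]; the choice e = [st] spends
   half of this. *)
pose st := x * p0 * (1 - eta) / 2.
have st0 : 0 < st by rewrite !divr_gt0 ?mulr_gt0 ?subr_gt0.
exists st => //; exists (Num.bound (eta / st)) => A mA A0 Astep.
have H n : A n (Num.max x (eta - n%:R * st)).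
  elim: n => [|n IH]; first by rewrite mul0r subr0 max_r.
  set y := Num.max x _ in IH.
  have yx : x <= y by rewrite le_max lexx.
  have ye : y <= eta.
    by rewrite ge_max xe /= gerBl mulr_ge0// ltW.
  apply: mA (Astep n y _ IH); last first.
    by rewrite (le_trans (ltW x0) yx) (le_trans ye (ltW eta1)).
  have h : st + y * (1 - p0 * (1 - y)) <= y - st.
    have : x * (p0 * (1 - eta)) <= y * (p0 * (1 - y)).
      rewrite ler_pM//; [exact: ltW|by rewrite mulr_ge0 ?subr_ge0// ltW|].
      by rewrite ler_pM2l// lerB.
    by rewrite /st; lra.
  apply: le_trans h _; rewrite /y -natr1 mulrDl mul1r.
  have [h1|h1] := leP x (eta - n%:R * st); rewrite le_max; apply/orP.
    by right; lra.
  by left; lra.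
apply: mA (H _); rewrite ge_max lexx /=.
apply: (@le_trans _ _ 0); last exact: ltW.
rewrite subr_le0 -ler_pdivrMr// ltW// archi_boundP// divr_ge0// ltW//.
Qed.

Lemma charf_vanish x : 0 < x -> exists2 r, 0 < r &
  forall t, V t -> r <= normc t -> normc (phi t) <= x.
Proof.
move=> x0; have [r [eta [r_gt0 eta01 hr]]] := charf_lt1.
have [e e0 [M hM]] := contract_small eta01 x0.
have [del1 del10 hdel1] := hsmall e0.
pose del := Num.min del1 del0.
have del_gt0 : 0 < del by rewrite lt_min del10.
(* Each contraction step divides the radius by [del]. *)
pose A (n : nat) (y : R) := exists2 r', 0 < r' &
  forall t, V t -> r' <= normc t -> normc (phi t) <= y.
apply: (hM A).
- by move=> n y y' yy' [r' r'0 h]; exists r' => // t Vt rt; exact: le_trans (h t Vt rt) yy'.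
- by exists r.
move=> n y y01 [r' r'0 h]; exists (r' / del); first by rewrite divr_gt0.
move=> t Vt rt; rewrite -[phi t]psi1 -(prod_good1 del J).
apply: psi_contract => //.
- by apply: fun01_cst; rewrite ler01 lexx.
- by rewrite /del ge_min lexx orbT.
- by apply: hdel1; rewrite /del ge_min lexx.
apply: filterS hV => w hw j _ hj; apply: h; first exact: hw.
rewrite normcM; move: rt; rewrite ler_pdivrMr// => /le_trans; apply.
by rewrite ler_wpM2l ?normc_ge0.
Qed.

Lemma psiB (F G : tree R -> R) t : bmf F -> bmf G ->
  psi (fun x => F x - G x) t = psi F t - psi G t.
Proof.
move=> bF bG; rewrite /psi -PsiB//.
- exact: bmf_comp iidX.1 bF.
- exact: bmf_comp iidX.1 bG.
Qed.

Lemma psiZ c (F : tree R -> R) t : bmf F ->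
  psi (fun x => c * F x) t = Complex c 0 * psi F t.
Proof. by move=> bF; rewrite /psi -PsiZ//; exact: bmf_comp iidX.1 bF. Qed.

Lemma psi0 (F : tree R -> R) : psi F 0 = Complex (Ex P (fun w => F (X w))) 0.
Proof.
rewrite /psi /Psi -cEx_real; apply: eq_cEx => w.
by rewrite mul0r /= eC0 mulr1.
Qed.

(** * Second differences of products and the recursive functionals *)

Section ProductTriple.
Variable y : R.
Hypothesis y0 : 0 <= y.

(** [a], [b], [c] stand for the transforms that belong to z = 1, 1/2, 0: the first differences are
    of order y, the second one of order y^2. *)
Definition triple_bound (a b c : R[i]) := 
  [/\ [/\ normc a <= 4^-1, normc b <= 4^-1 & normc c <= 4^-1],
      normc (a - b) <= y, normc (b - c) <= y &
      normc (a - Complex 2 0 * b + c) <= 4 * y ^+ 2].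

(* The bound [4 y^2] on the second difference is stable under products because
   all the factors are at most 1/4. *)
Lemma triple_boundM a b c a' b' c' : triple_bound a b c -> triple_bound a' b' c' ->
  triple_bound (a * a') (b * b') (c * c').
Proof.
move=> [[ha hb hc] hab hbc hd] [[ha' hb' hc'] hab' hbc' hd'].
have pos := @normc_ge0 R.
have M4 (u v : R[i]) : normc u <= 4^-1 -> normc v <= 4^-1 -> normc (u * v) <= 4^-1.
  move=> hu hv; rewrite normcM (le_trans (ler_pM _ _ hu hv))//.
  by lra.
have D (u v u' v' : R[i]) : normc u' <= 4^-1 -> normc v <= 4^-1 -> normc (u - v) <= y ->
    normc (u' - v') <= y -> normc (u * u' - v * v') <= y.
  move=> h1 h2 h3 h4.
  rewrite (_ : u * u' - v * v' = (u - v) * u' + v * (u' - v')); last by ring.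
  apply: le_trans (normc_triangle _ _) _; rewrite !normcM.
  have H (A B : R) : A <= y / 4 -> B <= 4^-1 * y -> A + B <= y by move: y0; lra.
  exact: H (ler_pM (pos _) (pos _) h3 h1) (ler_pM (pos _) (pos _) h2 h4).
split; [by split; exact: M4|exact: D|exact: D|].
(* Leibniz rule for second differences. The three terms contribute y^2, 2 y^2 and y^2, which adds up
   to 4 y^2 again. *)
rewrite (_ : _ + _ = (a - Complex 2 0 * b + c) * a' +
   Complex 2 0 * ((b - c) * (a' - b')) + c * (a' - Complex 2 0 * b' + c')); last first.
  have -> : Complex 2 0 = 1 + 1 :> R[i] by apply: complex_ext => /=; rewrite ?addr0//.
  by ring.
apply: le_trans (normc_triangle _ _) _.
apply: le_trans (lerD (normc_triangle _ _) (lexx _)) _.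
rewrite !normcM normcR ger0_norm//.
have h1 := ler_pM (pos _) (pos _) hd ha'.
have h2 := ler_pM (pos _) (pos _) hbc hab'.
have h3 := ler_pM (pos _) (pos _) hc hd'.
have H (A B C : R) : A <= 4 * y ^+ 2 / 4 -> B <= y * y -> C <= 4^-1 * (4 * y ^+ 2) ->
    A + 2 * B + C <= 4 * y ^+ 2 by rewrite expr2; lra.
exact: H h1 h2 h3.
Qed.

(** Without good factors A = B = C = 1 and all differences vanish, so no additive error arises, in
    contrast to [psi_contract]. With at least one, the triple bounds multiply. *)
Lemma triple_bound_prod (I : Type) (s : seq I) (good : I -> bool) (a b c : I -> R[i]) :
  (forall i, good i -> triple_bound (a i) (b i) (c i)) ->
  let A := \prod_(i <- s) (if good i then a i else 1) in
  let B := \prod_(i <- s) (if good i then b i else 1) in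
  let C := \prod_(i <- s) (if good i then c i else 1) in
  [/\ normc (A - B) <= y, normc (B - C) <= y & normc (A - Complex 2 0 * B + C) <= 4 * y ^+ 2].
Proof.
move=> h A B C.
have : (A = 1 /\ B = 1 /\ C = 1) \/ triple_bound A B C.
  rewrite /A /B /C {A B C}; elim: s => [|i s IH]; first by left; rewrite !big_nil.
  rewrite !big_cons; case: ifPn => gi; last by rewrite !mul1r.
  case: IH => [[-> [-> ->]]|IH]; last by right; apply: triple_boundM => //; exact: h.
  by rewrite !mulr1; right; exact: h.
case=> [[-> [-> ->]]|[_ hab hbc hd]]; last by split.
have -> : 1 - Complex 2 0 * 1 + 1 = 0 :> R[i] by apply: complex_ext => /=; ring.
by rewrite subrr normc0; split => //; rewrite mulr_ge0 ?sqr_ge0.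
Qed.

End ProductTriple.

Section GoodFunctional.
Variables (del : R) (M : nat).

Let B := prod_good (R := R) del J.

Definition thin (z : R) (w : tree R -> R) (x : tree R) := 1 - (1 - z) * w x.

(* If [w] is the indicator of an event, [iter M B (thin z w)] is [z ^ N], where
   [N] counts the good nodes of generation [M] whose subtree satisfies the event.
   The combination below is then [1 - 2^(1-N) + 0^N]: it vanishes for [N <= 1]. *)
Definition refine (w : tree R -> R) (x : tree R) :=
  1 - 2 * iter M B (thin 2^-1 w) x + iter M B (thin 0 w) x.

Lemma fun01_thin z w : 0 <= z <= 1 -> fun01 w -> fun01 (thin z w).
Proof.
move=> /andP[z0 z1] w01; have bw := fun01_bmf w01; have [_ w1] := w01; split.
  by have [] : bmf (thin z w) by apply: bmfB; [exact: bmf_cst|exact: bmfZ].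
by move=> x; have /andP[h0 h1] := w1 x; rewrite /thin; nra.
Qed.

Lemma fun01_iter m F : fun01 F -> fun01 (iter m B F).
Proof. by move=> F01; elim: m => //= m IH; exact: fun01_prod_good. Qed.

Lemma half01 : 0 <= (2^-1 : R) <= 1. Proof. by apply/andP; split; lra. Qed.
Lemma zero01 : 0 <= (0 : R) <= 1. Proof. by rewrite lexx ler01. Qed.

(** The last inequality makes [refine w] nonnegative. It passes to products only in company with the
    other three, hence the joint induction. *)
Lemma iter_pair m w x : fun01 w ->
  let p := iter m B (thin 2^-1 w) x in let r := iter m B (thin 0 w) x in
  [/\ 0 <= r, r <= p, p <= 1 & 2 * p - r <= 1].
Proof.
move=> w01; have [_ w1] := w01; elim: m x => [|m IH] x /=.
  by rewrite /thin; have /andP[h0 h1] := w1 x; split; lra.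
move: IH; move: (iter m B (thin 2^-1 w)) (iter m B (thin 0 w)) => fp fr IH.
rewrite /B /prod_good; elim: (index_enum 'I_J) => [|j s IHs]; first by rewrite !big_nil; split; lra.
rewrite !big_cons; case: ifPn => _; last by rewrite !mul1r.
have := IH (subtree j x) => /=.
move: IHs; set u := \prod_(_ <- s) _; set v := \prod_(_ <- s) _.
move: (fp _) (fr _) => p r.
move=> [v0 vu u1 uv] [r_0 rp p1 pr].
have u0 := le_trans v0 vu; have p_0 := le_trans r_0 rp.
split; [exact: mulr_ge0|exact: ler_pM|exact: mulr_ile1|].
(* 1 - 2 u p + v r is the sum of these two products and of 1 - 2 p + r. *)
have h1 : 0 <= (1 + v - 2 * u) * p by rewrite mulr_ge0//; lra.
have h2 : 0 <= (1 - v) * (p - r) by rewrite mulr_ge0//; lra.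
by move: h1 h2; nra.
Qed.

Lemma fun01_refine w : fun01 w -> fun01 (refine w).
Proof.
move=> w01.
have h1 := fun01_iter M (fun01_thin half01 w01).
have h0 := fun01_iter M (fun01_thin zero01 w01).
split.
  have [] // : bmf (refine w).
  apply: bmfD; last exact: fun01_bmf.
  by apply: bmfB; [exact: bmf_cst|apply: bmfZ; exact: fun01_bmf].
move=> x; rewrite /refine; have [] := iter_pair M x w01 => /=; lra.
Qed.

Lemma psi_refine w t : fun01 w -> psi (refine w) t =
  phi t - Complex 2 0 * psi (iter M B (thin 2^-1 w)) t + psi (iter M B (thin 0 w)) t.
Proof.
move=> w01.
have h1 := fun01_bmf (fun01_iter M (fun01_thin half01 w01)).
have h0 := fun01_bmf (fun01_iter M (fun01_thin zero01 w01)).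
rewrite -psiZ// -psi1 -psiB//; [|exact: bmf_cst|exact: bmfZ].
have h2 : bmf (fun x => 1 - 2 * iter M B (thin 2^-1 w) x).
  by apply: bmfB; [exact: bmf_cst|exact: bmfZ].
by rewrite /psi -(PsiD P t (bmf_comp iidX.1 h2) (bmf_comp iidX.1 h0)).
Qed.

Definition weights_iter k := iter k refine (fun=> 1).

Lemma fun01_weights k : fun01 (weights_iter k).
Proof.
elim: k => [|k IH] /=; last exact: fun01_refine.
by apply: fun01_cst; rewrite ler01 lexx.
Qed.

Variables (e eps : R).
Hypotheses (del_gt0 : 0 < del) (del_le : del <= del0) (del_lt1 : del <= 1)
  (he : Ex P (fun w => if ngood del J (xi w) <= 0 then 1 else 0) <= e)
  (he2 : Ex P (fun w => if ngood del J (xi w) <= 0 then 1 else 0) <= 3 * p0 / 16)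
  (eps_le : 0 < eps <= 16^-1)
  (hM : forall A : nat -> R -> Prop,
    (forall n y y', y <= y' -> A n y -> A n y') -> A 0%N (3 / 4) ->
    (forall n y, 0 <= y <= 1 -> A n y -> A n.+1 (e + y * (1 - p0 * (1 - y)))) ->
    A M (eps / 2)).

Let Ew k := Ex P (fun w => 1 - weights_iter k (X w)).

(** At frequency 0 the transform of a functional is its mean, so [psi_contract] applies to means.
    From E[1 - w_k] <= eps, the functional for z = 1/2 starts with mean at most 1/2 + eps/2 <= 3/4,
    and [M] generations bring it to eps/2. As 1 - w_(k+1) is at most twice that functional, the
    bound eps reproduces itself without accumulating. *)
Lemma weights_mass k : Ew k <= eps.
Proof.
have /andP[eps0 eps1] := eps_le.
elim: k => [|k IH].
  by rewrite /Ew (eq_Ex P (g := fun=> 0)) ?Ex_cst ?ltW// => w; rewrite subrr.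
have w01 := fun01_weights k; have bw := bmf_comp_X iidX w01.
have h1 m := fun01_iter m (fun01_thin half01 w01).
have [_ H] : 0 <= eps / 2 /\ Ex P (fun w => iter M B (thin 2^-1 (weights_iter k)) (X w)) <= eps / 2.
  split; first by lra.
  apply: (hM (A := fun n y => Ex P (fun w => iter n B (thin 2^-1 (weights_iter k)) (X w)) <= y)).
  - by move=> n u v uv /le_trans; apply.
  - have -> : Ex P (fun w => iter 0 B (thin 2^-1 (weights_iter k)) (X w)) = 2^-1 + 2^-1 * Ew k.
      rewrite /Ew -ExZ; last by apply: bmfB => //; exact: bmf_cst.
      rewrite -[X in _ = X + _](Ex_cst P) -ExD; [|exact: bmf_cst|by apply: bmfZ; apply: bmfB => //; exact: bmf_cst].
      by apply: eq_Ex => w; rewrite /= /thin; lra.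
    by move: IH; lra.
  - move=> n u u01 hu.
    have F0 (F : tree R -> R) : fun01 F -> normc (psi F 0) = Ex P (fun w => F (X w)).
      move=> [_ F1]; rewrite psi0 normcR ger0_norm// Ex_ge0// => w.
      by have /andP[] := F1 (X w).
    rewrite -F0 /=; last exact: (fun01_prod_good _ _ (h1 n)).
    apply: (psi_contract (h1 n) del_le he u01).
    by apply: aeW => w j _ _; rewrite mul0r F0.
apply: (@le_trans _ _ (Ex P (fun w => 2 * iter M B (thin 2^-1 (weights_iter k)) (X w)))).
  apply: le_Ex.
  - apply: bmfB; [exact: bmf_cst|exact: (bmf_comp_X iidX (fun01_weights k.+1))].
  - by apply: bmfZ; exact: (bmf_comp_X iidX (h1 M)).
  move=> w /=; rewrite /refine; have [] := iter_pair M (X w) w01 => /=; lra.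
by rewrite ExZ; [move: H; lra|exact: (bmf_comp_X iidX (h1 M))].
Qed.

Lemma psi_weights_le k t : normc (psi (weights_iter k) t) <= normc (phi t) + eps.
Proof.
have w01 := fun01_weights k; have bw := fun01_bmf w01.
have -> : psi (weights_iter k) t = phi t - psi (fun x => 1 - weights_iter k x) t.
  by rewrite psiB//; [rewrite opprB addrC subrK|exact: bmf_cst].
apply: le_trans (normc_triangleB _ _) _; rewrite lerD2l.
have bX : bmf (fun w => 1 - weights_iter k (X w)).
  by apply: bmfB; [exact: bmf_cst|exact: (bmf_comp_X iidX)].
apply: le_trans (normc_Psi P t bX _ mZ) (weights_mass k) => w.
by have [_ /(_ (X w))/andP[_]] := w01; rewrite subr_ge0.
Qed.

Lemma smoothing_ineq3 (F G : tree R -> R) (u v z b : R) t : fun01 F -> fun01 G ->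
  {ae P, forall w, normc (
     Complex u 0 * (\prod_(j < J) if del <= normc (xi w j) then phi (t * xi w j) else 1) +
     Complex v 0 * (\prod_(j < J) if del <= normc (xi w j) then psi F (t * xi w j) else 1) +
     Complex z 0 * (\prod_(j < J) if del <= normc (xi w j) then psi G (t * xi w j) else 1)) <= b} ->
  normc (Complex u 0 * phi t + Complex v 0 * psi (B F) t + Complex z 0 * psi (B G) t) <= b.
Proof.
move=> F01 G01 hb.
pose c (i : 'I_3) := nth 0 [:: u; v; z] i.
pose H (i : 'I_3) := nth (fun=> 1) [:: fun=> 1; F; G] i.
have H01 i : fun01 (H i).
  case: i => [[|[|[|//]]] hi] //=; rewrite /H /=.
  by apply: fun01_cst; rewrite ler01 lexx.
have E : \sum_(i < 3) Complex (c i) 0 * Psi P (fun w => prod_good del J (H i) (X w)) Z t =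
    Complex u 0 * phi t + Complex v 0 * psi (B F) t + Complex z 0 * psi (B G) t.
  by rewrite !big_ord_recl big_ord0 addr0 addrA -[phi t]psi1 -(prod_good1 del J).
rewrite -E; apply: le_trans (hS J del c t H01) _.
rewrite -[leRHS](Ex_cst P); apply: le_Ex_ae.
- exact: (bmc_norm (bmc_good_comb iidX del J c t H01 mZ)).
- exact: bmf_cst.
apply: filterS hb => w; rewrite /good_comb !big_ord_recl big_ord0 addr0 addrA.
by [].
Qed.

Variables (r : R).
Hypotheses (r_gt0 : 0 < r)
  (hr : forall t, V t -> r <= normc t -> normc (phi t) <= 16^-1).

(** At generation 0 the three transforms are phi, phi - psi/2 and phi - psi, with psi the transform
    of w_k: the steps are equal, so the second difference is 0, and each modulus is at most 1/16 +
    1/8. Every generation keeps the triple bound and divides the radius by [del]. *)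
Lemma psi_iter_bound k x rho : 0 <= x -> r <= rho ->
  (forall t, V t -> rho <= normc t -> normc (psi (weights_iter k) t) <= x) ->
  forall m t, V t -> rho / del ^+ m <= normc t ->
  triple_bound (x / 2) (phi t) (psi (iter m B (thin 2^-1 (weights_iter k))) t)
    (psi (iter m B (thin 0 (weights_iter k))) t).
Proof.
move=> x0 rrho hx; have x20 : 0 <= x / 2 by rewrite divr_ge0.
have /andP[eps0 eps1] := eps_le.
have w01 := fun01_weights k; have bw := fun01_bmf w01.
have rho0 : 0 < rho by exact: lt_le_trans rrho.
have C01 : psi (thin 0 (weights_iter k)) = fun t => phi t - psi (weights_iter k) t.
  apply/funext => t; rewrite -psi1 -psiB//; last exact: bmf_cst.
  by congr (Psi _ _ _ _); apply/funext => w; rewrite /thin subr0 mul1r.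
have C02 : psi (thin 2^-1 (weights_iter k)) =
    fun t => phi t - Complex 2^-1 0 * psi (weights_iter k) t.
  apply/funext => t; rewrite -psi1 -psiZ// -psiB//; [|exact: bmf_cst|exact: bmfZ].
  by congr (Psi _ _ _ _); apply/funext => w; rewrite /thin; congr (_ - _ * _); lra.
have nh : normc (Complex 2^-1 0 : R[i]) = 2^-1 by rewrite normcR ger0_norm//; lra.
have rho_m m t : rho / del ^+ m <= normc t -> rho <= normc t.
  apply: le_trans; rewrite ler_pdivlMr ?exprn_gt0// ler_piMr ?(ltW rho0)//.
  by rewrite exprn_ile1// ltW.
elim=> [|m IH] t Vt.
  rewrite expr0 divr1 => rt /=; rewrite C01 C02.
  have h1 := hr Vt (le_trans rrho rt).
  have h2 := hx t Vt rt; have h3 := psi_weights_le k t.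
  set a := phi t in h1 h3 *; set b := psi _ t in h2 h3 *.
  have b0 := normc_ge0 b.
  have nb : normc (Complex 2^-1 0 * b) = 2^-1 * normc b by rewrite normcM nh.
  split; first split.
  - by lra.
  - by apply: le_trans (normc_triangleB _ _) _; rewrite nb; lra.
  - by apply: le_trans (normc_triangleB _ _) _; lra.
  - by rewrite opprB addrC subrK nb; lra.
  - rewrite (_ : _ - _ = Complex 2^-1 0 * b).
      by rewrite nb; lra.
    rewrite -[X in _ - (_ - X)](mul1r b) (_ : 1 = Complex 2^-1 0 + Complex 2^-1 0 :> R[i]).
      by ring.
    by apply: complex_ext => /=; lra.
  - rewrite (_ : _ + _ = 0) ?normc0 ?mulr_ge0 ?sqr_ge0//.
    rewrite mulrBr mulrA (_ : Complex 2 0 * Complex 2^-1 0 = 1 :> R[i]); last first.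
      by apply: complex_ext => /=; lra.
    rewrite (_ : Complex 2 0 = 1 + 1 :> R[i]); first by ring.
    by apply: complex_ext => /=; lra.
rewrite exprS invfM mulrCA => rt /=.
have F01 := fun01_iter m (fun01_thin half01 w01).
have G01 := fun01_iter m (fun01_thin zero01 w01).
set F := iter m B _ in IH F01 *; set G := iter m B _ in IH G01 *.
have htr : {ae P, forall w, forall j, (j < J)%N -> del <= normc (xi w j) ->
    triple_bound (x / 2) (phi (t * xi w j)) (psi F (t * xi w j)) (psi G (t * xi w j))}.
  apply: filterS hV => w hw j _ hj; apply: IH; first exact: hw.
  rewrite normcM; move: rt; rewrite mulrC ler_pdivrMr// => /le_trans; apply.
  by rewrite ler_wpM2l ?normc_ge0.
have q01 : 0 <= (4^-1 : R) <= 1 by apply/andP; split; lra.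
have /andP[p00 p01] := two_good_gt0.
(* The level 1/4 is preserved by the contraction as long as the absence of good children has
   probability at most 3 p0 / 16. *)
have qle : 3 * p0 / 16 + 4^-1 * (1 - p0 * (1 - 4^-1)) <= 4^-1 by lra.
have hrt : rho <= normc t.
  apply: (rho_m m.+1); rewrite exprS invfM mulrCA; exact: rt.
have htr2 (u v z b : R) :
    (forall A B' C : R[i], normc (A - B') <= x / 2 -> normc (B' - C) <= x / 2 ->
      normc (A - Complex 2 0 * B' + C) <= 4 * (x / 2) ^+ 2 ->
      normc (Complex u 0 * A + Complex v 0 * B' + Complex z 0 * C) <= b) ->
    normc (Complex u 0 * phi t + Complex v 0 * psi (B F) t + Complex z 0 * psi (B G) t) <= b.
  move=> H; apply: smoothing_ineq3 => //; apply: filterS htr => w hw.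
  have [|h1 h2 h3] := @triple_bound_prod (x / 2) x20 _ (index_enum 'I_J)
    (fun j => del <= normc (xi w j)) (fun j => phi (t * xi w j))
    (fun j => psi F (t * xi w j)) (fun j => psi G (t * xi w j)).
    by move=> j hj; apply: hw.
  exact: H.
have cx1 : Complex 1 0 = 1 :> R[i] by [].
have cN1 : Complex (-1) 0 = -1 :> R[i] by apply: complex_ext => /=; rewrite ?oppr0.
have cx0 : Complex 0 0 = 0 :> R[i] by [].
have cN2 : Complex (-2) 0 = - Complex 2 0 :> R[i] by apply: complex_ext => /=; rewrite ?oppr0.
split; first split.
- by apply: le_trans (hr Vt (le_trans rrho hrt)) _; lra.
- apply: le_trans qle; apply: (psi_contract F01 del_le he2 q01).
  by apply: filterS htr => w hw j Jj hj; have [[]] := hw j Jj hj.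
- apply: le_trans qle; apply: (psi_contract G01 del_le he2 q01).
  by apply: filterS htr => w hw j Jj hj; have [[]] := hw j Jj hj.
- have := htr2 1 (-1) 0 (x / 2); rewrite cx1 cN1 cx0 mul1r mulN1r mul0r addr0; apply.
  by move=> A B' C h _ _; rewrite mul1r mulN1r mul0r addr0.
- have := htr2 0 1 (-1) (x / 2); rewrite cx1 cN1 cx0 mul1r mulN1r mul0r add0r; apply.
  by move=> A B' C _ h _; rewrite mul1r mulN1r mul0r add0r.
- have := htr2 1 (-2) 1 (4 * (x / 2) ^+ 2); rewrite cx1 cN2 !mul1r mulNr; apply.
  by move=> A B' C _ _ h; rewrite !mul1r mulNr.
Qed.

Lemma psi_weights_sq k x rho : 0 <= x -> r <= rho ->
  (forall t, V t -> rho <= normc t -> normc (psi (weights_iter k) t) <= x) ->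
  forall t, V t -> rho / del ^+ M <= normc t ->
  normc (psi (weights_iter k.+1) t) <= x ^+ 2.
Proof.
move=> x0 rrho hx t Vt rt.
rewrite -[weights_iter k.+1]/(refine (weights_iter k)) psi_refine; last exact: fun01_weights.
have [_ _ _] := psi_iter_bound x0 rrho hx Vt rt.
by rewrite (_ : 4 * (x / 2) ^+ 2 = x ^+ 2)//; field.
Qed.

(** The start is 1/16 + eps <= 1/8; each refinement squares the bound and divides the radius by
    del^M. Only [k] refinements went into w_k, whence i <= k. *)
Lemma psi_weights_decay i k t : (i <= k)%N -> V t -> r / (del ^+ M) ^+ i <= normc t ->
  normc (psi (weights_iter k) t) <= 8^-1 ^+ (2 ^ i).
Proof.
have /andP[eps0 eps1] := eps_le.
elim: i k t => [|i IH] [|k] t // ik Vt.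
- rewrite expr0 divr1 expr1 => rt; apply: le_trans (psi_weights_le _ t) _.
  by have := hr Vt rt; lra.
- rewrite expr0 divr1 expr1 => rt; apply: le_trans (psi_weights_le _ t) _.
  by have := hr Vt rt; lra.
rewrite exprS invfM mulrCA mulrC => rt.
rewrite expnS mulnC exprM; apply: (psi_weights_sq (rho := r / (del ^+ M) ^+ i)) => //.
  rewrite ler_pdivlMr ?exprn_gt0// ler_piMr ?(ltW r_gt0)//.
  by rewrite exprn_ile1 ?exprn_ile1 ?exprn_ge0// ltW.
by move=> t' Vt'; exact: IH.
Qed.

End GoodFunctional.

Lemma good_functional eps : 0 < eps <= 16^-1 ->
  exists (w : nat -> tree R -> R) (C : R), [/\ forall k, fun01 (w k),
    forall k, Ex P (fun x => 1 - w k (X x)) <= eps, 0 < C &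
    forall B : R, exists k, forall t, V t -> normc t <= B ->
      normc (psi (w k) t) <= C / (1 + normc t) ^+ 4].
Proof.
move=> eps01; have /andP[eps0 eps1] := eps01.
have e20 : 0 < eps / 2 by lra.
have h34 : 0 <= (3 / 4 : R) < 1 by apply/andP; split; lra.
have [e e0 [M hM]] := contract_small h34 e20.
have /andP[p00 p01] := two_good_gt0.
have M0 : (0 < M)%N.
  (* This predicate says nothing for n > 0, so M = 0 would give 3/4 <= eps/2. A positive [M] is
     needed for D < 1. *)
  case: M hM => // /(_ (fun n y => n = 0%N -> 3 / 4 <= y)) H.
  have h : 3 / 4 <= eps / 2 by apply: H => // n y y' yy' h /h /le_trans; apply.
  by lra.
have e'0 : 0 < Num.min e (3 * p0 / 16) by rewrite lt_min e0 /=; lra.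
have [del1 del10 hdel1] := hsmall e'0.
pose del := Num.min (Num.min del1 2^-1) del0.
have del_gt0 : 0 < del by rewrite !lt_min del10 del0_gt0 invr_gt0 ltr0n.
have del_le : del <= del0 by rewrite ge_min lexx orbT.
have del_half : del <= 2^-1 by rewrite !ge_min lexx orbT.
have del_lt1 : del <= 1 by lra.
have : del <= del1 by rewrite !ge_min lexx.
move=> /hdel1; rewrite le_min => /andP[he he2].
have x16 : 0 < (16^-1 : R) by lra.
have [r r_gt0 hr] := charf_vanish x16.
pose w := weights_iter del M.
have w01 k : fun01 (w k) := fun01_weights del M k.
exists w.
pose D := del ^+ M.
have D0 : 0 < D by rewrite exprn_gt0.
have D1 : D < 1.
  by rewrite /D exprn_ilt1 -?lt0n//; lra.
(* The rate D^4 per scale compensates (1 + |t|)^4 on the shell r / D^i <= |t| < r / D^(i + 1). *)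
have A01 : 0 < D ^+ 4 < 1 by rewrite exprn_gt0//= exprn_ilt1// ltW.
have [C C0 hC] := double_exp_le A01.
pose C' := Num.max 1 (C / D ^+ 4) * (1 + r) ^+ 4.
have C'1 : (1 + r) ^+ 4 <= C'.
  by rewrite /C' ler_peMl ?le_max ?lexx// exprn_ge0//; lra.
have C'2 : C / D ^+ 4 * (1 + r) ^+ 4 <= C'.
  by rewrite /C' ler_wpM2r ?le_max ?lexx ?orbT// exprn_ge0//; lra.
have C'0 : 0 < C' by apply: lt_le_trans C'1; rewrite exprn_gt0//; lra.
exists C'; split => //.
  by move=> k; exact: (weights_mass del_le he eps01 hM).
move=> B.
(* For this [k] the radius r / D^k exceeds B, so any shell that meets |t| <= B has index at most
   [k]. *)
have [k hk] : exists k, D ^+ k * Num.max 1 B < r.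
  have B0 : 0 < Num.max 1 B by rewrite lt_max ltr01.
  have rB : 0 < r / Num.max 1 B by exact: divr_gt0.
  have D01 : 0 <= D < 1 by rewrite ltW.
  have [k hk] := exprn_small D01 rB.
  by exists k; rewrite -ltr_pdivlMr.
exists k => t Vt tB.
have n0 := normc_ge0 t.
have t40 : 0 < (1 + normc t) ^+ 4 by rewrite exprn_gt0//; lra.
rewrite ler_pdivlMr//.
have [tr|rt] := leP (normc t) r.
  apply: le_trans C'1; rewrite -[leRHS]mul1r; apply: ler_pM.
  - exact: normc_ge0.
  - exact: ltW.
  - exact: (Psi_le1 iidX t (w01 k) mZ).
  - by apply: lerXn2r; rewrite ?nnegrE; lra.
have [i [ik h1 h2]] : exists i, [/\ (i <= k)%N, r / D ^+ i <= normc t & normc t < r / D ^+ i.+1].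
  have ex0 : exists i, r / D ^+ i <= normc t by exists 0%N; rewrite expr0 divr1 ltW.
  have hle i : r / D ^+ i <= normc t -> (i <= k)%N.
    apply: contraTT; rewrite -ltnNge -ltNge => ki.
    rewrite ltr_pdivlMr ?exprn_gt0//; apply: le_lt_trans hk.
    rewrite mulrC; apply: ler_pM => //; first exact: exprn_ge0 (ltW D0).
      by apply: ler_wiXn2l; [exact: ltW|exact: ltW|exact: ltnW].
    by rewrite le_max tB orbT.
  case: (ex_maxnP ex0 hle) => i hi himax; exists i; split => //; first exact: hle.
  by rewrite ltNge; apply/negP => /himax; rewrite ltnn.
have dec := psi_weights_decay del_gt0 del_le del_lt1 he he2 eps01 hM r_gt0 hr ik Vt h1.
apply: le_trans C'2.
apply: (@le_trans _ _ (C * (D ^+ 4) ^+ i * ((1 + r) / D ^+ i.+1) ^+ 4)).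
  apply: ler_pM; [exact: normc_ge0|exact: ltW|exact: le_trans dec (hC i)|].
  apply: lerXn2r; rewrite ?nnegrE; [lra| |].
    by apply: divr_ge0; [lra|exact: exprn_ge0 (ltW D0)].
  rewrite mulrDl; apply: lerD; last exact: ltW.
  by rewrite mul1r invf_ge1; [apply: exprn_ile1; exact: ltW|exact: exprn_gt0].
have DE : (D ^+ i.+1) ^+ 4 = D ^+ 4 * D ^+ (4 * i).
  by rewrite -exprM mulnC mulnS exprD.
rewrite expr_div_n DE -exprM le_eqVlt; apply/orP; left; apply/eqP.
have := exprn_gt0 (4 * i) D0; have := exprn_gt0 4 D0.
move: (D ^+ (4 * i)) (D ^+ 4) => u v v0 u0; field.
by rewrite !gt_eqF.
Qed.

End Decay.

(** * From decay to absolute continuity *)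

Section Approximation.
Context {d : measure_display} {E : measurableType d} {R : realType}.
Variables (mu : {measure set E -> \bar R}) (G : set (set E)).
Hypotheses (mufin : (mu setT < +oo)%E)
  (mG : G `<=` measurable) (G0 : G set0)
  (GC : forall A, G A -> G (~` A)) (GU : forall A B, G A -> G B -> G (A `|` B)).

Definition approximable (A : set E) := measurable A /\
  forall e : R, 0 < e -> exists2 B, G B & (mu ((A `\` B) `|` (B `\` A)) <= e%:E)%E.

Lemma le_mu (A B : set E) : measurable A -> measurable B -> A `<=` B -> (mu A <= mu B)%E.
Proof. by move=> mA mB; apply: le_measure; rewrite inE. Qed.

Lemma approximable_gen A : G A -> approximable A.
Proof.
move=> GA; split; first exact: mG.
by move=> e e0; exists A => //; rewrite setDv setU0 measure0 lee_fin ltW.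
Qed.

Lemma approximableC A : approximable A -> approximable (~` A).
Proof.
move=> [mA hA]; split; first exact: measurableC.
move=> e /hA[B GB hB]; exists (~` B); first exact: GC.
suff -> : (~` A `\` ~` B) `|` (~` B `\` ~` A) = (A `\` B) `|` (B `\` A) by [].
by rewrite setDE setCK (setDE (~` B)) setCK setUC !setDE setIC (setIC _ B).
Qed.

Lemma approximableU A B : approximable A -> approximable B -> approximable (A `|` B).
Proof.
move=> [mA hA] [mB hB]; split; first exact: measurableU.
move=> e e0; have e2 : 0 < e / 2 by exact: divr_gt0.
have [A' GA' hA'] := hA _ e2; have [B' GB' hB'] := hB _ e2.
have mA' := mG GA'; have mB' := mG GB'.
have mD (X Y : set E) : measurable X -> measurable Y -> measurable ((X `\` Y) `|` (Y `\` X)).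
  by move=> mX mY; apply: measurableU; exact: measurableD.
exists (A' `|` B'); first exact: GU.
apply: (@le_trans _ _ (mu (((A `\` A') `|` (A' `\` A)) `|` ((B `\` B') `|` (B' `\` B))))).
  apply: le_mu.
  - by apply: mD; exact: measurableU.
  - by apply: measurableU; exact: mD.
  move=> x /=; tauto.
rewrite (splitr e) EFinD; apply: le_trans (measureU2 _ _ _) _; [exact: mD|exact: mD|].
exact: leeD.
Qed.

Lemma approximable_bigsetU (F : nat -> set E) n : (forall i, approximable (F i)) ->
  approximable (\big[setU/set0]_(i < n) F i).
Proof.
move=> hF; elim: n => [|n IH]; first by rewrite big_ord0; exact: approximable_gen.
by rewrite big_ord_recr; exact: approximableU.
Qed.

Lemma approximable_bigcup (F : nat -> set E) : (forall i, approximable (F i)) ->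
  approximable (\bigcup_i F i).
Proof.
move=> hF; have mF i : measurable (F i) by have [] := hF i.
have mU : measurable (\bigcup_i F i) by exact: bigcup_measurable.
pose S n := \big[setU/set0]_(i < n) F i.
have mS n : measurable (S n) by exact: bigsetU_measurable.
split=> // e e0; have e2 : 0 < e / 2 by exact: divr_gt0.
pose D n := (\bigcup_i F i) `\` S n.
have mD n : measurable (D n) by exact: measurableD.
have D0 : \bigcap_n D n = set0.
  rewrite -subset0 => x hx; have [i _ Fx] : (\bigcup_i F i) x by have [] := hx 0%N I.
  have [_] := hx i.+1 I; apply; rewrite /S -bigcup_mkord.
  by exists i => /=.
have hcv : mu (D n) @[n --> \oo] --> 0%E.
  rewrite -(measure0 mu) -D0; apply: nonincreasing_cvg_mu => //.
  - by apply: le_lt_trans mufin; exact: le_mu.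
  - by rewrite D0.
  move=> n m nm; apply/subsetPset => x [Ux Sx]; split => // Sx'; apply: Sx.
  by move: Sx'; rewrite /S -!bigcup_mkord => -[i /= ilt Fx]; exists i => //=; exact: leq_trans nm.
have [n hn] : exists n, (mu (D n) <= (e / 2)%:E)%E.
  have /fine_cvgP[hf /cvgr0_norm_lt hc] := hcv.
  have [n [fn hn]] := filter_ex (filterI hf (hc _ e2)).
  by exists n; rewrite -(fineK fn) lee_fin ltW//; exact: le_lt_trans (ler_norm _) hn.
have [_ /(_ _ e2)[B GB hB]] := approximable_bigsetU n hF.
have mB := mG GB; exists B => //.
have mSB : measurable ((S n `\` B) `|` (B `\` S n)).
  by apply: measurableU; exact: measurableD.
apply: (@le_trans _ _ (mu (D n `|` ((S n `\` B) `|` (B `\` S n))))).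
  apply: le_mu; [by apply: measurableU; exact: measurableD|exact: measurableU|].
  move=> x [[Ux nBx]|[Bx nUx]].
    by have [Sx|nSx] := pselect (S n x); [right; left|left].
  right; right; split => // Sx; apply: nUx; move: Sx.
  by rewrite /S -bigcup_mkord => -[i _ Fx]; exists i.
by rewrite (splitr e) EFinD; apply: le_trans (measureU2 _ _ _) _ => //; exact: leeD.
Qed.

Lemma measurable_approximable : measurable `<=` <<s G >> -> forall A, measurable A -> approximable A.
Proof.
move=> hG A /hG; apply: smallest_sub; last exact: approximable_gen.
split.
- exact: approximable_gen.
- by move=> B hB; rewrite setTD; exact: approximableC.
- exact: approximable_bigcup.
Qed.

End Approximation.

(** The estimate for [Q] is known on the algebra only, with [C] depending on e. A null set inside a
    box is approximated by a set of the algebra for the finite measure formed by [Q] and the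
    restriction of [lam] to the box; the error e / (C + 1) is paid once in [Q] and, multiplied by
    [C], once in [lam]. *)
Lemma null_of_algebra_bound {d} {E : measurableType d} {R : realType}
    (Q : probability E R) (lam : {measure set E -> \bar R}) (G : set (set E)) (box : nat -> set E) :
  G `<=` measurable -> G set0 -> (forall A, G A -> G (~` A)) ->
  (forall A B, G A -> G B -> G (A `|` B)) -> measurable `<=` <<s G >> ->
  (forall m, G (box m)) -> (forall m, (lam (box m) < +oo)%E) -> \bigcup_m box m = setT ->
  (forall e : R, 0 < e -> exists2 C : R, 0 <= C &
    forall B, G B -> (Q B <= e%:E + C%:E * lam B)%E) ->
  forall A, measurable A -> lam A = 0%E -> Q A = 0%E.
Proof.
move=> mG G0 GC GU hG Gbox fbox Ubox hQ A mA A0.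
have mbox m := mG _ (Gbox m).
suff H m : Q (A `&` box m) = 0%E.
  apply: measure_negligible => //; rewrite -[A]setIT -Ubox setI_bigcupr.
  apply: negligible_bigcup => m; exists (A `&` box m); split; [exact: measurableI|exact: H|by []].
have lA : lam (A `&` box m) = 0%E.
  apply/eqP; rewrite -measure_le0 -A0; apply: le_mu => //; exact: measurableI.
pose mu : {measure set E -> \bar R} := measure_add Q (mrestr lam (mbox m)).
have muE X : mu X = (Q X + lam (X `&` box m))%E by rewrite /mu/= /measure_add /= /msum big_ord_recl big_ord1.
have mufin : (mu setT < +oo)%E.
  by rewrite muE setTI lte_add_pinfty// (le_lt_trans (probability_le1 _ _)) ?ltry.
have [_ hap] : approximable mu G (A `&` box m).
  by apply: measurable_approximable => //; exact: measurableI.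
have small (e : R) : 0 < e -> (Q (A `&` box m) <= (e + e)%:E)%E.
  move=> e0; have [C C0 hC] := hQ _ e0.
  have e'0 : 0 < e / (C + 1) by rewrite divr_gt0// ltr_wpDl.
  have [B GB hB] := hap _ e'0; have mB := mG _ GB.
  have Ge : G (B `&` box m).
    by rewrite -[B `&` _]setCK setCI; apply: (GC); apply: (GU); exact: (GC).
  set D := _ `|` _ in hB.
  have mD : measurable D.
    by apply: measurableU; apply: measurableD => //; exact: measurableI.
  rewrite muE in hB.
  have hQD : (Q D <= (e / (C + 1))%:E)%E by apply: le_trans hB; rewrite leeDl.
  have hlD : (lam (D `&` box m) <= (e / (C + 1))%:E)%E by apply: le_trans hB; rewrite leeDr.
  have h1 : (Q (A `&` box m) <= Q (B `&` box m) + Q D)%E.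
    apply: le_trans (measureU2 _ _ _); [|exact: measurableI|exact: mD].
    apply: le_mu; [exact: measurableI|by apply: measurableU => //; exact: measurableI|].
    move=> x [Ax bx]; have [Bx|nBx] := pselect (B x); [by left|by right; left].
  have h2 : (lam (B `&` box m) <= (e / (C + 1))%:E)%E.
    apply: le_trans hlD; rewrite -[leRHS]add0e -lA.
    apply: le_trans (measureU2 _ _ _); [|exact: measurableI|exact: measurableI].
    apply: le_mu; [exact: measurableI|by apply: measurableU; exact: measurableI|].
    move=> x [Bx bx]; have [Ax|nAx] := pselect (A x); first by left.
    by right; split => //; right; split => // -[].
  apply: le_trans h1 _; apply: le_trans (leeD (hC _ Ge) hQD) _.
  apply: (@le_trans _ _ (e%:E + C%:E * (e / (C + 1))%:E + (e / (C + 1))%:E)%E).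
    by rewrite leeD2r// leeD2l// lee_wpmul2l.
  rewrite -EFinM -!EFinD lee_fin -addrA lerD2l.
  rewrite -[X in _ * _ + X]mul1r -mulrDl mulrC divfK// gt_eqF// ltr_wpDl//.
have fQ : Q (A `&` box m) \is a fin_num by apply: fin_num_measure; exact: measurableI.
rewrite -(fineK fQ); congr EFin; apply/eqP; rewrite eq_le fine_ge0// andbT.
apply/ler_addgt0Pr => e e0; rewrite add0r.
have e2 : 0 < e / 2 by exact: divr_gt0.
by have := small _ e2; rewrite -splitr -{1}(fineK fQ) lee_fin.
Qed.
(** [nu] may change with the level [n], as the functional does. Bounding cells suffices: a set of
    level [n] is a countable disjoint union of cells, and the sets of all levels form an algebra
    because each level refines the previous one. *)
Lemma null_of_grid_bound {d} {E : measurableType d} {R : realType} {K : countType}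
    (Q : probability E R) (lam : {measure set E -> \bar R}) (g : nat -> E -> K)
    (f : nat -> K -> K) (box : nat -> set K) :
  (forall n k, measurable (g n @^-1` [set k])) ->
  (forall n x, g n x = f n (g n.+1 x)) ->
  measurable `<=` <<s [set B | exists n S, B = g n @^-1` S] >> ->
  (forall m, (lam (g 0%N @^-1` box m) < +oo)%E) -> \bigcup_m box m = setT ->
  (forall e : R, 0 < e -> exists2 C : R, 0 <= C & forall n, exists nu : set E -> \bar R,
    [/\ forall B, measurable B -> (Q B <= e%:E + nu B)%E,
        forall F : nat -> set E, (forall i, measurable (F i)) -> trivIset setT F ->
          nu (\bigcup_i F i) = (\sum_(0 <= i <oo) nu (F i))%E,
        nu set0 = 0%E & forall k, (0 <= nu (g n @^-1` [set k]) <= C%:E * lam (g n @^-1` [set k]))%E]) ->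
  forall A, measurable A -> lam A = 0%E -> Q A = 0%E.
Proof.
move=> mg gf hG fbox Ubox hnu.
(* Cells are enumerated by [pickle]; a number that codes no element of [S] gives the empty set. *)
pose F n (S : set K) i := g n @^-1` [set k | pickle k = i /\ S k].
have FE n S : g n @^-1` S = \bigcup_i F n S i.
  rewrite predeqE => x; split => [Sx|[i _ []]//].
  by exists (pickle (g n x)).
have tF n S : trivIset setT (F n S).
  by move=> i j _ _ [x [[<- _] [<- _]]].
have Fcase n S i : F n S i = set0 \/ exists k, F n S i = g n @^-1` [set k].
  have [[k [ki Sk]]|nk] := pselect (exists k, pickle k = i /\ S k).
    right; exists k; rewrite predeqE /F /preimage /= => x; split => [[xi _]|-> //].
    by apply: (pcan_inj pickleK); rewrite xi.
  by left; rewrite -subset0 => x hx; apply: nk; exists (g n x).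
have mF n S i : measurable (F n S i) by case: (Fcase n S i) => [->//|[k ->]]; exact: mg.
have mS n S : measurable (g n @^-1` S) by rewrite FE; exact: bigcup_measurable.
have gfm n m : exists f', forall x, g n x = f' (g (m + n)%N x).
  elim: m => [|m [f' hf']]; first by exists id.
  by exists (f' \o f (m + n)%N) => x; rewrite hf' gf.
apply: (null_of_algebra_bound (G := [set B | exists n S, B = g n @^-1` S]) (box := fun m => g 0%N @^-1` box m)) => //.
- by move=> _ [n [S ->]].
- by exists 0%N, set0; rewrite preimage_set0.
- by move=> _ [n [S ->]]; exists n, (~` S); rewrite preimage_setC.
- move=> _ _ [n [S ->]] [m [S' ->]].
  have [f1 h1] := gfm n m; have [f2 h2] := gfm m n.
  exists (m + n)%N, (f1 @^-1` S `|` f2 @^-1` S'); rewrite predeqE => x /=.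
  by rewrite h1 h2 (addnC n).
- by move=> m; exists 0%N, (box m).
- by rewrite -preimage_bigcup Ubox preimage_setT.
move=> e /hnu[C C0 hC]; exists C => // _ [n [S ->]].
have [nu [hQ nuU nu0 hk]] := hC n.
apply: le_trans (hQ _ (mS n S)) _; rewrite leeD2l// FE.
rewrite nuU// measure_bigcup// -nneseriesZl//.
have h i : (0 <= nu (F n S i) <= C%:E * lam (F n S i))%E.
  case: (Fcase n S i) => [->|[k ->]]; last exact: hk.
  by rewrite nu0 measure0 mule0 lexx.
under [leRHS]eq_eseriesl do rewrite in_setT.
apply: lee_nneseries => i _; first by have /andP[] := h i.
by have /andP[] := h i.
Qed.
Section Density.
Context {d : measure_display} {T : measurableType d} {R : realType} (P : probability T R).
Context {d' : measure_display} {E : measurableType d'}.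
Variables (Y : T -> E) (W : T -> R).
Hypotheses (mY : measurable_fun setT Y) (bW : bmf W) (W01 : forall x, 0 <= W x <= 1).

Definition weighted_law (A : set E) : \bar R := (Ex P (fun x => W x * \1_A (Y x)))%:E.

Lemma bmf_weighted A : measurable A -> bmf (fun x => W x * \1_A (Y x)).
Proof.
move=> mA; apply: bmfM => //.
by apply: (bmf_comp mY); exact: bmf_ind.
Qed.

Lemma weighted_lawE A : measurable A ->
  weighted_law A = (\int[P]_(x in Y @^-1` A) (W x)%:E)%E.
Proof.
move=> mA; rewrite /weighted_law /Ex /Rintegral fineK; last first.
  by apply: integrable_fin_num => //; exact: (bmf_int P (bmf_weighted mA)).
have mYA : measurable (Y @^-1` A) by rewrite -[X in measurable X]setTI; exact: mY.
rewrite [RHS]integral_mkcond; apply: eq_integral => x _; rewrite patchE /=.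
by rewrite indicE -[x \in _]/(Y x \in A); case: (Y x \in A); rewrite ?mulr1 ?mulr0.
Qed.

Lemma weighted_law_bigcup (F : nat -> set E) : (forall i, measurable (F i)) -> trivIset setT F ->
  weighted_law (\bigcup_i F i) = (\sum_(0 <= i <oo) weighted_law (F i))%E.
Proof.
move=> mF tF; rewrite weighted_lawE; last exact: bigcup_measurable.
rewrite preimage_bigcup ge0_integral_bigcup.
- by apply: eq_eseriesr => i _; rewrite weighted_lawE.
- by move=> i; rewrite -[X in measurable X]setTI; exact: mY.
- apply/measurable_EFinP; apply: measurable_funS (proj1 bW) => //.
- by move=> x _; rewrite lee_fin; have /andP[] := W01 x.
- by move=> i j _ _ [x [Fi Fj]]; apply: tF => //; exists (Y x).
Qed.

Lemma weighted_law_ge0 A : (0 <= weighted_law A)%E.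
Proof.
rewrite lee_fin Ex_ge0// => x; have /andP[W0 _] := W01 x.
by rewrite mulr_ge0.
Qed.

Lemma law_le_weighted e A : Ex P (fun x => 1 - W x) <= e -> measurable A ->
  (P (Y @^-1` A) <= e%:E + weighted_law A)%E.
Proof.
move=> he mA.
have mYA : measurable (Y @^-1` A) by rewrite -[X in measurable X]setTI; exact: mY.
have b1 : bmf (fun x => 1 - W x) by apply: bmfB => //; exact: bmf_cst.
have b2 := bmf_weighted mA.
have -> : P (Y @^-1` A) = (Ex P (\1_(Y @^-1` A)))%:E.
  by rewrite Ex_ind// fineK//; exact: fin_num_measure.
rewrite -EFinD lee_fin; apply: (@le_trans _ _ (Ex P (fun x => (1 - W x) + W x * \1_A (Y x)))).
  apply: le_Ex; [exact: bmf_ind|exact: bmfD|].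
  move=> x; rewrite !indicE -[x \in _]/(Y x \in A); have /andP[W0 W1] := W01 x.
  case: (Y x \in A); first by rewrite mulr1 subrK.
  by rewrite mulr0 addr0 subr_ge0.
by rewrite ExD// lerD2r.
Qed.

End Density.

(** * Dirichlet kernels and the mass of small cubes *)

Section Dirichlet.
Context {R : realType}.

Lemma dirichlet_ge M (u : R) : (forall j, (j < M)%N -> 0 <= j%:R * u <= 1) ->
  M%:R / 2 <= normc (\sum_(j < M) eC (j%:R * u)).
Proof.
move=> hu; apply: le_trans (le_trans (ler_norm _) (Re_le_normc _)).
rewrite Re_sum (_ : M%:R / 2 = \sum_(j < M) 2^-1); last first.
  by rewrite big_const iter_addr_0 card_ord mulr_natl.
apply: ler_sum => j _ /=; have /andP[h0 h1] := hu j (ltn_ord j).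
by have := cos_half h0 h1; rewrite div1r.
Qed.

(* Both halves of the sum telescope, as 1 / (1 + a)^2 <= 2 / (1 + a) - 2 / (2 + a). *)
Lemma sum_inv_sq (M j : nat) :
  \sum_(l < M) ((1 + `|j%:R - l%:R|) ^+ 2)^-1 <= 4 :> R.
Proof.
pose f (a : R) : R := ((1 + a) ^+ 2)^-1.
have f0 a : 0 <= f a by rewrite invr_ge0 sqr_ge0.
have tel (n : nat) : f n%:R <= 2 / (1 + n%:R) - 2 / (2 + n%:R).
  have n0 : 0 <= n%:R :> R by [].
  rewrite -subr_ge0 /f (_ : _ - _ = n%:R / ((1 + n%:R) ^+ 2 * (2 + n%:R))).
    by rewrite divr_ge0// mulr_ge0 ?sqr_ge0// addr_ge0.
  by field; apply/andP; split; rewrite gt_eqF//; lra.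
have S2 (n : nat) : 1 + n.+1%:R = 2 + n%:R :> R by rewrite -[n.+1%:R]natr1; lra.
have H1 n : \sum_(l < n) (if (l <= j)%N then f (j - l)%:R else 0) <= 2 / (1 + (j.+1 - n)%:R).
  elim: n => [|n IH]; first by rewrite big_ord0 divr_ge0.
  rewrite big_ord_recr /=; case: ifPn => [nj|].
    have := tel (j - n)%N; move: IH; rewrite subSS subSn// S2; lra.
  rewrite -ltnNge => jn; rewrite addr0; move: IH.
  have /eqP -> : (j.+1 - n == 0)%N by rewrite subn_eq0.
  have /eqP -> : (j.+1 - n.+1 == 0)%N by rewrite subn_eq0 ltnW.
  by [].
have H2 n : \sum_(l < n) (if (j <= l)%N then f (l - j)%:R else 0) <= 2 - 2 / (1 + (n - j)%:R).
  elim: n => [|n IH]; first by rewrite big_ord0 sub0n addr0 divr1 subrr.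
  rewrite big_ord_recr /=; case: ifPn => [nj|].
    have := tel (n - j)%N; move: IH; rewrite subSn// S2; lra.
  rewrite -ltnNge => jn; rewrite addr0; move: IH.
  have /eqP -> : (n - j == 0)%N by rewrite subn_eq0 ltnW.
  have /eqP -> : (n.+1 - j == 0)%N by rewrite subn_eq0.
  by [].
have c1 : 2 / (1 + (j.+1 - M)%:R) <= 2 :> R.
  by rewrite ler_pdivrMr ?ltr_pwDl// ler_peMr// lerDl.
have c2 : 0 <= 2 / (1 + (M - j)%:R) :> R by rewrite divr_ge0// addr_ge0.
apply: (@le_trans _ _ (2 + 2)); last by lra.
apply: le_trans (lerD (le_trans (H1 M) c1) (le_trans (H2 M) (_ : _ <= 2))); last by lra.
rewrite -big_split /=; apply: ler_sum => l _.
have [lj|jl] := leqP l j.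
  by rewrite -natrB// ger0_norm// lerDl; case: ifP.
by rewrite add0r ltnW// distrC -natrB 1?ltnW// ger0_norm.
Qed.

End Dirichlet.

Section CubeBound.
Context {R : realType} {d : measure_display} {T : measurableType d} (P : probability T R).
Variable W : T -> R.
Hypotheses (bW : bmf W) (W0 : forall x, 0 <= W x).

Lemma bmc_weighted_eC (f : T -> R) : measurable_fun setT f ->
  bmc (fun x => Complex (W x) 0 * eC (f x)).
Proof. by move=> mf; apply: bmcM; [exact: bmc_real|exact: bmc_eC]. Qed.

Lemma bmf_weighted_sqr (I : finType) (theta : I -> T -> R) : (forall i, measurable_fun setT (theta i)) ->
  bmf (fun x => W x * normc (\sum_i eC (theta i x)) ^+ 2).
Proof.
move=> mt; apply: bmfM => //.
have b : bmf (fun x => normc (\sum_i eC (theta i x))).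
  by apply: bmc_norm; apply: bmc_sum => i; exact: bmc_eC.
by under eq_fun do rewrite expr2; exact: bmfM.
Qed.

Lemma Ex_sqr_sum_le (I : finType) (theta : I -> T -> R) : (forall i, measurable_fun setT (theta i)) ->
  Ex P (fun x => W x * normc (\sum_i eC (theta i x)) ^+ 2) <=
  \sum_i \sum_j normc (cEx P (fun x => Complex (W x) 0 * eC (theta i x - theta j x))).
Proof.
move=> mt.
have bij i j : bmc (fun x => Complex (W x) 0 * eC (theta i x - theta j x)).
  by apply: bmc_weighted_eC; exact: measurable_funB.
rewrite (eq_Ex P (g := fun x => \sum_i \sum_j
    Re (Complex (W x) 0 * eC (theta i x - theta j x)))); last first.
  move=> x; rewrite normc_sqr Re_sum Im_sum !expr2 !mulr_sumr -big_split mulr_sumr /=.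
  apply: eq_bigr => i _; rewrite !mulr_suml -big_split mulr_sumr /=.
  apply: eq_bigr => j _; rewrite mul0r subr0 cosB.
  by ring.
rewrite Ex_sum; last by move=> i; apply: bmf_sum => j; have [] := bij i j.
apply: ler_sum => i _; rewrite Ex_sum; last by move=> j; have [] := bij i j.
apply: ler_sum => j _.
exact: le_trans (ler_norm _) (Re_le_normc (cEx P (fun x => Complex (W x) 0 * eC (theta i x - theta j x)))).
Qed.

Variable Z : T -> R[i].
Hypothesis mZ : measurable_fun setT Z.

(** On [A] the two Dirichlet sums have moduli at least M1 / 2 and M2 / 2, so the indicator is at
    most 16 / (M1 M2)^2 times the square of their product. Expanding the square leaves transforms at
    differences of frequencies, whose moduli sum to at most C (4 M1) (4 M2); this gives 256 as 16
    times 16. *)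
Lemma cube_bound (M1 M2 : nat) (a b C : R) (A : set R[i]) : (0 < M1)%N -> (0 < M2)%N ->
  (forall j j' l l', (j < M1)%N -> (j' < M1)%N -> (l < M2)%N -> (l' < M2)%N ->
    normc (Psi P W Z (Complex (j%:R - j'%:R) (- (l%:R - l'%:R)))) <=
    C / ((1 + `|j%:R - j'%:R|) ^+ 2 * (1 + `|l%:R - l'%:R|) ^+ 2)) ->
  measurable A ->
  (forall z, A z -> (forall j, (j < M1)%N -> 0 <= j%:R * (Re z - a) <= 1) /\
     (forall l, (l < M2)%N -> 0 <= l%:R * (Im z - b) <= 1)) ->
  0 <= C ->
  Ex P (fun x => W x * \1_A (Z x)) <= 256 * C / (M1%:R * M2%:R).
Proof.
move=> M10 M20 hC mA hA C0.
have m1 : 0 < M1%:R :> R by rewrite ltr0n.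
have m2 : 0 < M2%:R :> R by rewrite ltr0n.
pose theta (i : 'I_M1 * 'I_M2) x : R := i.1%:R * (Re (Z x) - a) + i.2%:R * (Im (Z x) - b).
have [mR mI] := (measurable_complexP _).1 mZ.
have mt i : measurable_fun setT (theta i).
  by apply: measurable_funD; apply: measurable_funM; try exact: measurable_cst;
    apply: measurable_funB; try exact: measurable_cst.
pose c : R := 16 / (M1%:R * M2%:R) ^+ 2.
have c0 : 0 < c by rewrite divr_gt0// exprn_gt0// mulr_gt0.
have b1 := bmf_weighted_sqr mt.
apply: (@le_trans _ _ (Ex P (fun x => c * (W x * normc (\sum_i eC (theta i x)) ^+ 2)))).
  apply: le_Ex; [exact: bmf_weighted|exact: bmfZ|].
  move=> x; rewrite mulrCA ler_wpM2l// indicE.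
  case: (boolP (Z x \in A)) => hx; last by rewrite mulr_ge0 ?sqr_ge0// ltW.
  have [h1 h2] := hA _ (set_mem hx).
  have -> : \sum_i eC (theta i x) = (\sum_(j < M1) eC (j%:R * (Re (Z x) - a))) *
      (\sum_(l < M2) eC (l%:R * (Im (Z x) - b))).
    rewrite big_distrlr /= pair_big /=; apply: eq_bigr => i _; exact: eCD.
  have g1 := dirichlet_ge h1; have g2 := dirichlet_ge h2.
  rewrite normcM /c; rewrite -ler_pdivrMl// invf_div mulr1.
  apply: (@le_trans _ _ ((M1%:R / 2 * (M2%:R / 2)) ^+ 2)).
    by rewrite le_eqVlt; apply/orP; left; apply/eqP; field.
  apply: lerXn2r; rewrite ?nnegrE.
  - by rewrite !mulr_ge0// ltW.
  - by rewrite mulr_ge0// normc_ge0.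
  by apply: ler_pM => //; rewrite divr_ge0// ltW.
rewrite ExZ//; apply: (@le_trans _ _ (c * (C * ((M1%:R * 4) * (M2%:R * 4))))); last first.
  by rewrite le_eqVlt; apply/orP; left; apply/eqP; rewrite /c; field; rewrite !gt_eqF.
rewrite ler_pM2l//; apply: le_trans (Ex_sqr_sum_le mt) _.
pose f (M : nat) (j l : 'I_M) : R := ((1 + `|j%:R - l%:R|) ^+ 2)^-1.
have f0 (M : nat) (j l : 'I_M) : 0 <= f M j l by rewrite invr_ge0 sqr_ge0.
have fsum (M : nat) : \sum_(j < M) \sum_(l < M) f M j l <= M%:R * 4.
  apply: (@le_trans _ _ (\sum_(j < M) 4)).
    by apply: ler_sum => j _; exact: sum_inv_sq.
  by rewrite big_const iter_addr_0 card_ord mulr_natl.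
apply: (@le_trans _ _ (\sum_(i : 'I_M1 * 'I_M2) \sum_(i' : 'I_M1 * 'I_M2)
    C * (f M1 i.1 i'.1 * f M2 i.2 i'.2))).
  apply: ler_sum => i _; apply: ler_sum => i' _.
  pose t : R[i] := Complex (i.1%:R - i'.1%:R) (- (i.2%:R - i'.2%:R)).
  pose s : R := (i.1%:R - i'.1%:R) * a + (i.2%:R - i'.2%:R) * b.
  (* Recentring at (a, b) only produces a phase of modulus 1. *)
  rewrite (_ : cEx P _ = eC (- s) * Psi P W Z t); last first.
    rewrite /Psi -cExZ; last exact: bmc_PsiE.
    apply: eq_cEx => x; rewrite mulrCA -eCD; congr (_ * eC _).
    by rewrite cReM /theta /s /=; ring.
  rewrite normcM normc_eC mul1r; apply: le_trans (hC _ _ _ _ _ _ _ _) _ => //.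
  by rewrite /f invfM.
under eq_bigr do rewrite -mulr_sumr.
rewrite -mulr_sumr; apply: ler_wpM2l => //.
apply: (@le_trans _ _ ((\sum_j \sum_l f M1 j l) * (\sum_j \sum_l f M2 j l))); last first.
  by apply: ler_pM => //; apply: sumr_ge0 => j _; apply: sumr_ge0.
rewrite le_eqVlt; apply/orP; left; apply/eqP.
rewrite [RHS]big_distrlr [RHS]pair_big; apply: eq_bigr => i _.
by rewrite [RHS]big_distrlr [RHS]pair_big.
Qed.

End CubeBound.

(** The exponent 4 is split evenly, as 1 + |t| dominates both 1 + |p| and 1 + |q|. For M2 = 1 only
    real frequencies occur, which is the case of the line. *)
Lemma decay_cube {R : realType} {d : measure_display} {T : measurableType d} (P : probability T R)
    (W : T -> R) (Z : T -> R[i]) (V : set R[i]) (C a b : R) (M1 M2 : nat) (A : set R[i]) :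
  bmf W -> (forall x, 0 <= W x) -> measurable_fun setT Z -> 0 <= C -> (0 < M1)%N -> (0 < M2)%N ->
  (forall t, V t -> normc t <= M1%:R + M2%:R -> normc (Psi P W Z t) <= C / (1 + normc t) ^+ 4) ->
  (forall x y, (M2 = 1%N -> y = 0) -> V (Complex x y)) -> measurable A ->
  (forall z, A z -> (forall j, (j < M1)%N -> 0 <= j%:R * (Re z - a) <= 1) /\
     (forall l, (l < M2)%N -> 0 <= l%:R * (Im z - b) <= 1)) ->
  Ex P (fun x => W x * \1_A (Z x)) <= 256 * C / (M1%:R * M2%:R).
Proof.
move=> bW W0 mZ C0 M10 M20 hdec hV mA hA.
refine (@cube_bound R d T P W bW W0 Z mZ M1 M2 a b C A M10 M20 _ mA hA C0) => j j' l l' hj hj' hl hl'.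
have dist (M k k' : nat) : (k < M)%N -> (k' < M)%N -> `|k%:R - k'%:R| <= M%:R :> R.
  move=> hk hk'; rewrite ler_norml lerBrDl lerBlDl.
  have h1 : k%:R <= M%:R :> R by rewrite ler_nat ltnW.
  have h2 : k'%:R <= M%:R :> R by rewrite ler_nat ltnW.
  have h3 : 0 <= k%:R :> R by [].
  have h4 : 0 <= k'%:R :> R by [].
  by apply/andP; split; lra.
set p := j%:R - j'%:R; set q := l%:R - l'%:R.
set t : R[i] := Complex p (- q).
have tp : `|p| <= normc t by exact: (Re_le_normc t).
have tq : `|q| <= normc t by rewrite -normrN; exact: (Im_le_normc t).
apply: le_trans (hdec t _ _) _.
- apply: hV => M21; rewrite /q M21 in hl hl' *.
  by move: hl hl'; rewrite !ltnS !leqn0 => /eqP -> /eqP ->; rewrite subrr oppr0.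
- apply: le_trans (normc_le_ReIm t) _; rewrite /t /= normrN.
  by apply: lerD; apply: dist.
apply: ler_wpM2l => //.
have p0 := normr_ge0 p; have q0 := normr_ge0 q.
rewrite lef_pV2 ?posrE; last 2 first.
- by rewrite exprn_gt0//; lra.
- by rewrite mulr_gt0 ?exprn_gt0//; lra.
have sq (u : R) : 0 <= u -> u <= normc t -> (1 + u) ^+ 2 <= (1 + normc t) ^+ 2.
  by move=> u0 ut; apply: lerXn2r; rewrite ?nnegrE; lra.
have -> : (1 + normc t) ^+ 4 = (1 + normc t) ^+ 2 * (1 + normc t) ^+ 2 by rewrite -exprD.
by apply: ler_pM; [exact: sqr_ge0|exact: sqr_ge0|exact: sq|exact: sq].
Qed.

(** * Dyadic grids on the line and in the plane *)

Section Grid.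
Context {R : realType}.
Implicit Types x : R.

Definition cell n x : int := Num.floor (2 ^+ n * x).

Lemma cell_eq n k x : (cell n x == k) = (k%:~R / 2 ^+ n <= x < (k + 1)%:~R / 2 ^+ n).
Proof.
have p : 0 < 2 ^+ n :> R by rewrite exprn_gt0.
by rewrite /cell floor_eq ler_pdivrMr// ltr_pdivlMr// mulrC.
Qed.

Lemma cell_half n x : cell n x = (cell n.+1 x %/ 2)%Z.
Proof.
set k := cell n.+1 x.
have /andP[k1 k2] : k%:~R <= 2 ^+ n.+1 * x < (k + 1)%:~R by exact: floor_itv.
have hk := divz_eq k 2; set m := (k %/ 2)%Z in hk *.
have r0 : (0 <= (k %% 2)%Z) by rewrite modz_ge0.
have r1 : ((k %% 2)%Z < 2) by rewrite ltz_pmod.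
apply: floor_def; move: k1 k2; rewrite exprS -mulrA hk; set r := (k %% 2)%Z in r0 r1 *.
have : (0 : R) <= r%:~R by rewrite ler0z.
have : r%:~R <= 1 :> R by rewrite lerz1 -ltzD1.
rewrite !rmorphD rmorphM /=; move: (2 ^+ n * x) (m%:~R : R) (r%:~R : R) => u v w.
rewrite (_ : 2%:~R = 2 :> R)// => h1 h2 h3 h4; apply/andP; split; lra.
Qed.

Lemma cell_preimage n k : cell n @^-1` [set k] = `[k%:~R / 2 ^+ n, (k + 1)%:~R / 2 ^+ n[%classic.
Proof.
by rewrite predeqE => x /=; rewrite in_itv /= -cell_eq; split => /eqP.
Qed.

Lemma measurable_cell n k : measurable (cell n @^-1` [set k] : set (measurableTypeR R)).
Proof. by rewrite cell_preimage; exact: measurable_itv. Qed.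

Lemma lebesgue_cell n k : lebesgue_measure (cell n @^-1` [set k] : set (measurableTypeR R)) = ((2 ^+ n)^-1)%:E.
Proof.
have p : 0 < 2 ^+ n :> R by rewrite exprn_gt0.
rewrite cell_preimage lebesgue_measure_itv /= lte_fin ltr_pM2r ?invr_gt0// ltr_int ltzD1 lexx.
by rewrite -EFinB -mulrBl -rmorphB /= addrAC subrr add0r mul1r.
Qed.

Definition zbox (m : nat) : set int := [set k | - m%:Z <= k < m%:Z].

Lemma cell0_box m : cell 0%N @^-1` zbox m = `[- m%:R, m%:R[%classic.
Proof.
rewrite predeqE => x /=; rewrite in_itv /= /zbox /cell expr0 mul1r /=.
by rewrite floor_ge_int floor_lt_int rmorphN.
Qed.

Lemma bigcup_zbox : \bigcup_m zbox m = setT.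
Proof.
rewrite -subTset => k _; exists `|k|.+1%N => //; rewrite /zbox /=.
have := ler_norm k; have := ler_norm (- k); rewrite normrN -addn1 PoszD abszE.
by move: `|k| => u h1 h2; apply/andP; split; lra.
Qed.

Lemma cell_box_fin m : (lebesgue_measure (cell 0%N @^-1` zbox m : set (measurableTypeR R)) < +oo)%E.
Proof.
rewrite cell0_box lebesgue_measure_itv /=; case: ifP => _ //.
by rewrite -EFinB ltry.
Qed.

Lemma cell_dirichlet n k x j : cell n x = k -> (j < 2 ^ n)%N ->
  0 <= j%:R * (x - k%:~R / 2 ^+ n) <= 1.
Proof.
have p : 0 < 2 ^+ n :> R by rewrite exprn_gt0.
move=> /eqP; rewrite cell_eq => /andP[h1 h2] hj.
have u0 : 0 <= x - k%:~R / 2 ^+ n by rewrite subr_ge0.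
rewrite mulr_ge0//=; apply: (@le_trans _ _ (2 ^+ n * (x - k%:~R / 2 ^+ n))).
  by rewrite ler_wpM2r// -natrX ler_nat ltnW.
rewrite mulrBr mulrCA divff ?gt_eqF// mulr1.
by move: h2; rewrite ltr_pdivlMr// rmorphD /= mulrC; lra.
Qed.

(** An open half-line is the union of the dyadic cells it contains, so the cells generate the Borel
    sets. *)
Lemma ray_cells (a : R) : `]-oo, a[%classic =
  \bigcup_n (cell n @^-1` [set k | (k + 1)%:~R <= 2 ^+ n * a]).
Proof.
rewrite predeqE => x /=; rewrite in_itv /=; split => [xa|[n _ /= h]].
  have e0 : 0 < a - x by rewrite subr_gt0.
  have h2 : 0 <= (2^-1 : R) < 1 by apply/andP; split; lra.
  have [n hn] := exprn_small h2 e0.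
  exists n => //=; rewrite rmorphD /=.
  have := floor_le (2 ^+ n * x); rewrite -/(cell n x).
  have : 1 <= 2 ^+ n * (a - x).
    by rewrite -ler_pdivrMl ?exprn_gt0// mulr1 -exprVn ltW.
  rewrite mulrBr; move: (2 ^+ n * a) (2 ^+ n * x) ((cell n x)%:~R) => u v w.
  by rewrite rmorph1; lra.
have /andP[_] : (cell n x)%:~R <= 2 ^+ n * x < (cell n x + 1)%:~R by exact: floor_itv.
by move=> /lt_le_trans/(_ h); rewrite ltr_pM2l ?exprn_gt0.
Qed.

End Grid.

Lemma sigma_preimage {R : realType} (E : pointedType) (S : set (set E)) (f : E -> R) :
  (forall a, <<s S>> (f @^-1` `]-oo, a[%classic)) ->
  forall A : set (measurableTypeR R), measurable A -> <<s S>> (f @^-1` A).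
Proof.
have mE : (measurable : set (set (measurableTypeR R))) = <<s @RGenInftyO.G R >>.
  exact: RGenInftyO.measurableE.
move=> hf A; rewrite mE; move: A; apply: smallest_sub.
  split.
  - by rewrite preimage_set0; exact: sigma_algebra0.
  - by move=> A hA; rewrite setTD preimage_setC; exact: sigma_algebraC.
  - by move=> F hF; rewrite preimage_bigcup; exact: sigma_algebra_bigcup.
by move=> _ [x ->].
Qed.

(* [Psi P (fun=> 1) Z] becomes integrable on [V] after a small part of the
   probability space is removed, with a different part for each scale [B]. *)
Definition truncated_decay {R : realType} {d : measure_display} {T : measurableType d}
    (P : probability T R) (Z : T -> R[i]) (V : set R[i]) :=
  forall e : R, 0 < e <= 16^-1 -> exists2 C : R, 0 < C &
    forall B : R, exists W : T -> R, [/\ bmf W, forall x, 0 <= W x <= 1,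
      Ex P (fun x => 1 - W x) <= e &
      forall t, V t -> normc t <= B -> normc (Psi P W Z t) <= C / (1 + normc t) ^+ 4].

Section AbsolutelyContinuous.
Context {R : realType} {d : measure_display} {T : measurableType d} (P : probability T R).
Variables (Z : T -> R[i]).
Hypothesis mZ : measurable_fun setT Z.

(** Both dimensions are treated at once: [M2] is 1 for the line and 2^n for the plane, and [cube] is
    the region of C that corresponds to a cell. *)
Lemma null_of_decay {d'} {E : measurableType d'} {K : countType} (Y : {mfun T >-> E})
    (lam : {measure set E -> \bar R}) (V : set R[i]) (g : nat -> E -> K) (f : nat -> K -> K)
    (box : nat -> set K) (M2 : nat -> nat) (a b : nat -> K -> R) (cube : nat -> K -> set R[i]) :
  truncated_decay P Z V ->
  (forall n k, measurable (g n @^-1` [set k])) ->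
  (forall n x, g n x = f n (g n.+1 x)) ->
  measurable `<=` <<s [set B | exists n S, B = g n @^-1` S] >> ->
  (forall m, (lam (g 0%N @^-1` box m) < +oo)%E) -> \bigcup_m box m = setT ->
  (forall n k, measurable (cube n k)) ->
  (forall n k x, g n (Y x) = k <-> cube n k (Z x)) ->
  (forall n k z, cube n k z -> (forall j, (j < 2 ^ n)%N -> 0 <= j%:R * (Re z - a n k) <= 1) /\
     (forall l, (l < M2 n)%N -> 0 <= l%:R * (Im z - b n k) <= 1)) ->
  (forall n, (0 < M2 n)%N) ->
  (forall n x y, (M2 n = 1%N -> y = 0) -> V (Complex x y)) ->
  (forall n k, lam (g n @^-1` [set k]) = (((2 ^ n)%:R * (M2 n)%:R)^-1)%:E) ->
  forall A, measurable A -> lam A = 0%E -> P (Y @^-1` A) = 0%E.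
Proof.
move=> hdec mg gf hG fbox Ubox mcube hcube cubeP M20 hV lamE.
apply: (null_of_grid_bound (Q := distribution P Y) mg gf hG fbox Ubox) => e e0.
pose e' := Num.min e 16^-1.
have e'0 : 0 < e' <= 16^-1 by rewrite lt_min e0 invr_gt0 ltr0n ge_min lexx orbT.
have [C C0 hC] := hdec _ e'0.
exists (256 * C) => [|n]; first by rewrite mulr_ge0// ltW.
(* The kernels at level [n] involve only frequencies of modulus at most 2^n + M2 n, so the
   functional may be chosen for this range. *)
have [W [bW W01 W1 WC]] := hC ((2 ^ n)%:R + (M2 n)%:R).
have mY : measurable_fun setT Y by exact: measurable_funPT.
exists (weighted_law P Y W); split.
- move=> B mB; apply: law_le_weighted => //.
  by apply: le_trans W1 _; rewrite ge_min lexx.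
- by move=> F mF tF; apply: weighted_law_bigcup.
- rewrite /weighted_law (eq_Ex P (g := fun=> 0)) ?Ex_cst// => x.
  by rewrite indicE in_set0 mulr0.
move=> k; rewrite weighted_law_ge0//= lamE -EFinM lee_fin.
have -> : Ex P (fun x => W x * \1_(g n @^-1` [set k]) (Y x)) =
    Ex P (fun x => W x * \1_(cube n k) (Z x)).
  apply: eq_Ex => x; rewrite !indicE; congr (W x * (nat_of_bool _)%:R).
  by apply/idP/idP => /set_mem/hcube/mem_set.
have W0 x : 0 <= W x by have /andP[] := W01 x.
apply: (decay_cube bW W0 mZ (ltW C0) _ (M20 n) WC (hV n) (mcube n k) (@cubeP n k)).
by rewrite expn_gt0.
Qed.

Lemma null_line : truncated_decay P Z [set t | Im t = 0] ->
  forall A : set (measurableTypeR R), measurable A -> lebesgue_measure A = 0%E ->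
  P ((Re \o Z) @^-1` A) = 0%E.
Proof.
move=> hdec.
have [mR mI] := (measurable_complexP _).1 mZ.
pose Y : {mfun T >-> measurableTypeR R} :=
  HB.pack (Re \o Z : T -> measurableTypeR R) (isMeasurableFun.Build _ _ _ _ (Re \o Z : T -> measurableTypeR R) mR).
apply: (@null_of_decay _ _ _ Y lebesgue_measure [set t | Im t = 0] (@cell R)
  (fun _ k => (k %/ 2)%Z) zbox (fun=> 1%N) (fun n k => k%:~R / 2 ^+ n) (fun _ _ => 0)
  (fun n k => [set z | cell n (Re z) = k])) => //.
- exact: measurable_cell.
- exact: cell_half.
- apply: (@sigma_preimage R R _ idfun) => a; rewrite /= preimage_id ray_cells.
  apply: sigma_algebra_bigcup => n; apply: sub_sigma_algebra.
  by exists n, [set k | (k + 1)%:~R <= 2 ^+ n * a].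
- exact: cell_box_fin.
- exact: bigcup_zbox.
- move=> n k; rewrite -[X in measurable X]setTI; exact: (measurable_Re measurableT (measurable_cell n k)).
- move=> n k z hz; split=> [j hj|[|//] _]; first exact: cell_dirichlet.
  by rewrite mul0r lexx ler01.
- by move=> _ x y /(_ erefl).
- by move=> n k; rewrite mulr1 natrX; exact: lebesgue_cell.
Qed.

Lemma null_plane : truncated_decay P Z setT ->
  forall A : set (measurableTypeR R * measurableTypeR R), measurable A ->
  (@lebesgue_measure R \x @lebesgue_measure R)%E A = 0%E ->
  P ((fun x => (Re (Z x), Im (Z x))) @^-1` A) = 0%E.
Proof.
move=> hdec.
have [mR mI] := (measurable_complexP _).1 mZ.
pose Yf x : measurableTypeR R * measurableTypeR R := (Re (Z x), Im (Z x)).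
have mY : measurable_fun setT Yf by exact: measurable_fun_pair.
pose Y : {mfun T >-> (measurableTypeR R * measurableTypeR R)%type} :=
  HB.pack Yf (isMeasurableFun.Build _ _ _ _ Yf mY).
pose g n (x : measurableTypeR R * measurableTypeR R) : int * int := (cell n x.1, cell n x.2).
have gE n k : g n @^-1` [set k] = (cell n @^-1` [set k.1]) `*` (cell n @^-1` [set k.2]).
  by rewrite predeqE => -[x y]; case: k => k l; rewrite /g /=; split => [[<- <-]//|[/= -> ->]].
apply: (@null_of_decay _ _ _ Y (@lebesgue_measure R \x @lebesgue_measure R)%E setT g
  (fun _ k => ((k.1 %/ 2)%Z, (k.2 %/ 2)%Z)) (fun m => zbox m `*` zbox m) (fun n => 2 ^ n)%N
  (fun n k => k.1%:~R / 2 ^+ n) (fun n k => k.2%:~R / 2 ^+ n)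
  (fun n k => [set z | g n (Re z, Im z) = k])) => //.
- by move=> n k; rewrite gE; apply: measurableX; exact: measurable_cell.
- by move=> n x; rewrite /g -!cell_half.
- set S := [set B | _].
  have h1 A : measurable A -> <<s S >> (fst @^-1` A).
    apply: sigma_preimage => a; rewrite ray_cells preimage_bigcup.
    apply: sigma_algebra_bigcup => n; apply: sub_sigma_algebra.
    by exists n, [set k | (k.1 + 1)%:~R <= 2 ^+ n * a].
  have h2 A : measurable A -> <<s S >> (snd @^-1` A).
    apply: sigma_preimage => a; rewrite ray_cells preimage_bigcup.
    apply: sigma_algebra_bigcup => n; apply: sub_sigma_algebra.
    by exists n, [set k | (k.2 + 1)%:~R <= 2 ^+ n * a].
  apply: smallest_sub; first exact: smallest_sigma_algebra.
  by move=> B [[A mA <-]|[A mA <-]]; rewrite setTI; [exact: h1|exact: h2].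
- move=> m; rewrite (_ : _ @^-1` _ = (cell 0 @^-1` zbox m) `*` (cell 0 @^-1` zbox m))//.
  have mb : measurable (cell 0 @^-1` zbox m : set (measurableTypeR R)).
    by rewrite cell0_box; exact: measurable_itv.
  apply: (eq_ind_r (fun u => (u < +oo)%E) _ (product_measure1E lebesgue_measure lebesgue_measure mb mb)).
  by apply: lte_mul_pinfty => //; rewrite ?ge0_fin_numE ?cell_box_fin.
- rewrite -subTset => -[k l] _.
  have [m _ hm] : (\bigcup_m zbox m) k by rewrite bigcup_zbox.
  have [m' _ hm'] : (\bigcup_m zbox m) l by rewrite bigcup_zbox.
  exists (maxn m m') => //; split => /=.
    move: hm; rewrite /zbox /= => /andP[h1 h2].
    have h3 : (m <= maxn m m')%N by exact: leq_maxl.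
    have : m%:Z <= (maxn m m')%:Z by rewrite lez_nat.
    by move: (maxn m m')%:Z => u; lra.
  move: hm'; rewrite /zbox /= => /andP[h1 h2].
  have : m'%:Z <= (maxn m m')%:Z by rewrite lez_nat leq_maxr.
  by move: (maxn m m')%:Z => u; lra.
- move=> n k.
  have mp : measurable_fun setT (fun z : R[i] => (Re z, Im z) : measurableTypeR R * measurableTypeR R).
    by apply: measurable_fun_pair; [exact: measurable_Re|exact: measurable_Im].
  rewrite -[X in measurable X]setTI; apply: (mp measurableT (g n @^-1` [set k])).
  by rewrite gE; apply: measurableX; exact: measurable_cell.
- move=> n k z /= hz; split=> j hj; apply: cell_dirichlet => //; first by rewrite -hz.
  by rewrite -hz.
- by move=> n; rewrite expn_gt0.
- move=> n k; rewrite gE.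
  apply: etrans (product_measure1E _ _ (measurable_cell n k.1) (measurable_cell n k.2)) _.
  by rewrite natrX invfM EFinM; congr (_ * _)%E; exact: lebesgue_cell.
Qed.

End AbsolutelyContinuous.

(** * Real weights and the support of the limit *)

Section RealWeights.
Context {R : realType} {d : measure_display} {T : measurableType d}.
Variables (P : probability T R) (X : T -> tree R) (q : set (cseq R) -> \bar R).
Hypothesis iidX : iid_tree P X q.
Variable Z : T -> R[i].
Hypothesis mZ : measurable_fun setT Z.
Hypothesis hS : forall J, smoothing_ineq P X J Z Z.

Let phi := charf P Z.
Let xi w := rootw (X w).

Lemma charf_ae_const t : ae_const P Z t -> normc (phi t) = 1.
Proof.
move=> [c hc]; rewrite /phi charfE -[RHS](normc_eC c) -(cEx_cst P (eC c)); congr normc.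
apply: cEx_ae; [exact: (bmc_eC (measurable_ReM t mZ))|exact: bmc_cst|].
by apply: filterS hc => w ->.
Qed.

Lemma ae_constZ t (s : R) : ae_const P Z t -> ae_const P Z (Complex s 0 * t).
Proof.
move=> [c hc]; exists (s * c); apply: filterS hc => w <-.
by rewrite -mulrA (cReM (Complex s 0)) /= mul0r subr0.
Qed.

(** Equality case of the smoothing inequality: a product of factors in [0, 1] with mean at least 1
    has all its factors equal to 1 almost surely. *)
Lemma charf_child t J del : normc (phi t) = 1 ->
  {ae P, forall w, forall j, (j < J)%N -> del <= normc (xi w j) -> normc (phi (t * xi w j)) = 1}.
Proof.
move=> ht.
pose b w (j : 'I_J) := if del <= normc (xi w j) then normc (phi (t * xi w j)) else 1.
have b01 w j : 0 <= b w j <= 1.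
  rewrite /b; case: ifP => _; last by rewrite ler01 lexx.
  by rewrite normc_ge0; exact: normc_charf_le1.
have fun1 : fun01 (fun=> 1 : R) :> Prop by apply: (@fun01_cst R); rewrite ler01 lexx.
have bb : bmf (fun w => \prod_(j < J) b w j).
  apply: bmf_prod => j; apply: bmf_if; [exact: (measurable_good_X iidX)| |exact: bmf_cst].
  apply: bmc_norm; apply: bmc_Psi => //; first exact: bmf_cst.
  by apply: measurable_funCM; [exact: measurable_cst|exact: (measurable_root_X iidX)].
have p01 w : 0 <= \prod_(j < J) b w j <= 1.
  by rewrite prodr_ge0 ?prodr_ile1// => j _; have /andP[] := b01 w j.
have le : normc (phi t) <= Ex P (fun w => \prod_(j < J) b w j).
  have := normc_psi_prod_good iidX mZ hS del J t fun1.
  by rewrite prod_good1.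
have b1 : bmf (fun w => 1 - \prod_(j < J) b w j) by apply: bmfB => //; exact: bmf_cst.
have E0 : Ex P (fun w => 1 - \prod_(j < J) b w j) = 0.
  apply/eqP; rewrite eq_le ExB ?Ex_cst//; last exact: bmf_cst.
  move: le; rewrite ht subr_le0 => -> /=; rewrite subr_ge0 -[leRHS](Ex_cst P).
  by apply: le_Ex => //; [exact: bmf_cst|move=> w; have /andP[] := p01 w].
have h0 w : 0 <= 1 - \prod_(j < J) b w j by rewrite subr_ge0; have /andP[] := p01 w.
apply: filterS (Ex_eq0 b1 h0 E0) => w /eqP; rewrite subr_eq0 => /eqP hw j jJ hj.
have bj : b w (Ordinal jJ) = normc (phi (t * xi w j)) by rewrite /b hj.
rewrite -bj; apply/eqP; rewrite eq_le; have /andP[_ ->] := b01 w (Ordinal jJ).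
rewrite /= hw (bigD1 (Ordinal jJ))//= ler_piMr//; first by have /andP[] := b01 w (Ordinal jJ).
by apply: prodr_ile1 => k _; exact: b01.
Qed.

(** Modulus 1 at a single frequency would leave lattice laws. Here it holds at t xi_j / (n + 1) for
    every [n], which contradicts the quadratic bound of [nonlattice_line] if Re(t xi_j Z) is not
    constant. *)
Lemma ae_const_child t : ae_const P Z t ->
  {ae P, forall w, forall j, ae_const P Z (t * xi w j)}.
Proof.
move=> ht.
(* Countably many [n], [J] and thresholds 1 / (m + 1) are handled together, so that one null set
   serves all of them. *)
have H : {ae P, forall w, forall n : nat, forall J : nat, forall m : nat, forall j, (j < J)%N -> m.+1%:R^-1 <= normc (xi w j) ->
    normc (phi (Complex n.+1%:R^-1 0 * t * xi w j)) = 1}.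
  apply: ae_foralln => n; apply: ae_foralln => J; apply: ae_foralln => m.
  by apply: charf_child; apply: charf_ae_const; exact: ae_constZ.
apply: filterS H => w hw j.
have [x0|x0] := eqVneq (xi w j) 0.
  exists 0; apply: nearW => w'; by rewrite x0 mulr0 mul0r.
apply: contrapT => /(nonlattice_line mZ)[r [c [r0 c0 hr]]].
have n0 : 0 < normc (xi w j) by rewrite normc_gt0.
have inv_lt (u : R) : 0 < u -> exists n : nat, n.+1%:R^-1 <= u.
  move=> u0; exists (Num.bound u^-1).
  rewrite -[leRHS]invrK lef_pV2 ?posrE ?invr_gt0//.
  by rewrite ltW// (lt_trans (archi_boundP _)) ?ltr_nat// invr_ge0 ltW.
have [m hm] := inv_lt _ n0; have [n hn] := inv_lt _ r0.
have i0 : 0 < n.+1%:R^-1 :> R by rewrite invr_gt0.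
have := hr n.+1%:R^-1; rewrite ger0_norm ?(ltW i0)// => /(_ hn).
rewrite mulrA (hw n j.+1 m j)// => h.
have p0 : 0 < c * n.+1%:R^-1 ^+ 2 by rewrite mulr_gt0// exprn_gt0.
by move: h; rewrite lerBrDl gerDr leNgt p0.
Qed.

(* Two linearly independent real linear forms determine [Z]. *)
Lemma degenerate_of_two (t u : R[i]) : t != 0 -> Im u != 0 ->
  ae_const P Z t -> ae_const P Z (t * u) -> degenerate P Z.
Proof.
move=> t0 u0 [a ha] [b hb].
pose y := (Re u * a - b) / Im u.
exists (Complex a y / t); apply: filterS2 ha hb => w ha hb.
apply: (mulfI t0); rewrite [RHS]mulrCA divff// mulr1; apply: complex_ext => //.
apply: (mulIf u0); rewrite [RHS]divfK// -hb mulrAC cReM ha.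
by rewrite (mulrC a) opprB addrC subrK.
Qed.

Lemma weights_real t : t != 0 -> ae_const P Z t -> ~ degenerate P Z ->
  {ae P, forall w, forall j, Im (xi w j) = 0}.
Proof.
move=> t0 ht nd; apply: filterS (ae_const_child ht) => w hw j.
have [//|u0] := eqVneq (Im (xi w j)) 0.
by case: nd; exact: (degenerate_of_two t0 u0 ht (hw j)).
Qed.

End RealWeights.

Section Support.
Context {R : realType} {d : measure_display} {T : measurableType d}.
Variables (P : probability T R) (Z : {RV P >-> R[i]}).

Let mZ : measurable_fun setT Z. Proof. exact: measurable_funPT. Qed.

Let mball (z : R[i]) (e : R) : measurable [set w | normc (Z w - z) < e].
Proof.
have m1 : measurable_fun setT (fun w => normc (Z w - z)).
  apply: measurable_normc; apply: measurable_funCD => //; exact: measurable_cst.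
have := m1 measurableT _ (measurable_itv `]-oo, e[); rewrite setTI.
by congr measurable; apply/seteqP; split=> w /=; rewrite in_itv.
Qed.

Lemma supp_real_of_ae : {ae P, forall w, Im (Z w) = 0} ->
  supp (distribution P Z) `<=` real_line.
Proof.
move=> hZ z hz; apply/eqP; apply: contrapT => /negP z0.
have e0 : 0 < `|Im z| by rewrite normr_gt0.
have := hz _ e0; rewrite lt_neqAle => /andP[+ _]; apply/negP; rewrite negbK eq_sym.
have -> : distribution P Z [set x | normc (x - z) < `|Im z|] =
    P [set w | normc (Z w - z) < `|Im z|] by [].
apply/eqP; apply: measure_negligible; first exact: mball.
apply: negligibleS hZ => w /= hw Iw; move: hw.
rewrite ltNge; apply/negP; rewrite negbK.
by apply: le_trans (Im_le_normc _); rewrite cImB Iw sub0r normrN.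
Qed.

Lemma rational_ball (z : R[i]) (e : R) : 0 < e -> exists (a b c : rat),
  normc (z - Complex (ratr a) (ratr b)) < ratr c /\
  forall x, normc (x - Complex (ratr a) (ratr b)) < ratr c -> normc (x - z) < e.
Proof.
move=> e0.
have [c] := rat_in_itvoo (divr_gt0 e0 (ltr0n R 2)); rewrite in_itv /= => /andP[c0 ce].
have near (u : R) : exists a : rat, `|u - ratr a| < ratr c / 2.
  have : u - ratr c / 2 < u + ratr c / 2 by lra.
  move=> /rat_in_itvoo[a]; rewrite in_itv /= => /andP[h1 h2]; exists a.
  by rewrite ltr_norml; apply/andP; split; lra.
have [a ha] := near (Re z); have [b hb] := near (Im z).
have hz : normc (z - Complex (ratr a) (ratr b)) < ratr c.
  apply: le_lt_trans (normc_le_ReIm _) _; rewrite cReB cImB /=.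
  by rewrite [ltRHS]splitr; exact: ltrD.
exists a, b, c; split => // x hx.
rewrite (_ : x - z = (x - Complex (ratr a) (ratr b)) - (z - Complex (ratr a) (ratr b))).
  by apply: le_lt_trans (normc_triangleB _ _) _; apply: lt_trans (ltrD hx hz) _; lra.
by ring.
Qed.

(** The complement of the support is covered by countably many rational balls of probability 0. *)
Lemma ae_real_of_supp : supp (distribution P Z) `<=` real_line ->
  {ae P, forall w, Im (Z w) = 0}.
Proof.
move=> hs; pose B (i : rat * rat * rat) : set T :=
  [set w | normc (Z w - Complex (ratr i.1.1) (ratr i.1.2)) < ratr i.2].
have H : {ae P, forall w, forall n : nat, forall i, unpickle n = Some i -> P (B i) = 0%E -> ~ B i w}.
  apply: ae_foralln => n; case: (unpickle n) => [i|]; last exact: aeW.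
  have [B0|B0] := pselect (P (B i) = 0%E).
    exists (B i); split; [exact: mball|exact: B0|].
    by move=> w /= hw; apply: contrapT => nB; apply: hw => j [<-].
  by apply: aeW => w j [<-].
apply: filterS H => w hw; apply: contrapT => I0.
have : ~ supp (distribution P Z) (Z w) by move/hs.
move=> /existsNP[e /not_implyP[e0 he]].
have [a [b [c [hc hx]]]] := rational_ball (Z w) e0.
apply: (hw (pickle (a, b, c)) (a, b, c)) => //; first exact: pickleK.
apply: measure_negligible; first exact: mball.
have P0 : P [set w' | normc (Z w' - Z w) < e] = 0%E.
  by apply/eqP; rewrite -measure_le0 leNgt; apply/negP.
exists [set w' | normc (Z w' - Z w) < e]; split; [exact: mball|exact: P0|].
by move=> w'; exact: hx.
Qed.

End Support.

Lemma Zt_real {R : realType} K n (x : tree R) : (forall v j, Im (x v j) = 0) -> Im (Zt K n x) = 0.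
Proof.
elim: n x => //= n IH x hx; rewrite Im_sum big1// => j _.
by rewrite cImM IH//= ?hx ?mulr0 ?mul0r ?addr0// => v k; exact: hx.
Qed.

Lemma ccvg_unique {R : realType} (u : nat -> R[i]) (a b : R[i]) : ccvg u a -> ccvg u b -> a = b.
Proof.
move=> /ccvgP[ar ai] /ccvgP[br bi]; apply: complex_ext.
  exact: (cvg_unique _ ar br).
exact: (cvg_unique _ ai bi).
Qed.
(** Convergence to [c] is the vanishing of the upper limit of the distances. Measurability allows
    this event to be transferred between trees of the same law. *)
Lemma measurable_ccvg {R : realType} {d} {E : measurableType d} (f : nat -> E -> R[i]) (c : R[i]) :
  (forall n, measurable_fun setT (f n)) -> measurable [set x | ccvg (fun n => f n x) c].
Proof.
move=> mf; pose g n x := (normc (f n x - c))%:E.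
have mg : measurable_fun setT (fun x => limn_esup (fun n => g n x)).
  apply: measurable_fun_limn_esup => n; apply/measurable_EFinP; apply: measurable_normc.
  by apply: measurable_funCD => //; exact: measurable_cst.
have := mg measurableT _ (emeasurable_set1 0%E); rewrite setTI.
congr measurable; apply/seteqP; split=> x /= h; last first.
  have /cvg_limn_einf_sup[_ //] : g n x @[n --> \oo] --> 0%E.
  by apply: cvg_EFin => //; exact: nearW.
have : g n x @[n --> \oo] --> 0%E.
  by apply: limn_esup_le_cvg => [|n]; [rewrite h|rewrite lee_fin normc_ge0].
by move=> /fine_cvgP[_].
Qed.

Lemma Im_ccvg {R : realType} (u : nat -> R[i]) (l : R[i]) :
  (forall n, Im (u n) = 0) -> ccvg u l -> Im l = 0.
Proof.
move=> hu /ccvgP[_]; rewrite (_ : (fun n => Im (u n)) = fun=> 0); last exact/funext.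
by move=> hi; exact: cvg_unique hi (cvg_cst 0).
Qed.

Section WeightSums.
Context {R : realType}.
Implicit Types x : tree R.

Lemma Zlim0 x : Zlim 0 x = 1.
Proof. by apply: Zlim_eventually; exists 0%N. Qed.

Lemma big_initial (xi a : nat -> R[i]) m K : (forall j, (xi j != 0) = (j < m)%N) -> (m <= K)%N ->
  \sum_(j < K) xi j * a j = \sum_(j < m) xi j * a j.
Proof.
move=> hm mK; rewrite (big_ord_widen _ (fun j => xi j * a j) mK) [RHS]big_mkcond.
apply: eq_bigr => j _; case: ifPn => // jm.
have /negbFE/eqP -> : (xi j != 0) = false by rewrite hm; exact: negbTE.
by rewrite mul0r.
Qed.

Lemma ZlimS n m x : initial_tree x -> (forall j, (rootw x j != 0) = (j < m)%N) ->
  Zlim n.+1 x = \sum_(j < m) rootw x j * Zlim n (subtree j x).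
Proof.
move=> ix hm; apply: ccvg_unique (ccvg_Zlim n.+1 ix) _.
apply: (ccvg_near (f := fun K => \sum_(j < m) rootw x j * Zt K n (subtree j x))).
  exists m => // K /= mK.
  exact/esym/(big_initial (fun j => Zt K n (subtree j x)) hm mK).
apply: ccvg_sum => j; apply: ccvgM; first exact: ccvg_cst.
by apply: ccvg_Zlim; exact: initial_subtree.
Qed.

Lemma ccvg_initial_sum (xi : nat -> R[i]) m : (forall j, (xi j != 0) = (j < m)%N) ->
  ccvg (fun K => \sum_(j < K) xi j) (\sum_(j < m) xi j).
Proof.
move=> hm; apply: ccvg_near (ccvg_cst (\sum_(j < m) xi j)).
exists m => // K /= mK.
have := big_initial (fun=> 1) hm mK.
by rewrite -!mulr_suml !mulr1 => ->.
Qed.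

Lemma Zlim_sum1 n x : initial_tree x ->
  (forall v, ccvg (fun K => \sum_(j < K) x v j) 1) -> Zlim n x = 1.
Proof.
elim: n x => [|n IH] x ix h1; first exact: Zlim0.
have [m _ hm] := ix [::].
rewrite (ZlimS n ix hm) (eq_bigr (fun j : 'I_m => rootw x j)).
  exact: ccvg_unique (ccvg_initial_sum hm) (h1 [::]).
move=> j _; rewrite IH ?mulr1//; first exact: initial_subtree.
by move=> v; exact: h1.
Qed.

End WeightSums.

Lemma measurable_real_weights {R : realType} :
  measurable [set xi : cseq R | forall j, Im ((xi : nat -> R[i]) j) = 0].
Proof.
rewrite (_ : [set _ | _] = \bigcap_j [set xi : cseq R | Im ((xi : nat -> R[i]) j) = 0]).
  apply: bigcapT_measurable => j.
  have := measurableT_comp (@measurable_Im R) (measurable_coord j).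
  by move=> /(_ measurableT _ (measurable_set1 0)); rewrite setTI.
by apply/seteqP; split=> xi /= h j => [_|]; exact: h.
Qed.

Section Reality.
Context {R : realType} {d0 : measure_display} {T0 : measurableType d0}
  {d : measure_display} {T : measurableType d}.
Variables (P0 : probability T0 R) (P : probability T R).
Variables (W : nat -> {RV P0 >-> R[i]}) (TV : seq nat -> nat -> {RV P >-> R[i]}).
Hypotheses (hW : weights_initial P0 W) (hcopies : copies_of P TV P0 W)
  (hindep : independent_copies P TV)
  (hNpos : {ae P0, forall w, (0 < nweights W w)%N}).
Variable Z : {RV P >-> R[i]}.
Hypothesis hZ : Zn_cvg_as P TV Z.

Let X := random_tree TV.
Let iidX := iid_random_tree hcopies hindep.
Let hinit := ae_initial hW hcopies hindep hNpos.

Lemma ccvg_Zlim_limit : {ae P, forall w, ccvg (fun n => Zlim n (X w)) (Z w)}.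
Proof.
apply: filterS2 hinit hZ => w iw; rewrite /ccvg.
by under [X in _ -> X @ _ --> _]eq_fun do rewrite Zlim_Zn//.
Qed.

Lemma limit_real : {ae P0, forall w, forall j, Im (W j w) = 0} -> {ae P, forall w, Im (Z w) = 0}.
Proof.
move=> hR.
have H : {ae P, forall w, forall v j, Im (X w v j) = 0}.
  apply: ae_forall_seq => v.
  exact/(ae_copies hcopies hindep v measurable_real_weights).
apply: filterS3 hinit H ccvg_Zlim_limit => w iw hw; apply: Im_ccvg => n.
by have [K0 /(_ _ (leqnn _)) <-] := Zt_Zlim n iw; exact: Zt_real.
Qed.

Lemma constant_real (c : R[i]) : {ae P, forall w, Z w = c} -> Im c = 0.
Proof.
move=> hc; have [->//|c0] := eqVneq c 0.
have mA := measurable_ccvg c (@measurable_Zlim R).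
set A := [set x | _] in mA.
have mXA (Y : T -> tree R) : measurable_fun setT Y -> measurable (Y @^-1` A).
  by move=> mY; have := mY measurableT _ mA; rewrite setTI.
have hA : {ae P, forall w, A (X w)}.
  by apply: filterS2 hc ccvg_Zlim_limit => w ->.
(* Each subtree has the law of the whole tree, so its sums converge to the same constant [c]. *)
have hAj : {ae P, forall w, forall j, A (subtree j (X w))}.
  apply: ae_foralln => j; have iidj := iid_tree_subtree iidX j.
  apply/(ae_prob1P P (mXA _ iidj.1)).
  have /(ae_prob1P P (mXA _ iidX.1)) <- := hA.
  exact: (iid_tree_same iidj iidX mA).
pose B := [set xi : cseq R | ccvg (fun K => \sum_(j < K) (xi : nat -> R[i]) j) 1].
have mB : measurable B.
  apply: measurable_ccvg => K.
  by apply: measurable_funC_sum => j; exact: measurable_coord.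
have hB : {ae P, forall w, B (X w [::])}.
  apply: filterS3 hinit hA hAj => w iw hw hwj.
  have [m _ hm] := iw [::].
  have h1 : ccvg (fun n => Zlim n.+1 (X w)) c.
    by rewrite /ccvg (cvg_shiftS (fun n => normc (Zlim n (X w) - c))).
  have h2 : ccvg (fun n => Zlim n.+1 (X w)) (\sum_(j < m) rootw (X w) j * c).
    rewrite (_ : (fun n => _) = fun n => \sum_(j < m) rootw (X w) j * Zlim n (subtree j (X w))).
      by apply: ccvg_sum => j; apply: ccvgM; [exact: ccvg_cst|exact: hwj].
    by apply/funext => n; exact: ZlimS.
  (* In the limit the recursion at the root reads c = (sum_j xi_j) c. *)
  have := ccvg_unique h1 h2; rewrite -mulr_suml => /esym/(canRL (mulfK c0)).
  rewrite divff// => h3.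
  by rewrite /B /= -[X in ccvg _ X]h3; exact: ccvg_initial_sum.
have hBv : {ae P, forall w, forall v, B (X w v)}.
  apply: ae_forall_seq => v.
  exact/(ae_copies hcopies hindep v mB)/(ae_copies hcopies hindep [::] mB).
(* A single tree with all these properties determines [c]: there every Z_n equals 1. *)
have /(@ae_witness _ _ _ P)[w [iw [Bw Aw]]] :
    {ae P, forall w, initial_tree (X w) /\ (forall v, B (X w v)) /\ A (X w)}.
  by apply: filterS3 hinit hBv hA => w ? ? ?.
have := ccvg_unique Aw; rewrite /= => E.
have -> : c = 1.
  apply: E; rewrite (_ : (fun n => _) = fun=> 1); first exact: ccvg_cst.
  by apply/funext => n; exact: Zlim_sum1.
by [].
Qed.

End Reality.

(** * Absolute continuity in the plane and on the line *)

Section Main.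
Context {R : realType} {d0 : measure_display} {T0 : measurableType d0}
  {d : measure_display} {T : measurableType d}.
Variables (P0 : probability T0 R) (P : probability T R).
Variables (W : nat -> {RV P0 >-> R[i]}) (TV : seq nat -> nat -> {RV P >-> R[i]}).
Hypotheses (hW : weights_initial P0 W) (hcopies : copies_of P TV P0 W)
  (hindep : independent_copies P TV)
  (hNpos : {ae P0, forall w, (0 < nweights W w)%N}).
Variables (Z : {RV P >-> R[i]}) (alpha : R).
Hypotheses (hZ : Zn_cvg_as P TV Z)
  (hNmean : (1 < 'E_P0[fun w => (nweights W w)%:R%R])%E)
  (alpha0 : 0 < alpha) (hmom : moment P0 W alpha = 1%E).

Let X := random_tree TV.
Let iidX := iid_random_tree hcopies hindep.
Let mZ : measurable_fun setT Z. Proof. exact: measurable_funPT. Qed.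
Let hS J : smoothing_ineq P X J Z Z.
Proof. exact: (smoothing_ineq_limit hW hcopies hindep hNpos J hZ). Qed.

Lemma decay_of_nonlattice (V : set R[i]) (r c : R) :
  {ae P, forall w, forall j t, V t -> V (t * rootw (X w) j)} -> 0 < r -> 0 < c ->
  (forall t, V t -> normc t <= r -> normc (charf P Z t) <= 1 - c * normc t ^+ 2) ->
  truncated_decay P Z V.
Proof.
move=> hV r0 c0 hnl e e01.
have [J [del0 [del00 hmean]]] := ngood_mean hW hcopies hindep hNmean.
have J0 : (0 < J)%N.
  case: J hmean => //; rewrite (eq_Ex P (g := fun=> 0)) ?Ex_cst ?ltr10// => w.
  by rewrite /ngood big_ord0.
have hm := fun del s => @alpha_moment _ _ _ _ _ _ _ _ _ hW hcopies hindep alpha J del s hmom alpha0.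
have hsm := no_good_small hW hcopies hindep hNpos J0.
have [w [C [w01 wmass C0 wdec]]] := good_functional iidX mZ hS hV del00 hmean alpha0 hm hsm r0 c0 hnl e01.
exists C => // B; have [k hk] := wdec B; exists (fun x => w k (X x)); split => //.
- exact: (bmf_comp_X iidX (w01 k)).
- by move=> x; have [_ /(_ (X x))] := w01 k.
- exact: wmass.
Qed.

Lemma real_of_ae_const t : t != 0 -> ae_const P Z t -> {ae P, forall w, Im (Z w) = 0}.
Proof.
move=> t0 ht; have [[c hc]|nd] := pselect (degenerate P Z).
  have c0 := constant_real hW hcopies hindep hNpos hZ hc.
  by apply: filterS hc => w ->.
apply: (limit_real hW hcopies hindep hNpos hZ).
apply/(ae_copies hcopies hindep [::] measurable_real_weights).
exact: (weights_real iidX mZ hS t0 ht nd).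
Qed.

Lemma abs_cont_plane : ~ (supp (distribution P Z) `<=` real_line) -> abs_cont_law_C Z.
Proof.
move=> ns.
have nc t : t != 0 -> ~ ae_const P Z t.
  by move=> t0 /(real_of_ae_const t0)/supp_real_of_ae.
have [r [c [r0 c0 hnl]]] := nonlattice_plane mZ nc.
have hdec : truncated_decay P Z setT.
  apply: (decay_of_nonlattice _ r0 c0); first exact: aeW.
  by move=> t _; exact: hnl.
move=> N hN A mA AN; have A0 := hN A mA AN.
have mC : measurable_fun setT (fun p : measurableTypeR R * measurableTypeR R => Complex p.1 p.2 : R[i]).
  by apply/measurable_complexP; split; [exact: measurable_fst|exact: measurable_snd].
have := mC measurableT _ mA; rewrite setTI => mA'.
have := null_plane mZ hdec mA' A0.
congr (_ = 0%E); congr (P _); apply/seteqP; split=> w /=; by case: (Z w).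
Qed.

Lemma abs_cont_line : supp (distribution P Z) `<=` real_line -> ~ degenerate P Z -> abs_cont_law_R Z.
Proof.
move=> /ae_real_of_supp hR nd.
have nc : ~ ae_const P Z 1.
  move=> [c hc]; apply: nd; exists (Complex c 0); apply: filterS2 hR hc => w I0.
  by rewrite mul1r => <-; apply: complex_ext.
have hi : ae_const P Z (Complex 0 1).
  by exists 0; apply: filterS hR => w I0; rewrite cReM I0 /= mul0r mulr0 subr0.
have i0 : Complex 0 1 != 0 :> R[i] by rewrite eq_complex /= oner_eq0 andbF.
have [r [c [r0 c0 hnl]]] := nonlattice_line mZ nc.
have hdec : truncated_decay P Z [set t | Im t = 0].
  apply: (decay_of_nonlattice _ r0 c0).
    apply: filterS (weights_real iidX mZ hS i0 hi nd) => w hw j t /= t0.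
    by rewrite cImM t0 hw mulr0 mul0r addr0.
  move=> t /= t0; have -> : t = Complex (Re t) 0 by exact: complex_ext.
  by rewrite normcR => /hnl; rewrite mulr1 -normrX ger0_norm ?sqr_ge0.
by move=> N hN A mA AN; exact: (null_line mZ hdec mA (hN A mA AN)).
Qed.

End Main.

Theorem theorem2p1 (R : realType)
    (d0 : measure_display) (Omega0 : measurableType d0)
    (P0 : probability Omega0 R)
    (d : measure_display) (Omega : measurableType d)
    (P : probability Omega R)
    (T : nat -> {RV P0 >-> R[i]})
    (TV : seq nat -> nat -> {RV P >-> R[i]})
    (Z : {RV P >-> R[i]}) (alpha : R)
    (hT : weights_initial P0 T)
    (hTmean : has_expectation P0 (weight_sum T) 1)
    (hcopies : copies_of P TV P0 T)
    (hindep : independent_copies P TV)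
    (hNpos : {ae P0, forall w, (0 < nweights T w)%N})
    (hNmean : (1 < 'E_P0[fun w => (nweights T w)%:R%R])%E)
    (halpha : 1 < alpha < 2)
    (hmalpha : moment P0 T alpha = 1%E)
    (hZas : Zn_cvg_as P TV Z)
    (hZL1 : Zn_cvg_L1 P TV Z) :
  [/\ (~ (supp (distribution P Z) `<=` real_line) ->
       ('E_P0[fun w => ((nweights T w)%:R ^+ 2)%R] < +oo)%E ->
       ('E_P0[fun w => ((nweights T w)%:R *
              \sum_(j < nweights T w) logp (normc (T j w)))%R] < +oo)%E ->
       abs_cont_law_C Z),
      (supp (distribution P Z) `<=` real_line ->
       ~ degenerate P Z ->
       ('E_P0[fun w => (nweights T w)%:R%R] < +oo)%E ->
       abs_cont_law_R Z)
    & ((forall j, {ae P0, forall w, real_line (T j w)}) ->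
       supp (distribution P Z) `<=` real_line /\
       (~ degenerate P Z ->
        ('E_P0[fun w => (nweights T w)%:R%R] < +oo)%E ->
        abs_cont_law_R Z))].
Proof.
have alpha0 : 0 < alpha by case/andP: halpha => /(lt_trans ltr01).
split=> [hs _ _|hs nd _|hreal].
- exact: (abs_cont_plane hT hcopies hindep hNpos hZas hNmean alpha0 hmalpha hs).
- exact: (abs_cont_line hT hcopies hindep hNpos hZas hNmean alpha0 hmalpha hs nd).
have hs : supp (distribution P Z) `<=` real_line.
  apply: supp_real_of_ae; apply: (limit_real hT hcopies hindep hNpos hZas).
  exact: ae_foralln.
split=> // nd _.
exact: (abs_cont_line hT hcopies hindep hNpos hZas hNmean alpha0 hmalpha hs nd).
Qed.
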